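(* Let $\beta\ge0$, $b\in2^{F^0}$, and let $u:\Omega\times[0,\infty)\to\mathcal H$ be the solution to the SPDE $du=\dot u\,dt$, $d\dot u=-2\beta\dot u\,dt+\Delta_bu\,dt+dW$, $u(0)=\dot u(0)=0$. Then there exists a version $\tilde u$ of $u$ such that the following holds: for all $T>0$, the restriction of $\tilde u$ to $\Omega\times[0,T]$ is almost surely essentially $(1-\frac{d_s}{2})$-H\''older continuous as a function from $[0,T]$ to $\mathcal H$.
   Context: Fractal setting. Let $M\ge2$, $I=\{1,\dots,M\}$, and let $F$ be a connected compact metric space with injective strict contractions $\psi_i:F\to F$ ($i\in I$), $F=\bigcup_i\psi_i(F)$. Put $\mathbb W_n=I^n$, $\mathbb W_*=\bigcup_{n\ge0}\mathbb W_n$, $\mathbb W=I^{\mathbb N}$, $\psi_w=\psi_{w_1}\circ\cdots\circ\psi_{w_n}$ and $F_w=\psi_w(F)$ for $w=w_1\cdots w_n\in\mathbb W_n$ (identity for the empty word). Let $\pi:\mathbb W\to F$ be the continuous surjection with $\{\pi(w)\}=\bigcap_n F_{w_1\cdots w_n}$. With $\sigma$ the left shift on $\mathbb W$ and $C=\pi^{-1}(\bigcup_{i\ne j}F_i\cap F_j)$, assume the post-critical set $P=\bigcup_{n\ge1}\sigma^n(C)$ is finite (so $(F,(\psi_i))$ is a p.c.f. self-similar set). Let $F^0=\pi(P)$, $F^n=\bigcup_{w\in\mathbb W_n}\psi_w(F^0)$. Let $(A_0,\mathbf r)$ be a regular irreducible harmonic structure: $A_0=(a_{xy})_{x,y\in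 F^0}$ is a real symmetric irreducible matrix with $a_{xy}\ge0$ for $x\ne y$ and zero row sums, $\mathbf r=(r_1,\dots,r_M)$ with $r_i\in(0,1)$, and, writing $\mathcal E_0(f,f)=\frac12\sum_{x,y\in F^0}a_{xy}(f(x)-f(y))^2$, $r_w=\prod_i r_{w_i}$ and $\mathcal E_n(f,f)=\sum_{w\in\mathbb W_n}r_w^{-1}\mathcal E_0(f\circ\psi_w|_{F^0},f\circ\psi_w|_{F^0})$ for $f:F^n\to\mathbb R$, one has $\mathcal E_0(f,f)=\min\{\mathcal E_1(g,g):g:F^1\to\mathbb R,\ g|_{F^0}=f\}$ for all $f:F^0\to\mathbb R$. Let $\mathcal D=\{f\in C(F):\sup_n\mathcal E_n(f|_{F^n},f|_{F^n})<\infty\}$, $\mathcal E(f,f)=\lim_n\mathcal E_n(f|_{F^n},f|_{F^n})$ (extended to a bilinear form by polarisation). Let $d_H$ be the unique real with $\sum_i r_i^{d_H}=1$, $d_s=\frac{2d_H}{d_H+1}$ (one has $d_H\ge1$, $d_s\in[1,2)$), and $\mu$ the Borel probability measure on $F$ with $\mu(F_w)=r_w^{d_H}$ for all $w\in\mathbb W_*$. Let $\mathcal H=L^2(F,\mu)$ with inner product $\langle\cdot,\cdot\rangle_\mu$ and norm $\Vert\cdot\Vert_\mu$. For $b\subseteq F^0$ (i.e. $b\in2^{F^0}$) let $\mathcal D_b=\{f\in\mathcal D:f|_{F^0\setminus b}=0\}$; $(\mathcal E,\mathcal D_b)$ is a Dirichlet form on $\mathcal H$ and $\Delta_b$ is its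 generator, the nonpositive self-adjoint operator with: $f\in\mathcal D(\Delta_b)$, $\Delta_bf=h$ iff $f\in\mathcal D_b$ and $\mathcal E(f,g)=-\langle h,g\rangle_\mu$ for all $g\in\mathcal D_b$. There is an orthonormal basis $(\phi^b_k)_{k\ge1}$ of $\mathcal H$ with $-\Delta_b\phi^b_k=\lambda^b_k\phi^b_k$, $0\le\lambda^b_1\le\lambda^b_2\le\cdots$. Noise and solution. $W$ is a cylindrical Wiener process on $\mathcal H$ on a probability space $(\Omega,\mathcal F,\mathbb P)$: $\mathbb E[\langle f,W(s)\rangle_\mu\langle W(t),g\rangle_\mu]=(s\wedge t)\langle f,g\rangle_\mu$. For $\lambda,\beta\ge0$, $V_\beta(\lambda,\cdot):[0,\infty)\to\mathbb R$ is the unique solution of $v''+2\beta v'+\lambda v=0$, $v(0)=0$, $v'(0)=1$. The unique global solution of the SPDE is the $\mathcal H$-valued centred Gaussian process $u(t)=\int_0^tV_\beta(-\Delta_b,t-s)\,dW(s)=\sum_{k\ge1}\left(\int_0^tV_\beta(\lambda^b_k,t-s)\langle\phi^b_k,dW(s)\rangle_\mu\right)\phi^b_k$. A version of $u$ is a process $\tilde u$ with $\tilde u(t)=u(t)$ a.s. for each $t$. A function $f:(M_1,d_1)\to(M_2,d_2)$ between metric spaces is essentially $\delta$-H\''older continuous ($\delta\in(0,1]$) if for each $\gamma\in(0,\delta)$ there is $C_\gamma>0$ with $d_2(f(x),f(y))\le C_\gamma d_1(x,y)^\gamma$ for all $x,y\in M_1$. *)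

(* Defs.v *)
From HB Require Import structures.
From mathcomp Require Import all_boot all_order all_algebra.
From mathcomp Require Import all_classical all_reals all_analysis.
From mathcomp Require Import measurable_realfun ess_sup_inf.

Set Implicit Arguments.
Unset Strict Implicit.
Unset Printing Implicit Defensive.
Import Order.TTheory GRing.Theory Num.Theory.
Import numFieldNormedType.Exports.
Local Open Scope classical_set_scope.
Local Open Scope ring_scope.

(* Measurable types are pointed, hence the base point. *)
#[short(type="pMetricType")]
HB.structure Definition PMetric (K : numDomainType) :=
  {T of Metric K T & isPointed T}.

Notation borelType T := (g_sigma_algebraType (@open T)).

(* [LspaceType] is a bare quotient by a.e. equality in the library; we equip it
   with its vector space operations, the L^p norm and the induced distance. *)

Section Lspace_normed.
Context d (T : measurableType d) (R : realType).
Variable mu : {measure set T -> \bar R}.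
Variables (p : \bar R) (p1 : (1 <= p)%E).
Local Notation Lsp := (LspaceType mu p1).
Local Notation Lf := (LfunType mu p1).
Local Open Scope quotient_scope.

HB.instance Definition _ := gen_eqMixin Lsp.
HB.instance Definition _ := gen_choiceMixin Lsp.

Lemma eq_Lnorm_ae (f g : T -> R) : measurable_fun setT f ->
  measurable_fun setT g -> f = g %[ae mu] ->
  'N[mu]_p[EFin \o f]%E = 'N[mu]_p[EFin \o g]%E.
Proof.
move=> mf mg fg; rewrite unlock /Lnorm; case: p p1 => [r r1||] //=.
- have mh (h : T -> R) : measurable_fun setT h ->
      measurable_fun setT (fun x => `|(EFin \o h) x| `^ r)%E.
    move=> mh; apply/measurable_EFinP.
    apply: (@measurableT_comp _ _ _ _ _ _ (@powR R ^~ r)) => //.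
    exact: measurableT_comp.
  congr (_ `^ _)%E; apply: ae_eq_integral => //; [exact: mh|exact: mh|].
  by apply: filter_app fg; apply: aeW => x h /=; rewrite h.
- move=> _; case: ifP => // _; apply: eq_ess_sup.
  by apply: filter_app fg; apply: aeW => x h /=; rewrite h.
Qed.

Lemma Lspace_repr_finite (f : Lsp) : finite_norm mu p (repr (LebesgueSpace.sort f)).
Proof. by case: f => f [[]]. Qed.

Let rep_in (f : Lsp) : (f : T -> R) \in Lfun mu p.
Proof.
apply/andP; split; first by rewrite inE; exact: (@measurable_funPT _ _ T (measurableTypeR R)).
by rewrite inE; exact: Lspace_repr_finite.
Qed.

Definition Lrepr (f : Lsp) : Lf := Lfun_Sub p1 (rep_in f).

Lemma Lrepr_fun (f : Lsp) : Lrepr f = f :> (T -> R). Proof. by []. Qed.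

Let mfR (f : Lf) : {mfun T >-> measurableTypeR R} :=
  @mfun_Sub _ _ T (measurableTypeR R) f (mem_set (@measurable_funPT _ _ T R f)).

Let cls (f : Lf) : {mfun_ mu, T >-> measurableTypeR R} :=
  \pi_({mfun_ mu, T >-> measurableTypeR R}) (mfR f).

Let mrepr (f : {mfun_ mu, T >-> measurableTypeR R}) :
  measurable_fun setT (repr f : T -> R).
Proof. exact: (@measurable_funPT _ _ T (measurableTypeR R)). Qed.

Let cls_ae (f : Lf) : repr (cls f) = f %[ae mu].
Proof. by have /eqmodP/asboolP := reprK (cls f). Qed.

Let cls_finite (f : Lf) : finite_norm mu p (cls f).
Proof.
rewrite /finite_norm (eq_Lnorm_ae (mrepr _) (@measurable_funPT _ _ T R f) (cls_ae f)).
exact: Lfunction_finite.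
Qed.

Definition Lclass (f : Lf) : Lsp :=
  LebesgueSpace.Pack (LebesgueSpace.Class
    (isFinLebesgue.Build d T R mu p p1 (cls f) (cls_finite f))).

Lemma Lclass_ae (f : Lf) : Lclass f = f %[ae mu].
Proof. exact: cls_ae. Qed.

Lemma Lspace_eqP (f g : Lsp) : f = g <-> (f : T -> R) = g %[ae mu].
Proof.
split=> [->|]; first by apply: aeW.
case: f => f [[Hf]]; case: g => g [[Hg]] /= fg.
have efg : f = g.
  by rewrite -[f]reprK -[g]reprK; apply/eqmodP/asboolP.
by subst g; rewrite (Prop_irrelevance Hf Hg).
Qed.

Definition Lspace_zero : Lsp := Lclass 0.
Definition Lspace_opp (f : Lsp) : Lsp := Lclass (- Lrepr f).
Definition Lspace_add (f g : Lsp) : Lsp := Lclass (Lrepr f + Lrepr g).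
Definition Lspace_scale (a : R) (f : Lsp) : Lsp := Lclass (a *: Lrepr f).

Lemma Lspace_zeroE : Lspace_zero = cst 0 %[ae mu]. Proof. exact: Lclass_ae. Qed.
Lemma Lspace_oppE f : Lspace_opp f = \- f %[ae mu]. Proof. exact: Lclass_ae. Qed.
Lemma Lspace_addE f g : Lspace_add f g = f \+ g %[ae mu].
Proof. exact: Lclass_ae. Qed.
Lemma Lspace_scaleE a f : Lspace_scale a f = a \*: (f : T -> R) %[ae mu].
Proof. exact: Lclass_ae. Qed.

Let addA : associative Lspace_add.
Proof.
move=> f g h; apply/Lspace_eqP.
apply: filter_app (Lspace_addE f (Lspace_add g h)). apply: filter_app (Lspace_addE g h). apply: filter_app (Lspace_addE (Lspace_add f g) h). apply: filter_app (Lspace_addE f g).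
apply: aeW => x h4 h3 h2 h1 _.
by rewrite h1 // h3 //= h2 // h4 //= addrA.
Qed.

Let addC : commutative Lspace_add.
Proof.
move=> f g; apply/Lspace_eqP.
apply: filter_app (Lspace_addE f g). apply: filter_app (Lspace_addE g f).
apply: aeW => x h2 h1 _.
by rewrite h1 // h2 //= addrC.
Qed.

Let add0 : left_id Lspace_zero Lspace_add.
Proof.
move=> f; apply/Lspace_eqP.
apply: filter_app (Lspace_addE Lspace_zero f). apply: filter_app (Lspace_zeroE).
apply: aeW => x h2 h1 _.
by rewrite h1 //= h2 // add0r.
Qed.

Let addN : left_inverse Lspace_zero Lspace_opp Lspace_add.
Proof.
move=> f; apply/Lspace_eqP.
apply: filter_app (Lspace_addE (Lspace_opp f) f). apply: filter_app (Lspace_zeroE). apply: filter_app (Lspace_oppE f).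
apply: aeW => x h3 h2 h1 _.
by rewrite h1 //= h2 // h3 //= addNr.
Qed.

HB.instance Definition _ := GRing.isZmodule.Build Lsp addA addC add0 addN.

Let scaleA a b (f : Lsp) :
  Lspace_scale a (Lspace_scale b f) = Lspace_scale (a * b) f.
Proof.
apply/Lspace_eqP.
apply: filter_app (Lspace_scaleE a (Lspace_scale b f)). apply: filter_app (Lspace_scaleE b f). apply: filter_app (Lspace_scaleE (a * b) f).
apply: aeW => x h3 h2 h1 _.
by rewrite h1 //= h2 // h3 //= scalerA.
Qed.

Let scale1 : left_id 1 Lspace_scale.
Proof.
move=> f; apply/Lspace_eqP.
apply: filter_app (Lspace_scaleE 1 f).
apply: aeW => x h1 _.
by rewrite h1 //= scale1r.
Qed.

Let scaleDr : right_distributive Lspace_scale +%R.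
Proof.
move=> a f g; apply/Lspace_eqP.
apply: filter_app (Lspace_scaleE a (f + g)). apply: filter_app (Lspace_addE f g). apply: filter_app (Lspace_scaleE a f). apply: filter_app (Lspace_scaleE a g). apply: filter_app (Lspace_addE (Lspace_scale a f) (Lspace_scale a g)).
apply: aeW => x h5 h4 h3 h2 h1 _.
by rewrite h1 //= h2 // h5 //= h3 // h4 //= scalerDr.
Qed.

Let scaleDl (f : Lsp) : {morph Lspace_scale^~ f : a b / a + b}.
Proof.
move=> a b; apply/Lspace_eqP.
apply: filter_app (Lspace_scaleE (a + b) f). apply: filter_app (Lspace_scaleE a f). apply: filter_app (Lspace_scaleE b f). apply: filter_app (Lspace_addE (Lspace_scale a f) (Lspace_scale b f)).
apply: aeW => x h4 h3 h2 h1 _.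
by rewrite h1 //= h4 //= h2 // h3 //= scalerDl.
Qed.

HB.instance Definition _ :=
  GRing.Zmodule_isLmodule.Build R Lsp scaleA scale1 scaleDr scaleDl.

Definition Lspace_norm (f : Lsp) : R := fine 'N[mu]_p[EFin \o f]%E.

Let normD (f g : Lsp) : Lspace_norm (f + g) <= Lspace_norm f + Lspace_norm g.
Proof.
rewrite /Lspace_norm (_ : 'N[mu]_p[_]%E = 'N[mu]_p[EFin \o (Lrepr f + Lrepr g : Lf)%R]%E).
  exact: (ler_LnormD (Lrepr f) (Lrepr g)).
by apply: eq_Lnorm_ae; [exact: mrepr|exact: measurable_funPT|exact: Lclass_ae].
Qed.

Let normZ (a : R) (f : Lsp) : Lspace_norm (a *: f) = `|a| * Lspace_norm f.
Proof.
rewrite /Lspace_norm (_ : 'N[mu]_p[_]%E = 'N[mu]_p[EFin \o (a *: Lrepr f : Lf)%R]%E).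
  rewrite LnormZ fineM //.
  by have <- := finite_norm_fine (Lrepr f).
by apply: eq_Lnorm_ae; [exact: mrepr|exact: measurable_funPT|exact: Lclass_ae].
Qed.

Let norm0_eq0 (f : Lsp) : Lspace_norm f = 0 -> f = 0.
Proof.
move=> /(fine_Lnormr_eq0 (f := Lrepr f)) f0; apply/Lspace_eqP.
apply: filter_app (f0). apply: filter_app (Lspace_zeroE).
apply: aeW => x h2 h1 _.
by rewrite h2 // -Lrepr_fun h1.
Qed.

HB.instance Definition _ := Lmodule_isNormed.Build R Lsp normD normZ norm0_eq0.

Let mdist_pos (f g : Lsp) : `|f - g| = 0 -> f = g.
Proof. by move=> /normr0_eq0/eqP; rewrite subr_eq0 => /eqP. Qed.

HB.instance Definition _ := @PseudoMetric_isMetric.Build R Lsp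
  (fun f g => `|f - g|) (fun f g => normr_ge0 _) mdist_pos
  (fun f e => erefl).

End Lspace_normed.

Notation "'L2 mu" := (LspaceType2 mu) (at level 10, mu at level 8).

Definition inner d (T : measurableType d) (R : realType)
    (mu : {measure set T -> \bar R}) (f g : T -> R) : R :=
  \int[mu]_x (f x * g x).

Section self_similar.
Context (R : realType) (M : nat) (F : pMetricType R).
Implicit Types (psi : 'I_M -> F -> F) (code : (nat -> 'I_M) -> F).

Definition strict_contraction (f : F -> F) :=
  exists2 c : R, c < 1 & forall x y, mdist (f x) (f y) <= c * mdist x y.

Definition self_similar psi :=
  [/\ forall i, injective (psi i),
      forall i, strict_contraction (psi i) &
      [set: F] = \bigcup_i range (psi i)].

Definition psi_word psi (w : seq 'I_M) : F -> F :=
  foldr (fun i f => psi i \o f) id w.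

Definition cell psi (w : seq 'I_M) : set F := range (psi_word psi w).

Definition is_coding_map psi code :=
  forall w, \bigcap_n cell psi (mkseq w n) = [set code w].

Definition shift (w : nat -> 'I_M) : nat -> 'I_M := fun n => w n.+1.

Definition critical_set psi code : set (nat -> 'I_M) :=
  code @^-1` [set x | exists i j, [/\ i != j, range (psi i) x & range (psi j) x]].

Definition post_critical_set psi code : set (nat -> 'I_M) :=
  \bigcup_(n in [set n | (0 < n)%N]) (iter n shift @` critical_set psi code).

Definition boundary psi code : set F := code @` post_critical_set psi code.

(* The forms E_n are evaluated on functions defined on the whole of F; they
   only depend on the values taken on F^n, where F^0 is [boundary psi code] and
   F^n is the union of the sets psi_w(F^0) over words w of length n. *)
Definition energy0 (F0 : set F) (a : F -> F -> R) (f : F -> R) : R :=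
  2^-1 * \sum_(x \in F0) \sum_(y \in F0) a x y * (f x - f y) ^+ 2.

Definition weight (r : 'I_M -> R) (w : seq 'I_M) : R := \prod_(i <- w) r i.

Definition energy psi (F0 : set F) a r (n : nat) (f : F -> R) : R :=
  \sum_(w : n.-tuple 'I_M) (weight r w)^-1 * energy0 F0 a (f \o psi_word psi w).

Definition irreducible_on (F0 : set F) (a : F -> F -> R) :=
  forall S, S `<=` F0 -> S !=set0 -> F0 `\` S !=set0 ->
    exists x y, [/\ S x, (F0 `\` S) y & a x y != 0].

Definition laplacian_matrix (F0 : set F) (a : F -> F -> R) :=
  [/\ forall x y, F0 x -> F0 y -> a x y = a y x,
      irreducible_on F0 a,
      forall x y, F0 x -> F0 y -> x != y -> 0 <= a x y &
      forall x, F0 x -> \sum_(y \in F0) a x y = 0].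

Definition regular_harmonic_structure psi F0 a r :=
  [/\ laplacian_matrix F0 a,
      forall i, 0 < r i < 1 &
      forall f : F -> R,
        (exists2 g, {in F0, g =1 f} & energy psi F0 a r 1 g = energy0 F0 a f) /\
        (forall g, {in F0, g =1 f} -> energy0 F0 a f <= energy psi F0 a r 1 g)].

Definition domain psi F0 a r : set (F -> R) :=
  [set f | continuous f /\ has_ubound (range (fun n => energy psi F0 a r n f))].

Definition energy_lim psi F0 a r (f : F -> R) : R :=
  limn (fun n => energy psi F0 a r n f).

Definition dirichlet_form psi F0 a r (f g : F -> R) : R :=
  4^-1 * (energy_lim psi F0 a r (f \+ g) - energy_lim psi F0 a r (f \- g)).

Definition domain_bc psi F0 a r (b : set F) : set (F -> R) :=
  [set f | domain psi F0 a r f /\ forall x, (F0 `\` b) x -> f x = 0].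

(* [generator .. b f h] : f lies in the domain of Delta_b and Delta_b f = h. *)
Definition generator psi F0 a r (mu : {measure set (borelType F) -> \bar R})
    (b : set F) (f h : 'L2 mu) :=
  exists f0 : F -> R, [/\ domain_bc psi F0 a r b f0,
    (f : F -> R) = f0 %[ae mu] &
    forall g, domain_bc psi F0 a r b g ->
      dirichlet_form psi F0 a r f0 g = - inner mu h g].

End self_similar.

Definition orthonormal_basis d (T : measurableType d) (R : realType)
    (mu : {measure set T -> \bar R}) (phi : nat -> 'L2 mu) :=
  (forall j k, inner mu (phi j) (phi k) = (j == k)%:R) /\
  (forall f : 'L2 mu,
    series (fun k => inner mu f (phi k) *: phi k) @ \oo --> f).

Section noise.
Context d (Omega : measurableType d) (R : realType) (P : probability Omega R).

(* The library's [normal_prob 0 0] is not the Dirac measure at 0. *)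
Definition centred_normal (s : R) (A : set R) : \bar R :=
  if s == 0 then \d_(0 : R) A else normal_prob 0 s A.

Definition centred_gaussian (X : Omega -> R) :=
  measurable_fun setT X /\
  exists s, forall A, measurable A -> P (X @^-1` A) = centred_normal s A.

(* [W f t] is the random variable <f, W(t)>; W(t) itself is not H-valued.
   Linearity in f (almost surely) follows from the covariance. *)
Definition cylindrical_wiener d' (T : measurableType d')
    (mu : {measure set T -> \bar R}) (W : 'L2 mu -> R -> Omega -> R) :=
  (forall n (c : 'I_n -> R) (f : 'I_n -> 'L2 mu) (t : 'I_n -> R),
     (forall i, 0 <= t i) ->
     centred_gaussian (fun w => \sum_i c i * W (f i) (t i) w)) /\
  (forall f g (s t : R), 0 <= s -> 0 <= t ->
     'E_P[(W f s \* W g t)%R]%E = (Num.min s t * inner mu f g)%:E).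

(* A list of triples (c, (x, y)) encodes the step function
   \sum c * \1_(]x, y]) on [0, t]. *)
Definition step_wf (t : R) (st : seq (R * (R * R))) :=
  forall z, z \in st -> 0 <= z.2.1 /\ z.2.1 <= z.2.2 /\ z.2.2 <= t.

Definition step_fun (st : seq (R * (R * R))) (s : R) : R :=
  \sum_(z <- st) z.1 * \1_(`]z.2.1, z.2.2]%classic) s.

Definition step_int (B : R -> Omega -> R) (st : seq (R * (R * R))) (w : Omega) : R :=
  \sum_(z <- st) z.1 * (B z.2.2 w - B z.2.1 w).

(* X = \int_0^t g(s) dB(s): the L^2(P)-limit of the integrals of step functions
   converging to g in L^2([0, t]). *)
Definition wiener_integral (B : R -> Omega -> R) (t : R) (g : R -> R)
    (X : Omega -> R) :=
  measurable_fun setT X /\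
  exists st : nat -> seq (R * (R * R)),
  [/\ forall n, step_wf t (st n),
      (\int[lebesgue_measure]_(s in `[0%R, t]) ((g s - step_fun (st n) s) ^+ 2)%:E)%E
        @[n --> \oo] --> 0%E &
      (\int[P]_w ((X w - step_int B (st n) w) ^+ 2)%:E)%E @[n --> \oo] --> 0%E].

(* v is C^1 on [0, +oo[; by the mean value theorem v'(0) is then its
   right derivative at 0. *)
Definition damped_solution (beta lambda : R) (v : R -> R) :=
  exists v' : R -> R,
  [/\ v 0 = 0 /\ v' 0 = 1,
      {within `[0, +oo[, continuous v},
      {within `[0, +oo[, continuous v'} &
      forall t : R, 0 < t -> is_derive t 1 v (v' t) /\
        is_derive t 1 v' (- (2 * beta * v' t + lambda * v t))].

Definition random_element (E : topologicalType) (X : Omega -> E) :=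
  forall A : set E, open A -> measurable (X @^-1` A).

(* [X k t] is \int_0^t V(lambda_k, t - s) <phi_k, dW(s)>, and u(t) is the sum of
   the series of the [X k t *: phi k] in L^2(Omega; H). *)
Definition spde_solution d' (T : measurableType d')
    (mu : {measure set T -> \bar R}) (W : 'L2 mu -> R -> Omega -> R)
    (phi : nat -> 'L2 mu) (lambda : nat -> R) (V : R -> R -> R)
    (u : R -> Omega -> 'L2 mu) :=
  exists X : nat -> R -> Omega -> R,
  forall t : R, 0 <= t ->
  [/\ forall k, wiener_integral (W (phi k)) t (fun s => V (lambda k) (t - s)) (X k t),
      random_element (u t) &
      (\int[P]_w (`|u t w - \sum_(k < n) X k t w *: phi k| ^+ 2)%:E)%E
        @[n --> \oo] --> 0%E].

End noise.

Definition essentially_hoelder (R : realType) (M1 M2 : metricType R)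
    (A : set M1) (delta : R) (f : M1 -> M2) :=
  forall gamma, 0 < gamma < delta -> exists2 C, 0 < C &
    forall x y, A x -> A y -> mdist (f x) (f y) <= C * mdist x y `^ gamma.

Definition spectral_dim (R : realType) (dH : R) : R := 2 * dH / (dH + 1).

(* Main.v *)
(* Poincaré inequalities on the cells of resistance scale about [s], of which
   there are about [s ^ - dH], force [lambda_n >= c n ^ ((dH + 1) / dH)].
   Decay of energy bounds the variance of the increment over a time [h]
   of the [k]-th mode of [u] by a multiple of [min (h ^ 2) (1 / lambda_k)], hence
   by [h ^ (2 a) lambda_k ^ - (1 - a)], which is summable in [k] as soon as
   [a < 1 / (dH + 1) = 1 - ds / 2].  As [u] is Gaussian, its increments in L2
   then have subgaussian tails at scale [h ^ a], and dyadic chaining together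
   with the Borel-Cantelli lemma gives the Hölder continuous version. *)
Require Import Defs.
From mathcomp Require Import all_boot all_order all_algebra.
From mathcomp Require Import all_classical all_reals all_analysis.
From mathcomp Require Import finmap measurable_realfun ring lra.
Set Implicit Arguments.
Unset Strict Implicit.
Unset Printing Implicit Defensive.
Import Order.TTheory GRing.Theory Num.Theory.
Import numFieldNormedType.Exports.
Local Open Scope classical_set_scope.
Local Open Scope ring_scope.

(** * Gaussian variables *)

Section gaussian.
Context (R : realType).
Local Notation leb := (@lebesgue_measure R).

Lemma ge0_integral_normal_prob (m s : R) (f : R -> \bar R) :
  measurable_fun setT f -> (forall x, 0 <= f x)%E ->
  (\int[normal_prob m s]_x f x = \int[leb]_x (f x * (normal_pdf m s x)%:E))%E.
Proof.
move=> mf f0.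
have dom := @normal_prob_dominates R m s.
rewrite -(Radon_Nikodym_SigmaFinite.change_of_variables dom)//.
apply: ae_eq_integral => //.
- apply: emeasurable_funM => //.
  exact: measurable_int (Radon_Nikodym_SigmaFinite.f_integrable dom).
- apply: emeasurable_funM => //; apply/measurable_EFinP.
  exact: measurable_normal_pdf.
- apply: ae_eqe_mul2l; apply: integral_ae_eq => //.
  + exact: Radon_Nikodym_SigmaFinite.f_integrable.
  + by apply/measurable_EFinP; exact: measurable_normal_pdf.
  + by move=> E _ mE; rewrite -Radon_Nikodym_SigmaFinite.f_integral.
Qed.

Lemma integral_exp_normal_prob (s : R) : s != 0 ->
  (\int[normal_prob 0%R s]_x (expR (x ^+ 2 / (4 * s ^+ 2)))%:E =
   (Num.sqrt 2)%:E)%E.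
Proof.
move=> s0; rewrite ge0_integral_normal_prob//; last first.
  apply/measurable_EFinP; apply: measurableT_comp => //.
  by apply: measurable_funM => //; exact: measurable_funX.
have s20 : 0 < s ^+ 2 by rewrite exprn_even_gt0.
have q0 : 0 <= Num.sqrt 2 :> R by exact: sqrtr_ge0.
have t0 : Num.sqrt 2 * s != 0.
  by rewrite mulf_neq0// gt_eqF// sqrtr_gt0.
have E x : ((expR (x ^+ 2 / (4 * s ^+ 2)))%:E * (normal_pdf 0 s x)%:E =
    (Num.sqrt 2)%:E * (normal_pdf 0 (Num.sqrt 2 * s) x)%:E)%E.
  rewrite -!EFinM !normal_pdfE// /normal_peak /normal_fun subr0.
  have e2 : (Num.sqrt 2 * s) ^+ 2 = 2 * s ^+ 2 by rewrite exprMn sqr_sqrtr.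
  congr EFin; rewrite e2.
  have -> : (2 * s ^+ 2 * pi *+ 2) = 2 * (s ^+ 2 * pi *+ 2).
    by rewrite -mulrA mulrnAr.
  rewrite [Num.sqrt (2 * _)]sqrtrM// [(Num.sqrt 2 * _)^-1]invfM.
  rewrite [RHS]mulrA mulVKf ?gt_eqF ?sqrtr_gt0// mulrCA -expRD; congr (_ * expR _).
  have sn : s ^+ 2 != 0 by rewrite gt_eqF.
  rewrite -(mulr_natl (s ^+ 2) 2) -(mulr_natl (2 * s ^+ 2) 2).
  by field; rewrite s0.
under eq_integral do rewrite E.
rewrite ge0_integralZl//.
- by rewrite integral_normal_pdf mule1.
- by apply/measurable_EFinP; exact: measurable_normal_pdf.
- by move=> x _; rewrite lee_fin normal_pdf_ge0.
Qed.

Lemma normal_prob_half (s : R) : s != 0 ->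
  ((2^-1)%:E <= normal_prob 0 s [set x | (`|s| / 2 <= `|x|)%R])%E.
Proof.
move=> s0; have s1 : 0 < `|s| by rewrite normr_gt0.
pose B : set R := `](- (`|s| / 2)), (`|s| / 2)[%classic.
have mB : measurable B by exact: measurable_itv.
have -> : [set x | `|s| / 2 <= `|x|] = ~` B.
  apply/seteqP; split=> x; rewrite /B /= in_itv/= -ltr_norml.
    by move=> h; apply/negP; rewrite -leNgt.
  by move/negP; rewrite -leNgt.
have peakE : normal_peak s * `|s| <= 2^-1.
  have h0 : 0 <= s ^+ 2 * pi *+ 2 by rewrite mulrn_wge0// mulr_ge0 ?sqr_ge0 ?pi_ge0.
  rewrite /normal_peak -sqrtrV// -(sqrtr_sqr s) -sqrtrM ?invr_ge0//.
  have -> : 2^-1 = Num.sqrt ((2^-1) ^+ 2) :> R by rewrite sqrtr_sqr ger0_norm.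
  apply: ler_wsqrtr.
  have s20 : 0 < s ^+ 2 by rewrite exprn_even_gt0.
  have p2 := pi_ge2 R; have p0 := pi_gt0 R.
  rewrite mulrC ler_pdivrMr; last by rewrite mulrn_wgt0// mulr_gt0.
  rewrite -(mulr_natl (s ^+ 2 * pi) 2).
  nra.
have PB : (normal_prob 0 s B <= (2^-1)%:E)%E.
  rewrite /normal_prob; apply: (@le_trans _ _
     (\int[leb]_(x in B) (cst (normal_peak s)%:E) x)%E).
    apply: ge0_le_integral => //.
    - by move=> x _; rewrite lee_fin normal_pdf_ge0.
    - by apply/measurable_EFinP/measurable_funTS; exact: measurable_normal_pdf.
    - by move=> x _; rewrite lee_fin normal_pdf_ub.
  rewrite integral_cst//= /B lebesgue_measure_itv/= lte_fin.
  have -> : - (`|s| / 2) < `|s| / 2 by lra.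
  rewrite -EFinB opprK -splitr -EFinM lee_fin//.
rewrite probability_setC// -[X in (X <= _)%E]/((2^-1)%:E).
have -> : (2^-1)%:E = (1 - (2^-1)%:E :> \bar R)%E by rewrite -EFinB; congr EFin; field.
by rewrite leeD2l// leeN2.
Qed.

End gaussian.

Section gaussian_variable.
Context d (Omega : measurableType d) (R : realType) (P : probability Omega R).

Lemma centred_gaussian_exp (X : Omega -> R) (q : R) :
  centred_gaussian P X -> 0 < q -> (\int[P]_w (X w ^+ 2)%:E <= q%:E)%E ->
  (\int[P]_w (expR (X w ^+ 2 / (32 * q)))%:E <= 2%:E)%E.
Proof.
move=> [mX [s law]] q0 EX.
pose X' : {mfun Omega >-> measurableTypeR R} :=
  @mfun_Sub _ _ Omega (measurableTypeR R) X (mem_set mX).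
have mg : measurable_fun setT (fun x : R => (expR (x ^+ 2 / (32 * q)))%:E).
  apply/measurable_EFinP; apply: measurableT_comp => //.
  by apply: measurable_funM => //; exact: measurable_funX.
have -> : (\int[P]_w (expR (X w ^+ 2 / (32 * q)))%:E =
    \int[pushforward P X']_x (expR (x ^+ 2 / (32 * q)))%:E)%E.
  by rewrite ge0_integral_pushforward//.
have [s0|s0] := eqVneq s 0.
  have -> : (\int[pushforward P X']_x (expR (x ^+ 2 / (32 * q)))%:E =
      \int[\d_(0%R : measurableTypeR R)]_x (expR (x ^+ 2 / (32 * q)))%:E)%E.
    apply: eq_measure_integral => A mA _.
    by rewrite /pushforward [LHS]law// /centred_normal s0 eqxx.
  by rewrite integral_dirac// diracT mul1e expr0n/= mul0r expR0 lee_fin; lra.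
have -> : (\int[pushforward P X']_x (expR (x ^+ 2 / (32 * q)))%:E =
    \int[normal_prob 0%R s]_x (expR (x ^+ 2 / (32 * q)))%:E)%E.
  apply: eq_measure_integral => A mA _.
  by rewrite /pushforward [LHS]law// /centred_normal (negbTE s0).
have s20 : 0 < s ^+ 2 by rewrite exprn_even_gt0.
have sq : s ^+ 2 <= 8 * q.
  pose A : set Omega := X @^-1` [set x | `|s| / 2 <= `|x|].
  have mA0 : measurable [set x : R | `|s| / 2 <= `|x|].
    rewrite -[X in measurable X]setTI.
    by apply: (measurable_fun_le (f := cst _) (g := fun x : R => `|x|)).
  have mA : measurable A by rewrite -[X in measurable X]setTI; exact: (mX measurableT _ mA0).
  have PA : ((2^-1)%:E <= P A)%E.
    by rewrite law// /centred_normal (negbTE s0) normal_prob_half.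
  have : ((s ^+ 2 / 4)%:E * P A <= q%:E)%E.
    apply: le_trans EX; rewrite -integral_cst//.
    apply: (@le_trans _ _ (\int[P]_(w in A) (X w ^+ 2)%:E)%E).
      apply: ge0_le_integral => //.
      - by move=> w _; rewrite lee_fin; lra.
      - apply/measurable_EFinP/measurable_funTS; exact: measurable_funX.
      - move=> w; rewrite /A/= lee_fin => h.
        rewrite -(real_normK (num_real (X w))) -(real_normK (num_real s)).
        have := normr_ge0 s; have := normr_ge0 (X w); nra.
    apply: ge0_subset_integral => //.
      by apply/measurable_EFinP; exact: measurable_funX.
    by move=> w _; rewrite lee_fin sqr_ge0.
  have : ((s ^+ 2 / 4)%:E * (2^-1)%:E <= (s ^+ 2 / 4)%:E * P A)%E.
    by rewrite lee_pmul2l// lte_fin; lra.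
  move=> /le_trans h /h; rewrite -EFinM lee_fin; lra.
apply: (@le_trans _ _ (\int[normal_prob 0%R s]_x (expR (x ^+ 2 / (4 * s ^+ 2)))%:E)%E).
  apply: ge0_le_integral => //.
  - apply/measurable_EFinP; apply: measurableT_comp => //.
    by apply: measurable_funM => //; exact: measurable_funX.
  - move=> x _; rewrite lee_fin ler_expR ler_wpM2l ?sqr_ge0//.
    by rewrite lef_pV2 ?posrE; lra.
rewrite integral_exp_normal_prob// lee_fin -(@ler_pXn2r _ 2) ?nnegrE ?sqrtr_ge0// sqr_sqrtr//; lra.
Qed.

(* By convexity of the exponential, [exp (Σ X_k^2 / (32 Σ q_k))] is at most the
   average of the [exp (X_k^2 / (32 q_k))] with weights [q_k / Σ q_k]. *)
Lemma gaussian_sum_tail n (X : 'I_n.+1 -> Omega -> R) (q : 'I_n.+1 -> R) (e : R) :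
  (forall k, centred_gaussian P (X k)) -> (forall k, 0 < q k) ->
  (forall k, \int[P]_w (X k w ^+ 2)%:E <= (q k)%:E)%E ->
  (P [set w | (e <= \sum_k X k w ^+ 2)%R]
     <= (2 * expR (- (e / (32 * \sum_k q k))))%:E)%E.
Proof.
move=> gX q0 EX; pose Q := \sum_k q k.
have Q0 : 0 < Q.
  rewrite /Q big_ord_recl ltr_pwDl// sumr_ge0// => k _; exact: ltW.
pose Y w := expR (\sum_k X k w ^+ 2 / (32 * Q)).
have mX k : measurable_fun setT (X k) by have [] := gX k.
have mY : measurable_fun setT Y.
  apply: measurableT_comp => //; apply: measurable_sum => k.
  by apply: measurable_funM => //; exact: measurable_funX.
have mZ k : measurable_fun setT (fun w => expR (X k w ^+ 2 / (32 * q k))).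
  apply: measurableT_comp => //.
  by apply: measurable_funM => //; exact: measurable_funX.
have YE w : Y w <= \sum_k (q k / Q) * expR (X k w ^+ 2 / (32 * q k)).
  pose a k := X k w ^+ 2 / (32 * q k).
  pose m := \sum_k X k w ^+ 2 / (32 * Q).
  have mE : m = \sum_k (q k / Q) * a k.
    apply: eq_bigr => k _; rewrite /a; field.
    by rewrite !gt_eqF.
  have tan k : expR m * (1 + (a k - m)) <= expR (a k).
    rewrite -{2}(subrK m (a k)) expRD mulrC ler_wpM2r ?expR_ge0//.
    exact: expR_ge1Dx.
  rewrite /Y -/m; apply: (@le_trans _ _ (\sum_k q k / Q * (expR m * (1 + (a k - m))))).
    rewrite (_ : \sum_k _ = expR m * (\sum_k q k / Q + \sum_k q k / Q * a k
       - m * \sum_k q k / Q)); last first.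
      rewrite mulr_sumr -big_split/= -sumrB mulr_sumr.
      by apply: eq_bigr => k _; ring.
    by rewrite -mulr_suml divff ?gt_eqF// -mE; lra.
  by apply: ler_sum => k _; rewrite ler_wpM2l// divr_ge0 ?ltW.
have EY : (\int[P]_w (Y w)%:E <= 2%:E)%E.
  apply: (@le_trans _ _ (\int[P]_w (\sum_k (q k / Q)%:E *
      (expR (X k w ^+ 2 / (32 * q k)))%:E))%E).
    apply: ge0_le_integral => //.
    - by move=> w _; rewrite lee_fin expR_ge0.
    - exact/measurable_EFinP.
    - apply: emeasurable_sum => k; apply: emeasurable_funM => //.
      exact/measurable_EFinP.
    - move=> w _; under eq_bigr do rewrite -EFinM.
      by rewrite sumEFin lee_fin YE.
  rewrite ge0_integral_sum//; last 2 first.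
    - move=> k; apply: emeasurable_funM => //; exact/measurable_EFinP.
    - by move=> k w _; rewrite -EFinM lee_fin mulr_ge0 ?expR_ge0// divr_ge0 ?ltW.
  apply: (@le_trans _ _ (\sum_k (q k / Q * 2)%:E)%E).
    apply: lee_sum => k _; rewrite ge0_integralZl//; last 2 first.
      - exact/measurable_EFinP.
      - by rewrite lee_fin divr_ge0 ?ltW.
    rewrite [leRHS]EFinM; apply: lee_wpmul2l; first by rewrite lee_fin divr_ge0 ?ltW.
    exact: centred_gaussian_exp.
  by rewrite sumEFin lee_fin -!mulr_suml divff ?gt_eqF// mul1r.
set A := [set w | _]; pose c := expR (e / (32 * Q)).
have mA : measurable A.
  rewrite -[X in measurable X]setTI.
  apply: (measurable_fun_le (f := cst _)) => //.
  by apply: measurable_sum => k; exact: measurable_funX.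
have : (c%:E * P A <= 2%:E)%E.
  apply: le_trans EY; rewrite -integral_cst//.
  apply: (@le_trans _ _ (\int[P]_(w in A) (Y w)%:E)%E).
    apply: ge0_le_integral => //.
    - by move=> w _; rewrite lee_fin expR_ge0.
    - exact/measurable_EFinP/measurable_funTS.
    - move=> w; rewrite /A/= lee_fin => h; rewrite ler_expR.
      by rewrite -mulr_suml ler_wpM2r// invr_ge0 mulr_ge0// ltW.
  apply: ge0_subset_integral => //; first exact/measurable_EFinP.
  by move=> w _; rewrite lee_fin expR_ge0.
by rewrite -lee_pdivlMl ?expR_gt0// -EFinM expRN mulrC.
Qed.

End gaussian_variable.

(** * Self-similar sets and their energy *)

Section geometry.
Context (R : realType) (M : nat) (F : pMetricType R).
Variables (psi : 'I_M -> F -> F) (code : (nat -> 'I_M) -> F).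
Hypotheses (hM : (2 <= M)%N) (Fconn : connected [set: F])
  (Fcomp : compact [set: F]) (hpsi : self_similar psi)
  (hcode : is_coding_map psi code).

Lemma uniform_contraction : exists2 c : R, 0 <= c < 1 &
  forall i x y, mdist (psi i x) (psi i y) <= c * mdist x y.
Proof.
have [_ hc _] := hpsi.
have /choice [c cP] : forall i, exists c : R, c < 1 /\
    forall x y, mdist (psi i x) (psi i y) <= c * mdist x y.
  by move=> i; have [c c1 h] := hc i; exists c.
exists (\big[Num.max/0]_i c i).
  by rewrite bigmax_ge_id/=; apply: bigmax_lt => // i _; have [] := cP i.
move=> i x y; have [_ h] := cP i; apply: (le_trans (h x y)).
by rewrite ler_wpM2r ?mdist_ge0// le_bigmax.
Qed.

Lemma psi_continuous i : continuous (psi i).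
Proof.
have [c /andP[c0 c1] h] := uniform_contraction.
move=> x; apply/metricType_numDomainType.cvgrPdist_lt => e e0.
near=> y; apply: le_lt_trans (h _ _ _) _.
apply: (@le_lt_trans _ _ (mdist x y)).
  by rewrite ler_piMl ?mdist_ge0// ltW.
near: y; exact: (metricType_numDomainType.cvgr_dist_lt (f := id)).
Unshelve. all: by end_near. Qed.

Lemma psi_word_continuous w : continuous (psi_word psi w).
Proof.
elim: w => [|i w IH]; first by move=> x; exact: cvg_id.
by move=> x; apply: continuous_comp; [exact: IH|exact: psi_continuous].
Qed.

Lemma mdist_psi_word : exists2 c : R, 0 <= c < 1 & forall w x y,
  mdist (psi_word psi w x) (psi_word psi w y) <= c ^+ size w * mdist x y.
Proof.
have [c c01 h] := uniform_contraction; exists c => //.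
have c0 : 0 <= c by case/andP: c01.
elim=> [|i w IH] x y; first by rewrite expr0 mul1r.
by rewrite /= exprS -mulrA (le_trans (h _ _ _))// ler_wpM2l.
Qed.

Lemma mdist_continuous (x0 : F) : continuous (fun x : F => mdist x0 x).
Proof.
move=> x; apply/cvgrPdist_le => e e0; near=> y.
have xy : mdist x y < e.
  by near: y; exact: (metricType_numDomainType.cvgr_dist_lt (f := id)).
rewrite ler_norml; have := metric_triangle x0 x y.
have := metric_triangle x0 y x; rewrite (metric_sym y x); lra.
Unshelve. all: by end_near. Qed.

Lemma diameter_bound : exists D : R, forall x y : F, mdist x y <= D.
Proof.
have [c _ h] := compact_EVT_max (ex_intro _ (point : F) I) Fcomp
  (continuous_subspaceT (@mdist_continuous point)).
exists (mdist point c + mdist point c) => x y.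
apply: (le_trans (metric_triangle _ point _)).
by rewrite (metric_sym x) lerD// h// in_setT.
Qed.

Lemma cell_closed w : closed (cell psi w).
Proof.
apply: compact_closed; first exact: metric_hausdorff.
apply: continuous_compact => //.
exact: continuous_subspaceT (@psi_word_continuous w).
Qed.

Definition scons T (i : T) (w : nat -> T) (n : nat) : T :=
  if n is m.+1 then w m else i.

Lemma mem_cell_code w n : cell psi (mkseq w n) (code w).
Proof.
by have /(_ n I) : (\bigcap_n cell psi (mkseq w n)) (code w) by rewrite hcode.
Qed.

Lemma mkseqS T (w : nat -> T) n :
  mkseq w n.+1 = w 0%N :: mkseq (fun k => w k.+1) n.
Proof. by rewrite /mkseq/= (iotaDl 1 0) -map_comp. Qed.

Lemma code_eq w x : (forall n, cell psi (mkseq w n) x) -> code w = x.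
Proof.
move=> h; suff : [set code w] x by move->.
by rewrite -hcode => n _.
Qed.

Lemma code_scons i w : code (scons i w) = psi i (code w).
Proof.
apply: code_eq => -[|n]; first by exists (psi i (code w)).
rewrite mkseqS; have [y _ <-] := mem_cell_code w n.
by exists y.
Qed.

Lemma code_shift w : code w = psi (w 0%N) (code (Defs.shift w)).
Proof.
rewrite -code_scons; congr code; apply/funext => -[|n] //.
Qed.

Lemma code_surj x : exists w, code w = x.
Proof.
have [_ _ cov] := hpsi.
have /choice [g gP] : forall x : F, exists p : 'I_M * F, psi p.1 p.2 = x.
  move=> y; have : [set: F] y by [].
  by rewrite cov => -[i _ [z _ <-]]; exists (i, z).
exists (fun n => (g (iter n (fun y => (g y).2) x)).1).
apply: code_eq => n; elim: n x => [|n IH] x; first by exists x.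
rewrite mkseqS; have [y _ yE] := IH (g x).2.
exists y => //=; rewrite -[RHS]gP; congr (psi _ _).
rewrite -yE; congr (psi_word _ _ _); apply: eq_mkseq => k /=.
by rewrite -iterSr.
Qed.

Lemma boundary_of_overlap i j p q : i != j -> psi i p = psi j q ->
  boundary psi code p.
Proof.
move=> ij e; have [w wE] := code_surj p.
exists w => //; exists 1%N => //=; exists (scons i w); last exact/funext.
exists i, j; rewrite code_scons wE; split => //; rewrite e; exact: imageT.
Qed.

Lemma boundary_split p : boundary psi code p ->
  exists i q, boundary psi code q /\ p = psi i q.
Proof.
move=> [w [n /= n0 [v Cv <-]] <-].
exists (iter n (@Defs.shift M) v 0%N), (code (Defs.shift (iter n (@Defs.shift M) v))); split.
  exists (Defs.shift (iter n (@Defs.shift M) v)) => //.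
  by exists n.+1 => //; exists v.
exact: code_shift.
Qed.

(* If the cells in [A] and those outside did not overlap, they would split F
   into two disjoint closed sets. *)
Lemma cells_connected (A : set 'I_M) : A !=set0 -> A <> setT ->
  exists i j p q, [/\ A i, ~ A j, boundary psi code p, boundary psi code q &
    psi i p = psi j q].
Proof.
move=> [i0 Ai0] AT; have [_ _ cov] := hpsi.
have cl (S : set 'I_M) : closed (\bigcup_(i in S) range (psi i)).
  apply: closed_bigcup; first exact: finite_finset.
  by move=> i _; exact: (@cell_closed [:: i]).
have [//|no] := pselect (exists i j p q,
  [/\ A i, ~ A j, boundary psi code p, boundary psi code q & psi i p = psi j q]).
pose U := \bigcup_(i in A) range (psi i).
have UE : U = ~` (\bigcup_(i in ~` A) range (psi i)).
  apply/seteqP; split => [x [i Ai [p _ <-]] [j Aj [q _ e]]|x nx].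
    have ij : i != j by apply/eqP => ij; apply: Aj; rewrite -ij.
    apply: no; exists i, j, p, q; split => //.
      exact: boundary_of_overlap ij (esym e).
    by apply: boundary_of_overlap e; rewrite eq_sym.
  have : [set: F] x by [].
  rewrite cov => -[i _ ri]; exists i => //; apply: contrapT => Ai.
  by apply: nx; exists i.
have UT : U = setT.
  apply: Fconn.
  - by exists (psi i0 point); exists i0 => //; exists point.
  - exists U; last by rewrite setTI.
    by rewrite UE openC.
  - by exists U; [exact: cl|rewrite setTI].
case: AT; apply/seteqP; split=> // j _; apply: contrapT => Aj.
have : U (psi j point) by rewrite UT.
by rewrite UE; apply; exists j => //; exists point.
Qed.

Lemma boundary_nonempty : boundary psi code !=set0.
Proof.
pose i0 : 'I_M := Ordinal (ltnW hM); pose i1 : 'I_M := Ordinal hM.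
have [] := @cells_connected [set i0].
- by exists i0.
- by move=> /seteqP[_ /(_ i1 I)] /(congr1 val).
- by move=> i [j [p [q [_ _ bp _ _]]]]; exists p.
Qed.

End geometry.

Lemma cvg_sumr (R : realType) (T : Type) (G : set_system T) {FG : Filter G}
    (I : Type) (s : seq I) (f : I -> T -> R) (l : I -> R) :
  (forall i, f i @ G --> l i) ->
  (fun x => \sum_(i <- s) f i x) @ G --> \sum_(i <- s) l i.
Proof. by move=> fl; apply: cvg_big => //; exact: add_continuous. Qed.

Section energy.
Context (R : realType) (M : nat) (F : pMetricType R).
Variables (psi : 'I_M -> F -> F) (F0 : set F) (a : F -> F -> R) (r : 'I_M -> R).
Hypotheses (F0fin : finite_set F0)
  (har : regular_harmonic_structure psi F0 a r).
Local Notation E := (energy psi F0 a r).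
Local Notation Elim := (energy_lim psi F0 a r).
Local Notation D := (domain psi F0 a r).

Lemma ratio01 i : 0 < r i < 1. Proof. by have [_ h _] := har. Qed.
Lemma ratio_gt0 i : 0 < r i. Proof. by have /andP[] := ratio01 i. Qed.

Lemma weight_cons i w : weight r (i :: w) = r i * weight r w.
Proof. by rewrite /weight big_cons. Qed.

Lemma weight_gt0 w : 0 < weight r w.
Proof. by rewrite /weight prodr_gt0// => i _; exact: ratio_gt0. Qed.

Lemma conductance_ge0 x y (f : F -> R) : F0 x -> F0 y ->
  0 <= a x y * (f x - f y) ^+ 2.
Proof.
have [[_ _ a0 _] _ _] := har => Fx Fy.
have [->|xy] := eqVneq x y; first by rewrite subrr expr0n/= mulr0.
by rewrite mulr_ge0 ?sqr_ge0// a0.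
Qed.

Definition energy0_form (f g : F -> R) : R :=
  2^-1 * \sum_(x <- fset_set F0) \sum_(y <- fset_set F0)
    a x y * ((f x - f y) * (g x - g y)).

Definition energy_form n (f g : F -> R) : R :=
  \sum_(w : n.-tuple 'I_M) (weight r w)^-1 *
     energy0_form (f \o psi_word psi w) (g \o psi_word psi w).

Lemma energy0E f : energy0 F0 a f = energy0_form f f.
Proof.
rewrite /energy0 fsbig_finite//; congr (_ * _); apply: eq_bigr => x _.
by rewrite fsbig_finite//; apply: eq_bigr => y _; rewrite expr2.
Qed.

Lemma energyE n f : E n f = energy_form n f f.
Proof. by apply: eq_bigr => w _; rewrite energy0E. Qed.

Lemma energy_formC n f g : energy_form n f g = energy_form n g f.
Proof.
apply: eq_bigr => w _; congr (_ * (_ * _)).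
by apply: eq_bigr => x _; apply: eq_bigr => y _; congr (_ * _); rewrite mulrC.
Qed.

Lemma energy0_form_suml m (c : 'I_m -> R) (f : 'I_m -> F -> R) g :
  energy0_form (fun x => \sum_k c k * f k x) g = \sum_k c k * energy0_form (f k) g.
Proof.
rewrite /energy0_form; under [RHS]eq_bigr do rewrite mulrCA mulr_sumr.
rewrite -mulr_sumr; congr (_ * _); rewrite [RHS]exchange_big/=.
apply: eq_bigr => x _; under [RHS]eq_bigr do rewrite mulr_sumr.
rewrite [RHS]exchange_big/=; apply: eq_bigr => y _.
rewrite -sumrB mulr_suml mulr_sumr; apply: eq_bigr => k _ /=; ring.
Qed.

Lemma energy_form_suml n m (c : 'I_m -> R) (f : 'I_m -> F -> R) g :
  energy_form n (fun x => \sum_k c k * f k x) g = \sum_k c k * energy_form n (f k) g.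
Proof.
rewrite /energy_form; under [RHS]eq_bigr do rewrite mulr_sumr.
rewrite [RHS]exchange_big/=; apply: eq_bigr => w _.
by rewrite energy0_form_suml mulr_sumr; apply: eq_bigr => k _; rewrite mulrCA.
Qed.

Lemma energy_sum n m (c : 'I_m -> R) (f : 'I_m -> F -> R) :
  E n (fun x => \sum_k c k * f k x) =
  \sum_k \sum_l c k * c l * energy_form n (f k) (f l).
Proof.
rewrite energyE energy_form_suml; apply: eq_bigr => k _.
rewrite energy_formC energy_form_suml mulr_sumr; apply: eq_bigr => l _.
by rewrite energy_formC mulrA.
Qed.

Lemma energy_linear2 n (s t : R) f g : E n (fun x => s * f x + t * g x) =
  s ^+ 2 * E n f + 2 * s * t * energy_form n f g + t ^+ 2 * E n g.
Proof.
have := energy_sum n (fun k : 'I_2 => if val k is 0 then s else t)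
  (fun k : 'I_2 => if val k is 0 then f else g).
rewrite !big_ord_recl !big_ord0/= !addr0.
under [X in E n X = _ -> _]eq_fun do rewrite !big_ord_recl big_ord0/= addr0.
by move=> ->; rewrite !energyE (energy_formC n g f); ring.
Qed.

Lemma energyD n f g :
  E n (f \+ g) = E n f + 2 * energy_form n f g + E n g.
Proof.
have := energy_linear2 n 1 1 f g.
under [X in E n X = _ -> _]eq_fun do rewrite !mul1r.
by move=> ->; ring.
Qed.

Lemma energyB n f g :
  E n (f \- g) = E n f - 2 * energy_form n f g + E n g.
Proof.
have := energy_linear2 n 1 (- 1) f g.
under [X in E n X = _ -> _]eq_fun do rewrite mul1r mulN1r.
by move=> ->; ring.
Qed.

Lemma energy0_ge0 f : 0 <= energy0 F0 a f.
Proof.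
rewrite mulr_ge0// fsumr_ge0// => x Fx; rewrite fsumr_ge0// => y Fy.
exact: conductance_ge0.
Qed.

Lemma energy_ge0 n f : 0 <= E n f.
Proof.
apply: sumr_ge0 => w _; rewrite mulr_ge0 ?energy0_ge0// invr_ge0 ltW//.
exact: weight_gt0.
Qed.

Lemma energy_0 f : E 0 f = energy0 F0 a f.
Proof.
rewrite /energy (big_pred1 [tuple]); last by move=> w; rewrite [w]tuple0/= eqxx.
by rewrite /weight big_nil invr1 mul1r.
Qed.

Lemma energyS n f : E n.+1 f = \sum_i (r i)^-1 * E n (f \o psi i).
Proof.
rewrite /energy; under [RHS]eq_bigr do rewrite mulr_sumr.
rewrite pair_big/=.
rewrite (reindex (fun p : 'I_M * n.-tuple 'I_M => [tuple of p.1 :: p.2]))/=; last first.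
  exists (fun t : n.+1.-tuple 'I_M => (thead t, [tuple of behead t])).
    by move=> [i t] _ /=; congr pair; apply: val_inj.
  by move=> t _ /=; rewrite -tuple_eta.
apply: eq_bigr => -[i w] _ /=; rewrite weight_cons invfM mulrA//.
Qed.

Lemma energy_le_S n f : E n f <= E n.+1 f.
Proof.
elim: n f => [|n IH] f.
  by rewrite energy_0; have [_ _ /(_ f)[_]] := har; apply.
rewrite energyS [leRHS]energyS; apply: ler_sum => i _.
by rewrite ler_wpM2l// invr_ge0 ltW// ratio_gt0.
Qed.

Lemma energy_nd f : {homo E ^~ f : m n / (m <= n)%N >-> m <= n}.
Proof. by apply/nondecreasing_seqP => n; exact: energy_le_S. Qed.

Lemma domain_cvg (f : F -> R) : D f -> (fun n => E n f) @ \oo --> Elim f.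
Proof.
by move=> [_ ub]; apply: nondecreasing_is_cvgn => //; exact: energy_nd.
Qed.

Lemma energy_le_lim n f : D f -> E n f <= Elim f.
Proof.
move=> Df; apply: nondecreasing_cvgn_le; first exact: energy_nd.
by apply/cvg_ex; exists (Elim f); exact: domain_cvg.
Qed.

Lemma energy_lim_ge0 f : D f -> 0 <= Elim f.
Proof. by move=> Df; exact: le_trans (energy_ge0 0 f) (energy_le_lim 0 Df). Qed.

Lemma domain_of_cvg (f : F -> R) (l : R) :
  continuous f -> (fun n => E n f) @ \oo --> l -> D f.
Proof.
move=> cf cE; split => //; exists l => _ [n _ <-].
rewrite -(cvg_lim _ cE)//; apply: nondecreasing_cvgn_le; first exact: energy_nd.
by apply/cvg_ex; exists l.
Qed.

Lemma domain_comp f i : continuous (psi i) -> D f -> D (f \o psi i).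
Proof.
move=> ci Df; have [cf [B ub]] := Df; split.
  by move=> x; apply: continuous_comp; [exact: ci|exact: cf].
exists (r i * B) => _ [n _ <-].
have := ub (E n.+1 f) (ex_intro2 _ _ n.+1 I erefl).
rewrite energyS (bigD1 i)//= => h.
rewrite -ler_pdivrMl ?ratio_gt0//; apply: le_trans h.
rewrite lerDl sumr_ge0// => j _.
by rewrite mulr_ge0 ?energy_ge0// invr_ge0 ltW// ratio_gt0.
Qed.

Lemma energy_limS f : (forall i, continuous (psi i)) -> D f ->
  Elim f = \sum_i (r i)^-1 * Elim (f \o psi i).
Proof.
move=> cpsi Df; apply/cvg_lim => //.
rewrite -cvg_shiftS/=; under eq_cvg do rewrite energyS.
apply: cvg_sumr => i; apply: cvgMl_tmp.
by apply: domain_cvg; exact: domain_comp.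
Qed.

Lemma domainD f g : D f -> D g -> D (f \+ g).
Proof.
move=> Df Dg; have [cf _] := Df; have [cg _] := Dg; split.
  by move=> x; apply: cvgD; [exact: cf|exact: cg].
exists (2 * Elim f + 2 * Elim g) => _ [n _ <-].
have := energy_ge0 n (f \- g); rewrite energyB energyD.
have := energy_le_lim n Df; have := energy_le_lim n Dg; lra.
Qed.

Lemma domainB f g : D f -> D g -> D (f \- g).
Proof.
move=> Df Dg; have [cf _] := Df; have [cg _] := Dg; split.
  by move=> x; apply: cvgB; [exact: cf|exact: cg].
exists (2 * Elim f + 2 * Elim g) => _ [n _ <-].
have := energy_ge0 n (f \+ g); rewrite energyB energyD.
have := energy_le_lim n Df; have := energy_le_lim n Dg; lra.
Qed.

Lemma energy_form_cvg f g : D f -> D g ->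
  (fun n => energy_form n f g) @ \oo --> dirichlet_form psi F0 a r f g.
Proof.
move=> Df Dg; rewrite /dirichlet_form.
have -> : (fun n => energy_form n f g) =
    (fun n => 4^-1 * (E n (f \+ g) - E n (f \- g))).
  by apply/funext => n; rewrite energyD energyB; field.
apply: cvgMl_tmp; apply: cvgB; apply: domain_cvg.
  exact: domainD.
exact: domainB.
Qed.

Lemma domain_sum m (c : 'I_m -> R) (f : 'I_m -> F -> R) :
  (forall k, D (f k)) -> let g := fun x => \sum_k c k * f k x in
  D g /\ Elim g = \sum_k \sum_l c k * c l * dirichlet_form psi F0 a r (f k) (f l).
Proof.
move=> Df g.
have cE : (fun n => E n g) @ \oo -->
    \sum_k \sum_l c k * c l * dirichlet_form psi F0 a r (f k) (f l).
  under eq_cvg do rewrite energy_sum.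
  apply: cvg_sumr => k; apply: cvg_sumr => l; apply: cvgMl_tmp.
  exact: energy_form_cvg.
split; last exact/cvg_lim.
apply: domain_of_cvg cE => x.
have cf k : continuous (f k) by have [] := Df k.
apply: (@cvg_sumr _ _ _ _ _ _ (fun k y => c k * f k y) (fun k => c k * f k x)) => k.
by apply: cvgMl_tmp; exact: cf.
Qed.

End energy.

Lemma finite_uniform_bound (R : realType) (T : choiceType) (A : set T)
    (P : T -> R -> Prop) :
  finite_set A -> (forall x C C', C <= C' -> P x C -> P x C') ->
  (forall x, A x -> exists C, P x C) ->
  exists C, 0 <= C /\ forall x, A x -> P x C.
Proof.
move=> Afin mono h.
have /choice [c cP] : forall x, exists C, A x -> P x C.
  by move=> x; have [/h[C]|] := pselect (A x); [exists C|exists 0].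
exists (\big[Num.max/0]_(x <- fset_set A) c x); split.
  exact: bigmax_ge_id.
move=> x Ax; apply: mono (cP x Ax); apply: le_bigmax_seq => //.
by rewrite in_fset_set//; exact: mem_set.
Qed.

Lemma fsum_ge_term (R : realType) (T : choiceType) (A : set T) (F : T -> R) x :
  finite_set A -> (forall y, A y -> 0 <= F y) -> A x ->
  F x <= \sum_(y \in A) F y.
Proof.
move=> Afin F0 Ax; rewrite (fsbigD1 x)//= lerDl fsumr_ge0// => y [Ay _].
exact: F0.
Qed.

Section link.
Context (R : realType) (F : Type) (Q : (F -> R) -> R).
Hypothesis Q0 : forall f, 0 <= Q f.

Definition link x y := exists C, 0 <= C /\ forall f, (f x - f y) ^+ 2 <= C * Q f.

Lemma link_refl x : link x x.
Proof. by exists 0; split=> // f; rewrite subrr expr0n/= mul0r. Qed.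

Lemma link_trans y x z : link x y -> link y z -> link x z.
Proof.
move=> [C [C0 h]] [C' [C0' h']]; exists (2 * C + 2 * C'); split; first lra.
move=> f; apply: (@le_trans _ _ (2 * (f x - f y) ^+ 2 + 2 * (f y - f z) ^+ 2)).
  have := sqr_ge0 ((f x - f y) - (f y - f z)); rewrite !expr2; lra.
by have := h f; have := h' f; lra.
Qed.

End link.

Section oscillation.
Context (R : realType) (M : nat) (F : pMetricType R).
Variables (psi : 'I_M -> F -> F) (code : (nat -> 'I_M) -> F).
Variables (a : F -> F -> R) (r : 'I_M -> R).
Hypotheses (hM : (2 <= M)%N) (Fconn : connected [set: F])
  (Fcomp : compact [set: F]) (hpsi : self_similar psi)
  (hcode : is_coding_map psi code)
  (hpcf : finite_set (post_critical_set psi code))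
  (har : regular_harmonic_structure psi (boundary psi code) a r).
Local Notation F0 := (boundary psi code).
Local Notation E := (energy psi F0 a r).
Local Notation Elim := (energy_lim psi F0 a r).
Local Notation D := (domain psi F0 a r).

Lemma boundary_finite : finite_set F0.
Proof. exact: finite_image. Qed.

Lemma energy0_edge x y f : F0 x -> F0 y -> 0 < a x y ->
  (f x - f y) ^+ 2 <= 2 / a x y * energy0 F0 a f.
Proof.
move=> Fx Fy axy.
have h : a x y * (f x - f y) ^+ 2 <=
    \sum_(x \in F0) \sum_(y \in F0) a x y * (f x - f y) ^+ 2.
  apply: (@le_trans _ _ (\sum_(y \in F0) a x y * (f x - f y) ^+ 2)).
    apply: (fsum_ge_term (F := fun y => a x y * (f x - f y) ^+ 2)) => //.
      exact: boundary_finite.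
    by move=> z Fz; exact: conductance_ge0 har _ _ _ _ _.
  apply: (fsum_ge_term (F := fun x => \sum_(y \in F0) a x y * (f x - f y) ^+ 2)) => //.
    exact: boundary_finite.
  move=> z Fz; rewrite fsumr_ge0// => t Ft.
  exact: conductance_ge0 har _ _ _ _ _.
rewrite /energy0 mulrCA mulrA -ler_pdivrMl; last first.
  by rewrite mulr_gt0// ?mulr_gt0// invr_gt0.
apply: le_trans h; rewrite le_eqVlt; apply/orP; left; apply/eqP.
by field; rewrite gt_eqF.
Qed.

Lemma boundary_link p q : F0 p -> F0 q -> link (energy0 F0 a) p q.
Proof.
move=> Fp Fq.
pose S := [set y | F0 y /\ link (energy0 F0 a) p y].
have [//|nq] := pselect (link (energy0 F0 a) p q).
have [[asym irr apos _] _ _] := har.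
have [|||x [y [[Fx px] [Fy nSy] axy]]] := irr S.
- by move=> x [].
- by exists p; split => //; exact: link_refl.
- by exists q; split => // -[].
have xy : x != y by apply/eqP => xy; apply: nSy; rewrite -xy.
exfalso; apply: nSy; split => //; apply: link_trans px _.
exists (2 / a x y).
have a0 : 0 < a x y by rewrite lt_neqAle eq_sym axy apos.
by split => [|f]; [rewrite divr_ge0// ltW|exact: energy0_edge].
Qed.

Lemma cell_link1 i p q : F0 p -> F0 q -> link (E 1) (psi i p) (psi i q).
Proof.
move=> Fp Fq; have [C [C0 h]] := boundary_link Fp Fq.
have ri := ratio_gt0 har i.
exists (C * r i); split; first by rewrite mulr_ge0// ltW.
move=> f; apply: (le_trans (h (f \o psi i))).
rewrite -mulrA ler_wpM2l// energyS (bigD1 i)//= energy_0 mulrDr mulVKf ?gt_eqF//.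
rewrite lerDl mulr_ge0 ?(ltW ri)// sumr_ge0// => j _.
by rewrite mulr_ge0 ?(energy_ge0 har)// invr_ge0 ltW// (ratio_gt0 har).
Qed.

Lemma cells_link1 i j p q : F0 p -> F0 q -> link (E 1) (psi i p) (psi j q).
Proof.
move=> Fp Fq.
pose A := [set k | exists2 q', F0 q' & link (E 1) (psi i p) (psi k q')].
suff AT : A = setT.
  have [q' Fq' h] : A j by rewrite AT.
  exact: link_trans h (cell_link1 _ Fq' Fq).
apply: contrapT => AT.
have [|k [l [p' [q' [[s Fs h] nAl Fp' Fq' e]]]]] :=
  cells_connected Fconn Fcomp hpsi hcode _ AT.
  by exists i, p => //; exact: link_refl.
apply: nAl; exists q' => //; rewrite -e.
exact: link_trans h (cell_link1 _ Fs Fp').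
Qed.

Lemma boundary_cell_link1 i p q : F0 p -> F0 q -> link (E 1) (psi i p) q.
Proof.
move=> Fp Fq; have [j [q' [Fq' ->]]] := boundary_split hcode Fq.
exact: cells_link1.
Qed.

Lemma energy1_oscillation : exists C, 0 <= C /\ forall i p q f,
  F0 p -> F0 q -> (f (psi i p) - f q) ^+ 2 <= C * E 1 f.
Proof.
have [||C [C0 h]] := @finite_uniform_bound R _ ([set: 'I_M] `*` (F0 `*` F0))
  (fun z C => forall f, (f (psi z.1 z.2.1) - f z.2.2) ^+ 2 <= C * E 1 f)
  (finite_setX finite_finset (finite_setX boundary_finite boundary_finite)) _ _.
- by move=> z C C' CC' h f; rewrite (le_trans (h f))// ler_wpM2r// (energy_ge0 har).
- move=> [i [p q]] [_ [/= Fp Fq]].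
  by have [C [_ h]] := boundary_cell_link1 i Fp Fq; exists C.
- by exists C; split => // i p q f Fp Fq; exact: (h (i, (p, q))).
Qed.

Lemma ratio_max : exists2 c : R, 0 <= c < 1 & forall i, Num.sqrt (r i) <= c.
Proof.
exists (\big[Num.max/0]_i Num.sqrt (r i)); last by move=> i; exact: le_bigmax.
rewrite bigmax_ge_id/=; apply: bigmax_lt => // i _.
have /andP[r0 r1] := ratio01 har i.
by rewrite -sqrtr1 ltr_sqrt.
Qed.

Lemma boundary_oscillation : exists K, 0 <= K /\ forall w p q f, D f ->
  F0 p -> F0 q -> `|f (psi_word psi w p) - f q| <= K * Num.sqrt (Elim f).
Proof.
have [C [C0 hC]] := energy1_oscillation.
have [c /andP[c0 c1] hc] := ratio_max.
have bnd i f p q : D f -> F0 p -> F0 q ->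
    `|f (psi i p) - f q| <= Num.sqrt C * Num.sqrt (Elim f).
  move=> Df Fp Fq; rewrite -sqrtrM// -sqrtr_sqr; apply: ler_wsqrtr.
  by rewrite (le_trans (hC _ _ _ _ Fp Fq))// ler_wpM2l// (energy_le_lim har).
pose K := Num.sqrt C / (1 - c).
have K0 : 0 <= K by rewrite divr_ge0 ?sqrtr_ge0// subr_ge0 ltW.
have KE : K * c + Num.sqrt C = K by rewrite /K; field; rewrite gt_eqF// subr_gt0.
have CK : Num.sqrt C <= K.
  by rewrite -KE lerDr mulr_ge0.
exists K; split => //; elim=> [|i w IH] p q f Df Fp Fq.
  have [i [p' [Fp' ->]]] := boundary_split hcode Fp.
  by rewrite (le_trans (bnd i f p' q Df Fp' Fq))// ler_wpM2r ?sqrtr_ge0.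
have cpsi := psi_continuous hpsi.
have Dfi : D (f \o psi i) by exact: domain_comp har _ _ (cpsi i) Df.
have Ei : Elim (f \o psi i) <= r i * Elim f.
  rewrite (energy_limS har cpsi Df) (bigD1 i)//= mulrDr mulVKf ?gt_eqF ?(ratio_gt0 har)//.
  rewrite lerDl mulr_ge0 ?(ltW (ratio_gt0 har i))// sumr_ge0// => j _.
  rewrite mulr_ge0 ?invr_ge0 ?(ltW (ratio_gt0 har j))//.
  by apply: (energy_lim_ge0 har); exact: domain_comp har _ _ (cpsi j) Df.
have h := IH p q _ Dfi Fp Fq.
have h2 := bnd i f q q Df Fq Fq.
rewrite -[f _](subrK (f (psi i q))) -addrA (le_trans (ler_normD _ _))//.
rewrite -KE mulrDl lerD//; apply: (le_trans h).
rewrite -mulrA ler_wpM2l//; apply: (le_trans (ler_wsqrtr Ei)).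
by rewrite sqrtrM ?(ltW (ratio_gt0 har i))// ler_wpM2r ?sqrtr_ge0.
Qed.

Lemma oscillation : exists K, 0 <= K /\ forall x y f, D f ->
  (f x - f y) ^+ 2 <= K * Elim f.
Proof.
have [K [K0 hK]] := boundary_oscillation.
have [p0 Fp0] := boundary_nonempty hM Fconn Fcomp hpsi hcode.
have [c /andP[c0 c1] hc] := mdist_psi_word hpsi.
have [d hd] := diameter_bound Fcomp.
have step x f : D f -> `|f x - f p0| <= K * Num.sqrt (Elim f).
  move=> Df; have [cf _] := Df.
  have [w wx] := code_surj hpsi hcode x.
  pose u n := psi_word psi (mkseq w n) p0.
  have ux : u @ \oo --> x.
    apply/metricType_numDomainType.cvgrPdist_lt => e e0.
    have : (fun n => c ^+ n * d) @ \oo --> 0 * d.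
      by apply: cvgMr_tmp; apply: cvg_expr; rewrite ger0_norm.
    rewrite mul0r => /cvgrPdist_lt /(_ _ e0); apply: filterS => n.
    rewrite sub0r normrN => /(le_lt_trans _); apply; apply: le_trans (ler_norm _).
    have [y _ yx] := mem_cell_code hcode w n; rewrite wx in yx.
    rewrite -yx; apply: (le_trans (hc _ _ _)); rewrite size_mkseq.
    by rewrite ler_wpM2l ?exprn_ge0.
  have fu : (fun n => `|f (u n) - f p0|) @ \oo --> `|f x - f p0|.
    apply: cvg_norm; apply: cvgB; last exact: cvg_cst.
    by apply: continuous_cvg => //; exact: cf.
  rewrite -(cvg_lim _ fu)//; apply: limr_le; first by apply/cvg_ex; eexists; exact: fu.
  by apply: nearW => n; exact: hK.
exists (4 * K ^+ 2); split; first by rewrite mulr_ge0// sqr_ge0.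
move=> x y f Df; have Ef := energy_lim_ge0 har Df.
have h : `|f x - f y| <= 2 * K * Num.sqrt (Elim f).
  have := step x f Df; have := step y f Df.
  rewrite (distrC (f y)) => hy hx.
  rewrite -[f x](subrK (f p0)) -addrA (le_trans (ler_normD _ _))//; lra.
have -> : 4 * K ^+ 2 * Elim f = (2 * K * Num.sqrt (Elim f)) ^+ 2.
  by rewrite !exprMn sqr_sqrtr//; ring.
by rewrite -real_normK ?num_real// ler_sqr ?nnegrE// ?mulr_ge0 ?sqrtr_ge0.
Qed.

End oscillation.

(** * Orthonormal bases of L2 *)

Lemma nonexpansive_continuous (R : realType) (V : normedModType R) (g : V -> R) :
  (forall x y, `|g x - g y| <= `|x - y|) -> continuous g.
Proof.
move=> h x; apply/cvgrPdist_le => e e0; near=> y.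
apply: (le_trans (h x y)); near: y.
by apply: (@cvgr_dist_le _ _ _ _ _ id x) => //; exact: cvg_id.
Unshelve. all: by end_near. Qed.

Section L2.
Context d (T : measurableType d) (R : realType) (mu : {measure set T -> \bar R}).
Implicit Types f g h : 'L2 mu.

Lemma L2_measurable f : measurable_fun setT (f : T -> R).
Proof. exact: (@measurable_funPT _ _ T R (Lrepr f)). Qed.

Lemma L2_Lfun f : (f : T -> R) \in Lfun mu 2%:E.
Proof. exact: LfunP (Lrepr f). Qed.

Lemma L2_integrableM f g : mu.-integrable setT (EFin \o (fun x => f x * g x)).
Proof. by apply/Lfun1_integrable; apply: Lfun2_mul_Lfun1; exact: L2_Lfun. Qed.

Lemma ae_eq_inner (f f' g g' : T -> R) :
  measurable_fun setT f -> measurable_fun setT f' ->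
  measurable_fun setT g -> measurable_fun setT g' ->
  f = f' %[ae mu] -> g = g' %[ae mu] -> inner mu f g = inner mu f' g'.
Proof.
move=> mf mf' mg mg' ff' gg'; congr fine; apply: ae_eq_integral => //.
- by apply/measurable_EFinP; exact: measurable_funM.
- by apply/measurable_EFinP; exact: measurable_funM.
- by apply: filter_app ff'; apply: filter_app gg'; apply: aeW => x h1 h2 _; rewrite h1// h2.
Qed.

Lemma innerC (f g : T -> R) : inner mu f g = inner mu g f.
Proof. by apply: eq_Rintegral => x _; rewrite mulrC. Qed.

Lemma innerDl f g h : inner mu (f + g) h = inner mu f h + inner mu g h.
Proof.
rewrite (@ae_eq_inner _ (fun x => f x + g x) _ h); try exact: L2_measurable; last 3 first.
- by apply: measurable_funD; exact: L2_measurable.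
- exact: Lspace_addE.
- exact: aeW.
rewrite /inner; under eq_Rintegral do rewrite mulrDl.
by rewrite RintegralD//; exact: L2_integrableM.
Qed.

Lemma innerZl (a : R) f h : inner mu (a *: f) h = a * inner mu f h.
Proof.
rewrite (@ae_eq_inner _ (fun x => a * f x) _ h); try exact: L2_measurable; last 3 first.
- by apply: measurable_funM => //; exact: L2_measurable.
- exact: Lspace_scaleE.
- exact: aeW.
rewrite /inner; under eq_Rintegral do rewrite -mulrA.
by rewrite RintegralZl//; exact: L2_integrableM.
Qed.

Lemma inner0l h : inner mu (0 : 'L2 mu) h = 0.
Proof. by have := innerZl 0 h h; rewrite scale0r mul0r. Qed.

Lemma innerNl f h : inner mu (- f) h = - inner mu f h.
Proof. by rewrite -scaleN1r innerZl mulN1r. Qed.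

Lemma innerBl f g h : inner mu (f - g) h = inner mu f h - inner mu g h.
Proof. by rewrite innerDl innerNl. Qed.

Lemma inner_suml (I : Type) (s : seq I) (c : I -> R) (f : I -> 'L2 mu) h :
  inner mu (\sum_(i <- s) c i *: f i) h = \sum_(i <- s) c i * inner mu (f i) h.
Proof.
elim: s => [|i s IH]; first by rewrite !big_nil inner0l.
by rewrite !big_cons innerDl innerZl IH.
Qed.

Lemma L2_normE f : ((`|f| ^+ 2)%:E = \int[mu]_x (f x ^+ 2)%:E)%E.
Proof.
have n2 : 2 != 0 :> R by rewrite pnatr_eq0.
have h := powR_Lnorm mu (EFin \o f) n2.
have fin := @finite_norm_fine _ _ _ mu _ (lee1n 2) (Lrepr f).
rewrite -powR_mulrn ?normr_ge0// -poweR_EFin.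
rewrite [(`|f|)%:E]fin h.
by apply: eq_integral => x _; rewrite /= powR_mulrn// real_normK// num_real.
Qed.

Lemma sqr_normE f : `|f| ^+ 2 = inner mu f f.
Proof.
apply: EFin_inj; rewrite L2_normE /inner /Rintegral fineK//.
apply: integrable_fin_num => //; exact: L2_integrableM.
Qed.

Lemma L2_normB f g : ((`|f - g| ^+ 2)%:E = \int[mu]_x ((f x - g x) ^+ 2)%:E)%E.
Proof.
rewrite L2_normE; apply: ae_eq_integral => //.
- by apply/measurable_EFinP; apply: measurable_funX; exact: L2_measurable.
- apply/measurable_EFinP; apply: measurable_funX.
  by apply: measurable_funB; exact: L2_measurable.
- apply: filter_app (Lspace_addE f (- g)); apply: filter_app (Lspace_oppE g).
  by apply: aeW => x h1 h2 _; rewrite h2//= h1.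
Qed.

Lemma L2_sum_ae (I : Type) (s : seq I) (c : I -> R) (f : I -> 'L2 mu) :
  (\sum_(i <- s) c i *: f i : 'L2 mu) = (fun x => \sum_(i <- s) c i * f i x) %[ae mu].
Proof.
elim: s => [|i s IH].
  rewrite big_nil; apply: filter_app (Lspace_zeroE mu (lee1n 2)).
  by apply: aeW => x h _; rewrite h// big_nil.
rewrite big_cons.
apply: filter_app IH; apply: filter_app (Lspace_scaleE (c i) (f i)).
apply: filter_app (Lspace_addE (c i *: f i) (\sum_(j <- s) c j *: f j)).
by apply: aeW => x h1 h2 h3 _; rewrite h1//= h2// h3// big_cons.
Qed.

End L2.

Section orthonormal.
Context d (T : measurableType d) (R : realType) (mu : {measure set T -> \bar R}).
Variables (phi : nat -> 'L2 mu) (hphi : orthonormal_basis phi).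
Implicit Types f g h : 'L2 mu.
Local Notation "<| f , k |>" := (inner mu f (phi k)).

Lemma inner_basis_sum n (c : nat -> R) k :
  <| \sum_(j < n) c j *: phi j, k |> = if (k < n)%N then c k else 0.
Proof.
have [orth _] := hphi; rewrite inner_suml.
case: ifPn => kn.
  rewrite (bigD1 (Ordinal kn))//= orth eqxx mulr1 big1 ?addr0// => j jk.
  by rewrite orth (negbTE (_ : val j != k))// mulr0.
rewrite big1// => j _; rewrite orth; case: eqP => [jk|]; last by rewrite mulr0.
by move: kn; rewrite -jk ltn_ord.
Qed.

Lemma norm_basis_sum n (c : nat -> R) :
  `|\sum_(j < n) c j *: phi j| ^+ 2 = \sum_(j < n) c j ^+ 2.
Proof.
rewrite sqr_normE inner_suml; apply: eq_bigr => j _.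
by rewrite innerC inner_basis_sum ltn_ord expr2.
Qed.

Lemma norm_sub_basis_sum n f (c : nat -> R) :
  `|f - \sum_(j < n) c j *: phi j| ^+ 2 =
  `|f| ^+ 2 - \sum_(j < n) <|f, j|> ^+ 2 + \sum_(j < n) (<|f, j|> - c j) ^+ 2.
Proof.
set S := \sum_(j < n) _.
have fS : inner mu f S = \sum_(j < n) c j * <|f, j|>.
  rewrite innerC inner_suml; apply: eq_bigr => j _; by rewrite innerC.
rewrite sqr_normE innerBl (innerC _ f (f - S)) (innerC _ S (f - S)) !innerBl.
rewrite -!sqr_normE norm_basis_sum fS (innerC _ S f) fS.
rewrite -addrA -!sumrN -!big_split/= -!addrA; congr (_ + _).
rewrite -!sumrN -!big_split/=; apply: eq_bigr => j _; ring.
Qed.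

Lemma norm_basis_residual n f :
  `|f - \sum_(j < n) <|f, j|> *: phi j| ^+ 2 = `|f| ^+ 2 - \sum_(j < n) <|f, j|> ^+ 2.
Proof.
rewrite (norm_sub_basis_sum n f (fun j => <|f, j|>)).
by rewrite [X in _ + X = _]big1 ?addr0// => j _; rewrite subrr expr0n.
Qed.

Lemma parseval f : (fun n => \sum_(j < n) <|f, j|> ^+ 2) @ \oo --> `|f| ^+ 2.
Proof.
have [_ /(_ f)] := hphi; rewrite /series/= => h.
have {}h : (fun n => `|f - \sum_(j < n) <|f, j|> *: phi j| ^+ 2) @ \oo --> (0 : R).
  have -> : (0 : R) = `|f - f| ^+ 2 by rewrite subrr normr0 expr0n.
  apply: (@cvg_comp _ _ _ (fun n => `|f - \sum_(j < n) <|f, j|> *: phi j|)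
     (fun x : R => x ^+ 2)); last exact: exprn_continuous.
  apply: cvg_norm; apply: cvgB; first exact: cvg_cst.
  by under eq_cvg do rewrite -(big_mkord xpredT (fun j => <|f, j|> *: phi j)).
have -> : (fun n => \sum_(j < n) <|f, j|> ^+ 2) =
    (fun n => `|f| ^+ 2 - `|f - \sum_(j < n) <|f, j|> *: phi j| ^+ 2).
  apply/funext => n; rewrite norm_basis_residual; ring.
rewrite -[X in _ --> X]subr0.
by apply: cvgB => //; exact: cvg_cst.
Qed.

Lemma bessel1 f k : <|f, k|> ^+ 2 <= `|f| ^+ 2.
Proof.
have := sqr_ge0 `|f - \sum_(j < k.+1) <|f, j|> *: phi j|.
rewrite norm_basis_residual big_ord_recr/=.
have : 0 <= \sum_(j < k) <|f, j|> ^+ 2 by apply: sumr_ge0 => j _; exact: sqr_ge0.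
lra.
Qed.

Lemma inner_basis_continuous k : continuous (fun f => <|f, k|>).
Proof.
apply: (@nonexpansive_continuous R ('L2 mu)) => f g.
rewrite -innerBl -(ger0_norm (normr_ge0 (f - g))) -ler_sqr ?nnegrE//.
rewrite real_normK ?num_real// ger0_norm//; exact: bessel1.
Qed.

End orthonormal.

(** * Lower bound on the eigenvalues *)

Lemma continuous_borel_measurable (R : realType) (F : pMetricType R) (f : F -> R) :
  continuous f -> measurable_fun setT (f : borelType F -> R).
Proof.
move=> /continuousP cf.
apply: (@measurability _ _ (borelType F) R setT f (@RGenOpens.G R)); first exact: RGenOpens.measurableE.
move=> _ [_ [a [b ->] <-]]; rewrite setTI; apply: sub_sigma_algebra.
exact/cf/interval_open.
Qed.

Lemma ae_imp d (T : measurableType d) (R : realType)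
    (mu : {measure set T -> \bar R}) (P Q : T -> Prop) :
  (forall x, P x -> Q x) -> {ae mu, forall x, P x} -> {ae mu, forall x, Q x}.
Proof. by move=> PQ; apply: filterS. Qed.

Section eigenvalues.
Context (R : realType) (M : nat) (F : pMetricType R).
Variables (psi : 'I_M -> F -> F) (code : (nat -> 'I_M) -> F).
Variables (a : F -> F -> R) (r : 'I_M -> R).
Hypotheses (hM : (2 <= M)%N) (Fconn : connected [set: F])
  (Fcomp : compact [set: F]) (hpsi : self_similar psi)
  (hcode : is_coding_map psi code)
  (hpcf : finite_set (post_critical_set psi code))
  (har : regular_harmonic_structure psi (boundary psi code) a r).
Variables (dH : R) (hdH : \sum_i r i `^ dH = 1).
Local Notation F0 := (boundary psi code).
Local Notation Elim := (energy_lim psi F0 a r).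
Local Notation D := (domain psi F0 a r).

Lemma dimension_gt0 : 0 < dH.
Proof.
rewrite ltNge; apply/negP => dH0.
have : \sum_(i < M) (1 : R) <= \sum_i r i `^ dH.
  apply: ler_sum => i _; have /andP[r0 r1] := ratio01 har i.
  rewrite /powR gt_eqF// -[leLHS]expR0 ler_expR.
  have : ln (r i) < 0 by rewrite ln_lt0// r0.
  nra.
rewrite hdH sumr_const card_ord => h.
have : (2 : R) <= 1 by apply: le_trans h; rewrite ler_nat.
lra.
Qed.

Lemma ratio_min : exists2 m : R, 0 < m <= 1 & forall i, m <= r i.
Proof.
exists (\big[Num.min/1]_i r i); last by move=> i; exact: bigmin_le.
rewrite bigmin_le_id andbT; apply: lt_bigmin => // i _; exact: ratio_gt0 har i.
Qed.

(* Refine the cells until their resistance scale [weight r w] drops below [s];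
   as the scale shrinks by at most a factor [m] at each step, it does not drop
   far below, so that there are about [s ^ -dH] cells left. *)
Lemma cell_partition m : 0 < m <= 1 -> (forall i, m <= r i) ->
  forall s, 0 < s -> s <= m^-1 -> exists L : seq (seq 'I_M),
  [/\ forall x, exists2 w, w \in L & cell psi w x,
      forall f, D f ->
        \sum_(w <- L) (weight r w)^-1 * Elim (f \o psi_word psi w) = Elim f,
      (size L)%:R <= (s * m) `^ (- dH) &
      forall w, w \in L -> weight r w <= s].
Proof.
move=> /andP[m0 m1] hm.
have d0 := dimension_gt0.
have [c /andP[c0 c1] hc] : exists2 c : R, 0 < c < 1 & forall i, r i <= c.
  pose b : R := \big[Num.max/2^-1]_i r i.
  exists b; last by move=> i; exact: le_bigmax.
  apply/andP; split; first by apply: (@lt_le_trans _ _ 2^-1) => //; exact: bigmax_ge_id.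
  by apply: bigmax_lt => [|i _]; [lra|have /andP[] := ratio01 har i].
move=> s s0 sm.
have [N hN] : exists N, c ^+ N <= s.
  have : (fun n => c ^+ n) @ \oo --> 0 by apply: cvg_expr; rewrite ger0_norm ?ltW.
  move=> /cvgrPdist_lt /(_ _ s0)[N _ /(_ N (leqnn N))].
  by rewrite /= sub0r normrN ger0_norm ?exprn_ge0 ?(ltW c0)// => /ltW h; exists N.
have cpsi := psi_continuous hpsi; have [_ _ cov] := hpsi.
elim: N s s0 sm hN => [|N IH] s s0 sm hN; have [s1|s1] := leP 1 s.
- exists [:: [::]]; split.
  + by move=> x; exists [::]; rewrite ?inE//; exists x.
  + by move=> f _; rewrite big_seq1 /weight big_nil invr1 mul1r.
  + rewrite powRN invf_ge1 ?powR_gt0 ?mulr_gt0//.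
    rewrite -[leRHS](powRr0 (s * m)); apply: ger_powR; last exact: ltW.
    by rewrite mulr_gt0//= -ler_pdivlMr// div1r.
  + by move=> w; rewrite inE => /eqP ->; rewrite /weight big_nil.
- by move: hN; rewrite expr0 leNgt s1.
- exists [:: [::]]; split.
  + by move=> x; exists [::]; rewrite ?inE//; exists x.
  + by move=> f _; rewrite big_seq1 /weight big_nil invr1 mul1r.
  + rewrite powRN invf_ge1 ?powR_gt0 ?mulr_gt0//.
    rewrite -[leRHS](powRr0 (s * m)); apply: ger_powR; last exact: ltW.
    by rewrite mulr_gt0//= -ler_pdivlMr// div1r.
  + by move=> w; rewrite inE => /eqP ->; rewrite /weight big_nil.
have {}IH i := IH (s / r i).
have ri i : 0 < r i := ratio_gt0 har i.
have /choice [L hL] : forall i, exists L : seq (seq 'I_M),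
  [/\ forall x, exists2 w, w \in L & cell psi w x,
      forall f, D f ->
        \sum_(w <- L) (weight r w)^-1 * Elim (f \o psi_word psi w) = Elim f,
      (size L)%:R <= (s / r i * m) `^ (- dH) &
      forall w, w \in L -> weight r w <= s / r i].
  move=> i; apply: IH.
  - by rewrite divr_gt0.
  - rewrite ler_pdivrMr// (le_trans (ltW s1))// mulrC -ler_pdivrMr ?invr_gt0//.
    by rewrite invrK mul1r.
  - rewrite ler_pdivlMr// (le_trans _ hN)// exprSr ler_wpM2l// exprn_ge0//.
    exact: ltW.
exists (flatten [seq [seq i :: w | w <- L i] | i <- enum 'I_M]); split.
- move=> x; have : [set: F] x by [].
  rewrite cov => -[i _ [y _ yx]].
  have [/(_ y)[w wL [z _ zy]] _ _ _] := hL i.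
  exists (i :: w); last by exists z => //=; rewrite zy.
  apply/flattenP; exists [seq i :: w | w <- L i]; last exact: map_f.
  by apply: map_f; rewrite mem_enum.
- move=> f Df; rewrite big_flatten/= big_map big_enum/= (energy_limS har cpsi Df).
  have Dfi i := domain_comp har (cpsi i) Df.
  apply: eq_bigr => i _; have [_ part _ _] := hL i.
  rewrite big_map -(part _ (Dfi i)) mulr_sumr; apply: eq_bigr => w _.
  by rewrite weight_cons invfM mulrA.
- rewrite size_flatten /shape -map_comp sumnE big_map big_enum/= natr_sum.
  apply: (@le_trans _ _ (\sum_i (s * m) `^ (- dH) * r i `^ dH)); last first.
    by rewrite -mulr_sumr hdH mulr1.
  apply: ler_sum => i _; have [_ _ h _] := hL i; rewrite size_map (le_trans h)//.
  rewrite mulrAC powRM ?mulr_ge0 ?invr_ge0 ?(ltW s0) ?(ltW m0) ?(ltW (ri i))//.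
  rewrite -[(r i)^-1]powR_inv1 ?(ltW (ri i))// -powRrM.
  by rewrite mulN1r opprK.
- move=> w /flattenP[_ /mapP[i _ ->] /mapP[v vL ->]].
  rewrite weight_cons; have [_ _ _ /(_ v vL) h] := hL i.
  by rewrite mulrC -ler_pdivlMr.
Qed.

Variable mu : probability (borelType F) R.
Hypothesis hmu : forall w : seq 'I_M, mu (cell psi w) = (weight r w `^ dH)%:E.

Lemma measurable_cell w : measurable (cell psi w : set (borelType F)).
Proof.
have co : open (~` cell psi w) by apply: closed_openC; exact: cell_closed Fcomp hpsi w.
by rewrite -[cell psi w]setCK; apply: measurableC; exact: sub_sigma_algebra.
Qed.

Lemma cell_poincare : exists K, 0 < K /\ forall m s L x0 f (g : borelType F -> R),
  0 < m <= 1 -> (forall i, m <= r i) -> 0 < s ->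
  (forall x, exists2 w, w \in L & cell psi w x) ->
  (forall f, D f ->
     \sum_(w <- L) (weight r w)^-1 * Elim (f \o psi_word psi w) = Elim f) ->
  (forall w, w \in L -> weight r w <= s) ->
  D f -> (forall w, w \in L -> f (psi_word psi w x0) = 0) ->
  measurable_fun setT g -> g = f %[ae mu] ->
  (\int[mu]_x (g x ^+ 2)%:E <= (K * s `^ (dH + 1) * Elim f)%:E)%E.
Proof.
have [K [K0 hK]] := oscillation hM Fconn Fcomp hpsi hcode hpcf har.
exists (K + 1); split; first lra.
move=> m s L x0 f g m01 hm s0 cov part small Df f0 mg gf.
have cpsi := psi_continuous hpsi.
have Dw w h : D h -> D (h \o psi_word psi w).
  elim: w h => // i w IH h Dh; apply: (IH (h \o psi i)).
  exact (domain_comp har (cpsi i) Dh).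
have Ew w : 0 <= Elim (f \o psi_word psi w).
  by apply: (energy_lim_ge0 har); exact: Dw.
pose b w := K * Elim (f \o psi_word psi w).
have b0 w : 0 <= b w by rewrite mulr_ge0.
apply: (@le_trans _ _ (\int[mu]_x (\sum_(w <- L) (b w)%:E * (\1_(cell psi w) x)%:E))%E).
  apply: ae_ge0_le_integral => //.
  - by move=> x _; rewrite lee_fin sqr_ge0.
  - by apply/measurable_EFinP; exact: measurable_funX.
  - by move=> x _; apply: sume_ge0 => w _; rewrite -EFinM lee_fin mulr_ge0.
  - apply: emeasurable_sum => w; apply/measurable_EFinP.
    by apply: measurable_funM => //; apply: measurable_indic; exact: measurable_cell.
  - apply: filter_app gf; apply: aeW => x gfx _; rewrite gfx//.
    under eq_bigr do rewrite -EFinM.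
    rewrite sumEFin lee_fin; have [w wL [y _ yx]] := cov x.
    have wx : \1_(cell psi w) x = 1 :> R.
      by rewrite indicE mem_set//; exists y.
    apply: (@le_trans _ _ (b w * \1_(cell psi w) x)).
      rewrite wx mulr1; have := hK y x0 _ (Dw w f Df).
      by rewrite /= f0// subr0 yx.
    rewrite (big_rem w)//= lerDl sumr_ge0// => v _.
    by rewrite mulr_ge0.
rewrite ge0_integral_sum//; last 2 first.
- move=> w; apply/measurable_EFinP.
  by apply: measurable_funM => //; apply: measurable_indic; exact: measurable_cell.
- by move=> w x _; rewrite -EFinM lee_fin mulr_ge0.
have -> : (\sum_(w <- L) \int[mu]_x ((b w)%:E * (\1_(cell psi w) x)%:E) =
    (\sum_(w <- L) b w * weight r w `^ dH)%:E)%E.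
  rewrite -sumEFin; apply: eq_bigr => w _; have mc := @measurable_cell w.
  rewrite ge0_integralZl//; last by rewrite lee_fin.
  rewrite integral_indic// setIT [RHS]EFinM; congr (_ * _)%E; exact: hmu.
  by apply/measurable_EFinP; exact: measurable_indic.
rewrite lee_fin -(part f Df) mulr_sumr big_seq [leRHS]big_seq.
apply: ler_sum => w wL; have w0 := weight_gt0 har w.
have -> : weight r w `^ dH = weight r w `^ (dH + 1) * (weight r w)^-1.
  rewrite powRD; last by rewrite (gt_eqF w0) implybT.
  by rewrite powRr1 ?(ltW w0)// mulfK// gt_eqF.
rewrite /b; set e := Elim _; set v := (weight r w)^-1.
have v0 : 0 <= v by rewrite invr_ge0 ltW.
have pw : weight r w `^ (dH + 1) <= s `^ (dH + 1).
  have d0 := dimension_gt0.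
  by apply: ge0_ler_powR; rewrite ?nnegrE ?(ltW w0) ?(ltW s0)//; [lra|exact: small].
have e0 : 0 <= e by exact: Ew.
have p0 : 0 <= weight r w `^ (dH + 1) by exact: powR_ge0.
rewrite (_ : K * e * _ = K * weight r w `^ (dH + 1) * (v * e)); last by ring.
rewrite ler_wpM2r ?mulr_ge0//; apply: ler_pM => //; lra.
Qed.

Variables (b : set F) (phi : nat -> 'L2 mu) (lambda : nat -> R).
Hypotheses (hphi : orthonormal_basis phi)
  (heig : forall k, generator psi F0 a r b (phi k) (- lambda k *: phi k))
  (hlambda : forall k, lambda k <= lambda k.+1).

Lemma eigenvalue_nd : {homo lambda : k l / (k <= l)%N >-> k <= l}.
Proof. exact/nondecreasing_seqP. Qed.

Lemma eigenfunctions : exists f : nat -> F -> R,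
  [/\ forall k, D (f k), forall k, (phi k : F -> R) = f k %[ae mu] &
    forall k l, dirichlet_form psi F0 a r (f k) (f l) = lambda k * (k == l)%:R].
Proof.
have /choice [f hf] := heig; exists f; split.
- by move=> k; have [[]] := hf k.
- by move=> k; have [] := hf k.
move=> k l; have [_ _ h] := hf k; have [dl fl _] := hf l.
have [orth _] := hphi.
rewrite h// (_ : inner mu _ (f l) = inner mu (- lambda k *: phi k) (phi l)).
  by rewrite innerZl orth mulNr opprK.
apply: ae_eq_inner.
- exact: L2_measurable.
- exact: L2_measurable.
- by apply: continuous_borel_measurable; have [[]] := dl.
- exact: L2_measurable.
- by apply: aeW.
- by apply: (ae_imp _ fl) => x e _; rewrite e.
Qed.

Lemma exists_vanishing_combination n p (A : 'M[R]_(n, p)) : (p < n)%N ->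
  exists c : 'rV[R]_n, c != 0 /\ c *m A = 0.
Proof.
move=> pn; have k0 : kermx A != 0.
  rewrite -mxrank_eq0 mxrank_ker -lt0n subn_gt0.
  exact: leq_ltn_trans (rank_leq_col A) pn.
by have /rowV0Pn[v /sub_kermxP vA v0] := k0; exists v.
Qed.

(* A nontrivial combination of the first [n + 1] eigenfunctions vanishes at one
   point of each of the at most [n] cells of a partition of scale [n ^ (- 1 / dH)]. *)
Lemma eigenvalue_lower_bound : exists2 c : R, 0 < c & forall n, (0 < n)%N ->
  c * n%:R `^ ((dH + 1) / dH) <= lambda n.
Proof.
have d0 := dimension_gt0.
have [m /andP[m0 m1] hm] := ratio_min.
have [K [K0 hK]] := cell_poincare.
have [f [Df fphi ff]] := eigenfunctions.
exists (m `^ (dH + 1) / K); first by rewrite divr_gt0// powR_gt0.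
move=> n n0; have n0R : 0 < n%:R :> R by rewrite ltr0n.
pose s : R := n%:R `^ (- dH^-1) / m.
have s0 : 0 < s by rewrite divr_gt0// powR_gt0.
have sm : s <= m^-1.
  rewrite /s ler_piMl ?invr_ge0 ?(ltW m0)// powRN invf_le1 ?powR_gt0//.
  rewrite -[leLHS](powRr0 n%:R); apply: ler_powR; first by rewrite ler1n.
  by rewrite invr_ge0 ltW.
have [|L [cov part small wts]] := @cell_partition m _ hm s s0 sm.
  by rewrite m0.
have Ln : (size L < n.+1)%N.
  rewrite ltnS -(ler_nat R); apply: (le_trans small).
  rewrite /s divfK ?gt_eqF// -powRrM mulNr mulrN opprK mulVf ?gt_eqF//.
  by rewrite powRr1// ltW.
pose A : 'M[R]_(n.+1, size L) :=
  \matrix_(k, j) f k (psi_word psi (nth [::] L j) point).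
have [c [c0 cA]] := exists_vanishing_combination A Ln.
pose cn j := c 0 (inord j).
have cnE (k : 'I_n.+1) : cn k = c 0 k by rewrite /cn inord_val.
have [|Dg Eg] := domain_sum (boundary_finite hpcf) har
  (fun k : 'I_n.+1 => cn k) (f := fun k => f k); first by move=> k; exact: Df.
set g := (fun x => _) in Dg Eg.
have {}Eg : Elim g = \sum_(k < n.+1) lambda k * cn k ^+ 2.
  rewrite Eg; apply: eq_bigr => k _; rewrite (bigD1 k)//= big1 ?addr0.
    by rewrite ff eqxx mulr1; ring.
  by move=> l lk; rewrite ff eq_sym (negbTE (_ : val l != k)) ?mulr0.
pose S := \sum_(k < n.+1) cn k ^+ 2.
have S0 : 0 < S.
  rewrite lt_neqAle sumr_ge0 ?andbT; last by move=> k _; exact: sqr_ge0.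
  rewrite eq_sym psumr_eq0; last by move=> k _; exact: sqr_ge0.
  apply: contraNN c0 => /allP h; apply/eqP/rowP => k; rewrite mxE -cnE.
  by apply/eqP; rewrite -sqrf_eq0; apply: h; rewrite mem_index_enum.
have ES : Elim g <= lambda n * S.
  rewrite Eg mulr_sumr; apply: ler_sum => k _; rewrite ler_wpM2r ?sqr_ge0//.
  by apply: eigenvalue_nd; rewrite -ltnS.
pose G x := \sum_(k < n.+1) cn k * phi k x.
have mG : measurable_fun setT (G : borelType F -> R).
  by apply: measurable_sum => k; apply: measurable_funM => //; exact: L2_measurable.
have Gg : G = g %[ae mu].
  have : {ae mu, forall x, forall k, phi k x = f k x}.
    by apply: ae_foralln => k; apply: (ae_imp _ (fphi k)) => x; apply.
  by apply: ae_imp => x h _; apply: eq_bigr => k _; rewrite h.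
have normG : (\int[mu]_x (G x ^+ 2)%:E = S%:E)%E.
  rewrite /S -(norm_basis_sum hphi) L2_normE; apply: ae_eq_integral => //.
  - by apply/measurable_EFinP; exact: measurable_funX.
  - apply/measurable_EFinP; apply: measurable_funX; exact: L2_measurable.
  - apply: filter_app (L2_sum_ae (index_enum 'I_n.+1) (fun k => cn k) (fun k => phi k)).
    by apply: aeW => x h _; rewrite h.
have g0 w : w \in L -> g (psi_word psi w point) = 0.
  move=> wL; have wi : (index w L < size L)%N by rewrite index_mem.
  move/rowP: cA => /(_ (Ordinal wi)); rewrite !mxE => h.
  rewrite -[RHS]h; apply: eq_bigr => k _; rewrite mxE cnE/=.
  by rewrite nth_index.
have m01 : 0 < m <= 1 by rewrite m0.
have := hK m s L point g G m01 hm s0 cov part wts Dg g0 mG Gg.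
rewrite normG lee_fin => h.
have {}h : S <= K * s `^ (dH + 1) * (lambda n * S).
  by apply: (le_trans h); rewrite ler_wpM2l// mulr_ge0 ?powR_ge0// ltW.
have {}h : 1 <= K * s `^ (dH + 1) * lambda n.
  by rewrite -(ler_pM2r S0) mul1r (le_trans h)// mulrA.
have sE : s `^ (dH + 1) = (n%:R `^ ((dH + 1) / dH))^-1 * (m `^ (dH + 1))^-1.
  rewrite /s powRM ?powR_ge0 ?invr_ge0 ?(ltW m0)//; congr (_ * _).
    by rewrite -powRrM -powRN; congr (_ `^ _); field; rewrite gt_eqF.
  by rewrite -powR_inv1 ?(ltW m0)// -powRrM mulN1r powRN.
move: h; rewrite sE.
have p1 : 0 < n%:R `^ ((dH + 1) / dH) :> R by exact: powR_gt0.
have p2 : 0 < m `^ (dH + 1) by exact: powR_gt0.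
set u := n%:R `^ _ in p1 *; set v := m `^ _ in p2 *.
rewrite (_ : K * _ * _ = lambda n / (v / K * u)); last first.
  by field; rewrite !gt_eqF.
by rewrite ler_pdivlMr ?mul1r// mulr_gt0// divr_gt0.
Qed.

End eigenvalues.

(** * The damped wave equation in one mode *)

Section damped_wave.
Context (R : realType) (beta x : R) (v : R -> R).
Hypotheses (beta0 : 0 <= beta) (x0 : 0 <= x) (hv : damped_solution beta x v).

(* The energy [v' ^ 2 + x v ^ 2] has derivative [- 4 beta v' ^ 2 <= 0]. *)
Lemma damped_energy : exists v' : R -> R,
  [/\ {within `[0, +oo[, continuous v},
      forall t : R, 0 < t -> is_derive t 1 v (v' t) &
      forall t : R, 0 <= t -> v' t ^+ 2 + x * v t ^+ 2 <= 1].
Proof.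
have [v' [[v0 v'0] cv cv' dv]] := hv.
exists v'; split => //; first by move=> t /dv[].
move=> t; rewrite le_eqVlt => /predU1P[<-|t0].
  by rewrite v0 v'0 expr0n/= mulr0 addr0 expr1n.
pose e s := v' s ^+ 2 + x * v s ^+ 2.
pose de s := (2 * v' s) * (- (2 * beta * v' s + x * v s)) + x * ((2 * v s) * v' s).
have sub : `[0, t] `<=` `[0, +oo[%classic.
  by move=> s /=; rewrite !in_itv/= andbT => /andP[].
have cvt : {within `[0, t], continuous v} by exact: continuous_subspaceW cv.
have cvt' : {within `[0, t], continuous v'} by exact: continuous_subspaceW cv'.
have [||c] := @MVT R e de 0 t t0.
- move=> s; rewrite in_itv/= => /andP[s0 st]; have [d1 d2] := dv s s0.
  have := is_deriveD (is_deriveM d2 d2) (is_deriveM (is_derive_cst x s 1) (is_deriveM d1 d1)).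
  move=> /is_derive_eq; apply.
  rewrite /de scaler0 addr0 /cst; move: (v' s) (v s) (- _) => p q w.
  rewrite (_ : p *: w = p * w)// (_ : q *: p = q * p)//.
  rewrite (_ : x *: (q * p + q * p) = x * (q * p + q * p))//; ring.
- move=> s; apply: cvgD; first by apply: cvgM; exact: cvt'.
  by apply: cvgM; [exact: cvg_cst|apply: cvgM; exact: cvt].
rewrite in_itv/= => /andP[c0 ct]; rewrite /e v0 v'0.
have : de c * (t - 0) <= 0.
  have : de c = - (4 * beta * v' c ^+ 2) by rewrite /de; ring.
  have := mulr_ge0 beta0 (sqr_ge0 (v' c)); nra.
rewrite !expr0n/= mulr0 addr0 expr1n; lra.
Qed.

Lemma damped_bound t : 0 <= t -> x * v t ^+ 2 <= 1.
Proof.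
have [v' [_ _ h]] := damped_energy; move=> /h.
have := sqr_ge0 (v' t); lra.
Qed.

Lemma damped_lipschitz s t : 0 <= s -> 0 <= t -> `|v t - v s| <= `|t - s|.
Proof.
have [v' [cv dv h]] := damped_energy.
wlog st : s t / s <= t.
  move=> W s0 t0; have [st|ts] := leP s t; first exact: W.
  by rewrite distrC [leRHS]distrC W// ltW.
move=> s0 t0; have [||c] := @MVT_segment R v v' s t st.
- by move=> c; rewrite in_itv/= => /andP[sc _]; apply: dv; exact: le_lt_trans sc.
- apply: continuous_subspaceW cv => c /=; rewrite !in_itv/= andbT => /andP[sc _].
  exact: le_trans sc.
rewrite in_itv/= => /andP[sc ct] ->; rewrite normrM ler_piMl//.
have c0 : 0 <= c by exact: le_trans sc.
have := h c c0; have := mulr_ge0 x0 (sqr_ge0 (v c)) => h1 h2.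
rewrite -(@ler_pXn2r _ 2) ?nnegrE// expr1n real_normK ?num_real//; lra.
Qed.

Lemma damped0 : v 0 = 0.
Proof. by have [v' [[]]] := hv. Qed.

Lemma damped_continuous : {within `[0, +oo[, continuous v}.
Proof. by have [v' []] := hv. Qed.

End damped_wave.

(** * Increments of Wiener integrals *)

Lemma integral_sqr_sum d (T : measurableType d) (R : realType)
    (mu : {measure set T -> \bar R}) (D : set T) n (c : 'I_n -> R) (h : 'I_n -> T -> R) :
  measurable D ->
  (forall i j, mu.-integrable D (EFin \o (fun x => h i x * h j x))) ->
  (\int[mu]_(x in D) ((\sum_i c i * h i x) ^+ 2)%:E =
   (\sum_i \sum_j c i * c j * \int[mu]_(x in D) (h i x * h j x))%:E)%E.
Proof.
move=> mD ih.
have E x : (\sum_i c i * h i x) ^+ 2 = \sum_i \sum_j (c i * c j) * (h i x * h j x).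
  rewrite expr2 mulr_suml; apply: eq_bigr => i _.
  by rewrite mulr_sumr; apply: eq_bigr => j _; ring.
under eq_integral do rewrite E -sumEFin.
have ih' i j : mu.-integrable D (fun x => ((c i * c j) * (h i x * h j x))%:E).
  have := integrableZl mD (c i * c j) (ih i j).
  by apply: eq_integrable => // x _.
rewrite integral_sum//; last first.
  move=> i; rewrite (_ : (fun x => _) = (fun x => \sum_j ((c i * c j) * (h i x * h j x))%:E)%E).
    exact: integrable_sum.
  by apply/funext => x; rewrite sumEFin.
rewrite -sumEFin; apply: eq_bigr => i _.
under eq_integral do rewrite -sumEFin.
rewrite integral_sum// -sumEFin; apply: eq_bigr => j _.
under eq_integral do rewrite EFinM.
rewrite integralZl//; last exact: ih.
rewrite [RHS]EFinM; congr (_ * _)%E; rewrite /Rintegral fineK//.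
exact: integrable_fin_num (ih i j).
Qed.

Section brownian.
Context d (Omega : measurableType d) (R : realType) (P : probability Omega R).
Variable B : R -> Omega -> R.
Hypotheses (Bgauss : forall n (c t : 'I_n -> R), (forall i, 0 <= t i) ->
    centred_gaussian P (fun w => \sum_i c i * B (t i) w))
  (Bcov : forall s t : R, 0 <= s -> 0 <= t ->
    'E_P[(B s \* B t)%R]%E = (Num.min s t)%:E).

Lemma step_int_cat st st' w :
  step_int B (st ++ st') w = step_int B st w + step_int B st' w.
Proof. by rewrite /step_int big_cat. Qed.

Definition step_opp (st : seq (R * (R * R))) := [seq (- z.1, z.2) | z <- st].

Lemma step_int_opp st w : step_int B (step_opp st) w = - step_int B st w.
Proof.
rewrite /step_int big_map -sumrN; apply: eq_bigr => z _ /=; by rewrite mulNr.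
Qed.

Lemma step_fun_cat (st st' : seq (R * (R * R))) s :
  step_fun (st ++ st') s = step_fun st s + step_fun st' s.
Proof. by rewrite /step_fun big_cat. Qed.

Lemma step_fun_opp (st : seq (R * (R * R))) s : step_fun (step_opp st) s = - step_fun st s.
Proof.
rewrite /step_fun big_map -sumrN; apply: eq_bigr => z _ /=; by rewrite mulNr.
Qed.

Lemma step_wf_sub (t : R) st st' : step_wf t st -> step_wf t st' ->
  step_wf t (st ++ step_opp st').
Proof.
move=> h h' z; rewrite mem_cat => /orP[/h//|/mapP[y /h' hy ->]//].
Qed.

Lemma step_wf_le (s t : R) st : s <= t -> step_wf s st -> step_wf t st.
Proof.
by move=> st' h z /h[? [? ?]]; split => //; split => //; exact: le_trans st'.
Qed.

Lemma step_fun_gt (t s : R) st : step_wf t st -> t < s -> step_fun st s = 0.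
Proof.
move=> h ts; rewrite /step_fun big_seq big1// => z /h[_ [_ zt]].
rewrite indicE memNset ?mulr0//= in_itv/= => /andP[_ sz].
by move: ts; rewrite ltNge (le_trans sz zt).
Qed.

Lemma measurable_step_fun (st : seq (R * (R * R))) :
  measurable_fun setT (step_fun st : R -> R).
Proof.
by apply: measurable_sum => z; apply: measurable_funM => //.
Qed.

Lemma step_int_gaussian (t : R) st : step_wf t st -> centred_gaussian P (step_int B st).
Proof.
move=> wf.
pose l := [seq (z.1, z.2.2) | z <- st] ++ [seq (- z.1, z.2.1) | z <- st].
have l0 i : 0 <= (nth (0, 0) l i).2.
  have [il|] := ltnP i (size l); last by move=> /(nth_default _) ->.
  have := mem_nth (0, 0) il; rewrite mem_cat => /orP[] /mapP[z /wf[z0 [z1 _]] ->]//=.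
  exact: le_trans z1.
have -> : step_int B st =
    (fun w => \sum_(i < size l) (nth (0, 0) l i).1 * B (nth (0, 0) l i).2 w).
  apply/funext => w.
  rewrite -(big_mkord xpredT (fun i => (nth (0, 0) l i).1 * B (nth (0, 0) l i).2 w)).
  rewrite -(big_nth (0, 0) xpredT (fun p : R * R => p.1 * B p.2 w)).
  rewrite big_cat !big_map/= -big_split/=; apply: eq_bigr => z _.
  by rewrite mulrBr mulNr.
exact: Bgauss.
Qed.

Lemma measurable_B t : 0 <= t -> measurable_fun setT (B t).
Proof.
move=> t0; have [+ _] := @Bgauss 1 (fun=> 1) (fun=> t) (fun=> t0).
by under [X in measurable_fun _ X]eq_fun do rewrite big_ord1 mul1r.
Qed.

Lemma integrable_BB s t : 0 <= s -> 0 <= t ->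
  P.-integrable setT (EFin \o (fun w => B s w * B t w)).
Proof.
have sq v : 0 <= v -> P.-integrable setT (EFin \o (fun w => B v w ^+ 2)).
  move=> v0; apply/integrableP; split.
    by apply/measurable_EFinP; apply: measurable_funX; exact: measurable_B.
  have := Bcov v0 v0; rewrite unlock minxx => h.
  under eq_integral do rewrite /= ger0_norm ?sqr_ge0//.
  by rewrite [X in (X < _)%E]h ltry.
move=> s0 t0; apply: le_integrable (integrableD measurableT (sq s s0) (sq t t0)) => //.
  by apply/measurable_EFinP; apply: measurable_funM; exact: measurable_B.
move=> w _ /=; rewrite lee_fin [leRHS]ger0_norm ?addr_ge0 ?sqr_ge0//.
rewrite normrM -(real_normK (num_real (B s w))) -(real_normK (num_real (B t w))).
have := sqr_ge0 (`|B s w| - `|B t w|); have := normr_ge0 (B s w).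
have := normr_ge0 (B t w); nra.
Qed.

Lemma Rintegral_BB s t : 0 <= s -> 0 <= t ->
  \int[P]_w (B s w * B t w) = Num.min s t.
Proof.
move=> s0 t0; have := Bcov s0 t0; rewrite unlock => h.
by rewrite /Rintegral [X in fine X]h.
Qed.

Lemma Rintegral_increments x y x' y' : 0 <= x <= y -> 0 <= x' <= y' ->
  P.-integrable setT (EFin \o (fun w => (B y w - B x w) * (B y' w - B x' w))) /\
  \int[P]_w ((B y w - B x w) * (B y' w - B x' w)) =
    Num.max 0 (Num.min y y' - Num.max x x').
Proof.
move=> /andP[x0 xy] /andP[x'0 xy'].
have y0 := le_trans x0 xy; have y'0 := le_trans x'0 xy'.
have E w : (B y w - B x w) * (B y' w - B x' w) =
    (B y w * B y' w - B y w * B x' w) - (B x w * B y' w - B x w * B x' w) by ring.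
have i1 := integrable_BB y0 y'0; have i2 := integrable_BB y0 x'0.
have i3 := integrable_BB x0 y'0; have i4 := integrable_BB x0 x'0.
have i12 : P.-integrable setT (EFin \o (fun w => B y w * B y' w - B y w * B x' w)).
  exact: (integrableB measurableT i1 i2).
have i34 : P.-integrable setT (EFin \o (fun w => B x w * B y' w - B x w * B x' w)).
  exact: (integrableB measurableT i3 i4).
split.
  have -> : (fun w => (B y w - B x w) * (B y' w - B x' w)) =
    (fun w => (B y w * B y' w - B y w * B x' w) - (B x w * B y' w - B x w * B x' w)).
    exact/funext.
  exact: (integrableB measurableT i12 i34).
under eq_Rintegral do rewrite E.
rewrite RintegralB// RintegralB// RintegralB// !Rintegral_BB//.
rewrite /Num.min /Num.max.
case: (ltP y y') => ?; case: (ltP y x') => ?; case: (ltP x y') => ?; case: (ltP x x') => ?;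
  case: ltP => ?; lra.
Qed.

Lemma Rintegral_indic_itv (t x y x' y' : R) : 0 <= x <= y -> y <= t -> 0 <= x' <= y' -> y' <= t ->
  lebesgue_measure.-integrable `[0, t]%classic
    (EFin \o (fun s => \1_(`]x, y]%classic) s * \1_(`]x', y']%classic) s : R)) /\
  \int[lebesgue_measure]_(s in `[0, t]) (\1_(`]x, y]%classic) s * \1_(`]x', y']%classic) s) =
    Num.max 0 (Num.min y y' - Num.max x x').
Proof.
move=> /andP[x0 xy] yt /andP[x'0 xy'] yt'.
pose I : set R := `](Num.max x x'), (Num.min y y')]%classic.
have E s : \1_(`]x, y]%classic) s * \1_(`]x', y']%classic) s = \1_I s :> R.
  rewrite -[LHS]/((\1_(`]x, y]%classic) \* \1_(`]x', y']%classic)) s) -indicI.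
  congr (\1_ _ _); apply/seteqP; split => z /=; rewrite /I/= !in_itv/= gt_max le_min.
    by move=> [/andP[-> ->] /andP[-> ->]].
  by move=> /andP[/andP[-> ->] /andP[-> ->]].
have mI : measurable I by exact: measurable_itv.
have IE : (\int[lebesgue_measure]_(s in `[0%R, t]) (\1_I s)%:E =
    (Num.max 0 (Num.min y y' - Num.max x x'))%:E)%E.
  rewrite integral_indic// setIidl; last first.
    move=> z; rewrite /I/= !in_itv/= gt_max le_min => /andP[/andP[xz _] /andP[zy _]].
    by rewrite (le_trans zy yt) andbT (le_trans x0)// ltW.
  rewrite /= /I lebesgue_measure_itv/= lte_fin.
  move: (Num.min y y') (Num.max x x') => p q.
  have [pq|pq] := ltP q p.
    by rewrite max_r ?EFinB// subr_ge0 ltW.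
  by rewrite max_l// subr_le0.
have -> : (fun s => \1_(`]x, y]%classic) s * \1_(`]x', y']%classic) s : R) = \1_I.
  exact/funext.
split; last by rewrite /Rintegral IE.
apply/integrableP; split.
  apply/measurable_EFinP; exact: measurable_indic.
under eq_integral do rewrite /= ger0_norm//.
by rewrite IE ltry.
Qed.

Lemma step_isometry t st : step_wf t st ->
  (\int[P]_w (step_int B st w ^+ 2)%:E =
   \int[lebesgue_measure]_(s in `[0%R, t]) (step_fun st s ^+ 2)%:E)%E.
Proof.
move=> wf; pose z (i : 'I_(size st)) := nth (0, (0, 0)) st i.
have wfz i : 0 <= (z i).2.1 <= (z i).2.2 /\ (z i).2.2 <= t.
  by have [-> [-> ->]] := wf _ (mem_nth (0, (0, 0)) (ltn_ord i)).
have E (G : R * (R * R) -> R) : \sum_(y <- st) G y = \sum_i G (z i).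
  by rewrite (big_nth (0, (0, 0))) big_mkord.
have E1 w : step_int B st w = \sum_i (z i).1 * (B (z i).2.2 w - B (z i).2.1 w).
  exact: E.
have E2 s : step_fun st s = \sum_i (z i).1 * \1_(`](z i).2.1, (z i).2.2]%classic) s.
  exact: E.
under eq_integral do rewrite E1.
rewrite (integral_sqr_sum (fun i => (z i).1)
  (h := fun i w => B (z i).2.2 w - B (z i).2.1 w))//; last first.
  move=> i j; have [hi _] := wfz i; have [hj _] := wfz j.
  by have [] := Rintegral_increments hi hj.
under [RHS]eq_integral do rewrite E2.
have -> := @integral_sqr_sum _ _ R (@lebesgue_measure R) `[0, t]%classic (size st)
  (fun i => (z i).1) (fun i s => \1_(`](z i).2.1, (z i).2.2]%classic) s).
- congr EFin; apply: eq_bigr => i _; apply: eq_bigr => j _.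
  have [hi ti] := wfz i; have [hj tj] := wfz j.
  have [_ ->] := Rintegral_increments hi hj.
  by have [_ ->] := Rintegral_indic_itv hi ti hj tj.
- exact: measurable_itv.
- move=> i j; have [hi ti] := wfz i; have [hj tj] := wfz j.
  by have [] := Rintegral_indic_itv hi ti hj tj.
Qed.

End brownian.

Lemma cvge0_near_le (R : realType) (u : nat -> \bar R) (e : R) :
  u @ \oo --> 0%E -> 0 < e -> \forall n \near \oo, (u n <= e%:E)%E.
Proof.
move=> /fine_cvgP[fin /cvgrPdist_lt h] e0; have h1 := h e e0; near=> n.
have un : u n \is a fin_num by near: n.
have : `|0 - fine (u n)| < e by near: n; exact: h1.
rewrite sub0r normrN -[u n]fineK// lee_fin => /ltW ue.
exact: le_trans (ler_norm _) ue.
Unshelve. all: by end_near. Qed.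

Section wiener_increment.
Context d (Omega : measurableType d) (R : realType) (P : probability Omega R).
Variable B : R -> Omega -> R.
Hypotheses (Bgauss : forall n (c t : 'I_n -> R), (forall i, 0 <= t i) ->
    centred_gaussian P (fun w => \sum_i c i * B (t i) w))
  (Bcov : forall s t : R, 0 <= s -> 0 <= t ->
    'E_P[(B s \* B t)%R]%E = (Num.min s t)%:E).

Lemma wiener_integral_approx (t : R) (g : R -> R) (X : Omega -> R) (e : R) :
  wiener_integral P B t g X -> 0 < e -> exists st, [/\ step_wf t st,
    (\int[lebesgue_measure]_(s in `[0%R, t]) ((g s - step_fun st s) ^+ 2)%:E <= e%:E)%E &
    (\int[P]_w ((X w - step_int B st w) ^+ 2)%:E <= e%:E)%E].
Proof.
move=> [_ [st [wf c1 c2]]] e0.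
have h1 := cvge0_near_le c1 e0; have h2 := cvge0_near_le c2 e0.
near \oo => n; exists (st n); split => //; by near: n.
Unshelve. all: by end_near. Qed.

Lemma measurable_step_int (t : R) st : step_wf t st ->
  measurable_fun setT (step_int B st).
Proof. by move=> /(step_int_gaussian Bgauss)[]. Qed.

Lemma wiener_increment (s t m : R) (gs gt : R -> R) (Xs Xt : Omega -> R) (e : R) :
  0 <= s -> s <= t -> 0 < m -> 0 < e ->
  measurable_fun `[0, s]%classic gs -> measurable_fun `[0, t]%classic gt ->
  (forall v, 0 <= v <= s -> (gt v - gs v) ^+ 2 <= 4 * m) ->
  (forall v, s < v <= t -> gt v ^+ 2 <= 4 * m) ->
  wiener_integral P B s gs Xs -> wiener_integral P B t gt Xt ->
  exists Z, [/\ centred_gaussian P Z,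
    (\int[P]_w (Z w ^+ 2)%:E <= (12 * (t + 1) * m)%:E)%E &
    (\int[P]_w ((Xt w - Xs w - Z w) ^+ 2)%:E <= e%:E)%E].
Proof.
move=> s0 st m0 e0 mgs mgt b1 b2 hs ht; have t0 := le_trans s0 st.
pose eta := Num.min (e / 4) m.
have eta0 : 0 < eta by rewrite lt_min m0 divr_gt0.
have etae : eta <= e / 4 by rewrite ge_min lexx.
have etam : eta <= m by rewrite ge_min lexx orbT.
have mXs := hs.1; have mXt := ht.1.
have [ls [wfs As Cs]] := wiener_integral_approx hs eta0.
have [lt [wft At Ct]] := wiener_integral_approx ht eta0.
pose l := lt ++ step_opp ls.
have wf : step_wf t l by apply: step_wf_sub => //; exact: step_wf_le wfs.
have mst := measurable_step_int wft; have mss := measurable_step_int wfs.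
have lE w : step_int B l w = step_int B lt w - step_int B ls w.
  by rewrite step_int_cat step_int_opp.
exists (step_int B l); split; first exact: (step_int_gaussian Bgauss wf).
- rewrite (step_isometry Bgauss Bcov wf).
  have mf st' (A : set R) : measurable A -> measurable_fun A (step_fun st' : R -> R).
    by move=> mA; apply: measurable_funTS; exact: measurable_step_fun.
  have mAt : measurable_fun `[0, t]%classic (fun v => ((gt v - step_fun lt v) ^+ 2)%:E).
    by apply/measurable_EFinP; apply: measurable_funX; apply: measurable_funB => //; exact: mf.
  have mAs : measurable_fun `[0, s]%classic (fun v => ((gs v - step_fun ls v) ^+ 2)%:E).
    by apply/measurable_EFinP; apply: measurable_funX; apply: measurable_funB => //; exact: mf.
  pose h := (fun v => ((gs v - step_fun ls v) ^+ 2)%:E) \_ (`[0, s]%classic : set R).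
  have mh : measurable_fun `[0, t]%classic h.
    apply: measurable_funTS.
    by apply/(measurable_restrictT _ _).1 => //; exact: measurable_itv.
  have h0 v : (0 <= h v)%E.
    by rewrite /h patchE; case: ifP => // _; rewrite lee_fin sqr_ge0.
  apply: (@le_trans _ _ (\int[lebesgue_measure]_(v in `[0%R, t])
     (3%:E * ((gt v - step_fun lt v) ^+ 2)%:E + (3%:E * h v + (12 * m)%:E)))%E).
    apply: ge0_le_integral => //=.
    - by move=> v _; rewrite lee_fin sqr_ge0.
    - apply/measurable_EFinP; apply: measurable_funX; exact: mf.
    - apply: emeasurable_funD; first exact: emeasurable_funM.
      by apply: emeasurable_funD => //; exact: emeasurable_funM.
    - move=> v; rewrite /= in_itv/= => /andP[v0 vt].
      rewrite step_fun_cat step_fun_opp /h patchE.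
      case: ifPn => hv.
        have vs : 0 <= v <= s by have := set_mem hv; rewrite /= in_itv.
        have := b1 v vs.
        rewrite -!EFinM -!EFinD lee_fin.
        move: (gt v) (gs v) (step_fun lt v) (step_fun ls v) => p q x y hb.
        have := sqr_ge0 ((p - x) + (q - y)); have := sqr_ge0 ((p - x) + (p - q)).
        have := sqr_ge0 ((q - y) - (p - q)); nra.
      have sv : s < v.
        rewrite ltNge; apply/negP => vs; move/negP: hv; apply.
        by apply: mem_set; rewrite /= in_itv/= v0.
      rewrite (step_fun_gt wfs sv) oppr0 addr0 mule0 add0e.
      have := b2 v; rewrite sv vt => /(_ isT).
      rewrite -!EFinM -!EFinD lee_fin.
      move: (gt v) (step_fun lt v) => p x hb.
      have := sqr_ge0 ((p - x) + p); have := sqr_ge0 (p - x); have := sqr_ge0 p; nra.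
  have q1 v : `[0, t]%classic v -> (0 <= 3%:E * ((gt v - step_fun lt v) ^+ 2)%:E)%E.
    by move=> _; rewrite -EFinM lee_fin mulr_ge0 ?sqr_ge0.
  have m1 : measurable_fun `[0, t]%classic
      (fun v => (3%:E * ((gt v - step_fun lt v) ^+ 2)%:E)%E).
    exact: emeasurable_funM.
  have q2 v : `[0, t]%classic v -> (0 <= 3%:E * h v)%E by move=> _; rewrite mule_ge0.
  have m2 : measurable_fun `[0, t]%classic (fun v => (3%:E * h v)%E).
    exact: emeasurable_funM.
  have q3 v : `[0, t]%classic v -> (0 <= (12 * m)%:E)%E.
    by move=> _; rewrite lee_fin mulr_ge0// ltW.
  have q23 v : `[0, t]%classic v -> (0 <= 3%:E * h v + (12 * m)%:E)%E.
    by move=> tv; rewrite adde_ge0 ?q2 ?(q3 v).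
  have m23 : measurable_fun `[0, t]%classic (fun v => (3%:E * h v + (12 * m)%:E)%E).
    exact: emeasurable_funD.
  have q4 v : `[0, t]%classic v -> (0 <= ((gt v - step_fun lt v) ^+ 2)%:E)%E.
    by move=> _; rewrite lee_fin sqr_ge0.
  rewrite ge0_integralD// ge0_integralD// !ge0_integralZl//.
  rewrite integral_cst// -integral_mkcondr setIidr; last first.
    by move=> v /=; rewrite !in_itv/= => /andP[-> /le_trans]; apply.
  apply: (@le_trans _ _ (3%:E * eta%:E + (3%:E * eta%:E + (12 * m)%:E * t%:E))%E).
    apply: leeD; first by rewrite lee_wpmul2l.
    apply: leeD; first by rewrite lee_wpmul2l.
    apply: lee_wpmul2l; first by rewrite lee_fin mulr_ge0// ltW.
    rewrite /= lebesgue_measure_itv/= lte_fin.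
    by case: ifP => _; rewrite ?oppr0 ?oppe0 ?adde0 ?lee_fin//.
  rewrite -!EFinM -!EFinD lee_fin; nra.
- apply: (@le_trans _ _ (\int[P]_w (2%:E * ((Xt w - step_int B lt w) ^+ 2)%:E +
     2%:E * ((Xs w - step_int B ls w) ^+ 2)%:E))%E).
    apply: ge0_le_integral => //=.
    - by move=> w _; rewrite lee_fin sqr_ge0.
    - apply/measurable_EFinP; apply: measurable_funX; apply: measurable_funB.
        exact: measurable_funB.
      exact: measurable_step_int wf.
    - apply: emeasurable_funD; apply: emeasurable_funM => //; apply/measurable_EFinP;
        by apply: measurable_funX; exact: measurable_funB.
    - move=> w _; rewrite lE -!EFinM -EFinD lee_fin.
      have := sqr_ge0 ((Xt w - step_int B lt w) + (Xs w - step_int B ls w)); nra.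
  have mt : measurable_fun setT (fun w => ((Xt w - step_int B lt w) ^+ 2)%:E).
    by apply/measurable_EFinP; apply: measurable_funX; exact: measurable_funB.
  have ms : measurable_fun setT (fun w => ((Xs w - step_int B ls w) ^+ 2)%:E).
    by apply/measurable_EFinP; apply: measurable_funX; exact: measurable_funB.
  have q0 (f : Omega -> R) w : [set: Omega] w -> (0 <= (f w ^+ 2)%:E)%E.
    by move=> _; rewrite lee_fin sqr_ge0.
  have q1 (f : Omega -> R) w : [set: Omega] w -> (0 <= 2%:E * (f w ^+ 2)%:E)%E.
    by move=> _; rewrite -EFinM lee_fin mulr_ge0 ?sqr_ge0.
  rewrite ge0_integralD//; [|exact: (q1 (fun w => Xt w - step_int B lt w))|exact: emeasurable_funM
    |exact: (q1 (fun w => Xs w - step_int B ls w))|exact: emeasurable_funM].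
  rewrite !ge0_integralZl//; last 2 first.
  - exact: (q0 (fun w => Xs w - step_int B ls w)).
  - exact: (q0 (fun w => Xt w - step_int B lt w)).
  apply: (@le_trans _ _ (2%:E * eta%:E + 2%:E * eta%:E)%E).
    by apply: leeD; rewrite lee_wpmul2l.
  rewrite -!EFinM -!EFinD lee_fin; lra.
Qed.

End wiener_increment.

(** * Tails of Gaussian series in L2 *)

Lemma sqr_norm_split (R : realType) (V : normedModType R) (s t S S' D : V) :
  `|t - s| ^+ 2 <= 2 * `|D| ^+ 2 +
    2 * (3 * `|s - S| ^+ 2 + (3 * `|t - S'| ^+ 2 + 3 * `|S' - S - D| ^+ 2)).
Proof.
have -> : t - s = D + (t - S' - (s - S) + (S' - S - D)).
  by rewrite addrCA [D + _]addrC subrK opprB addrAC [t - S' + _]addrA subrK addrA subrK.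
have h : `|D + (t - S' - (s - S) + (S' - S - D))| <=
    `|D| + (`|t - S'| + `|s - S| + `|S' - S - D|).
  rewrite (le_trans (ler_normD _ _))// lerD2l (le_trans (ler_normD _ _))// lerD2r.
  by rewrite (le_trans (ler_normB _ _)).
have := normr_ge0 D; have := normr_ge0 (t - S'); have := normr_ge0 (s - S).
have := normr_ge0 (S' - S - D).
have := normr_ge0 (D + (t - S' - (s - S) + (S' - S - D))).
move: (`|D + _|) (`|D|) (`|t - S'|) (`|s - S|) (`|S' - S - D|) h => p x y z v.
move=> h p0 v0 z0 y0 x0.
apply: (@le_trans _ _ ((x + (y + z + v)) ^+ 2)).
  by rewrite ler_sqr ?nnegrE// addr_ge0// addr_ge0// addr_ge0.
have := sqr_ge0 (x - (y + z + v)); have := sqr_ge0 (z - y).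
have := sqr_ge0 (z - v); have := sqr_ge0 (y - v).
rewrite !expr2; lra.
Qed.

Lemma measurable_superlevel d (T : measurableType d) (R : realType) (f : T -> R) (a : R) :
  measurable_fun setT f -> measurable [set x | a <= f x].
Proof.
move=> mf; rewrite -[X in measurable X]setTI.
exact: (measurable_fun_le (f := cst a)).
Qed.

Section random_element.
Context d (Omega : measurableType d) (R : realType).

Lemma random_element_comp (E : topologicalType) (X : Omega -> E) (f : E -> R) :
  random_element X -> continuous f -> measurable_fun setT (f \o X).
Proof.
move=> rX /continuousP cf.
apply: (@measurability _ _ Omega R setT (f \o X) (@RGenOpens.G R)); first exact: RGenOpens.measurableE.
move=> _ [_ [a [b ->] <-]]; rewrite setTI comp_preimage.
by apply: rX; apply: cf; exact: interval_open.
Qed.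

Context d' (T : measurableType d') (mu : {measure set T -> \bar R}).
Variables (phi : nat -> 'L2 mu) (hphi : orthonormal_basis phi).

Lemma measurable_sqr_norm (v : Omega -> 'L2 mu) :
  (forall k, measurable_fun setT (fun w => inner mu (v w) (phi k))) ->
  measurable_fun setT (fun w => `|v w| ^+ 2).
Proof.
move=> mv.
apply: (@measurable_fun_cvg _ _ _ _
  (fun n w => \sum_(j < n) inner mu (v w) (phi j) ^+ 2)).
  by move=> n; apply: measurable_sum => j; exact: measurable_funX.
by move=> w _; exact: parseval.
Qed.

Lemma measurable_coef (u : Omega -> 'L2 mu) k : random_element u ->
  measurable_fun setT (fun w => inner mu (u w) (phi k)).
Proof.
move=> ru; exact: (random_element_comp ru (@inner_basis_continuous _ _ _ _ _ hphi k)).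
Qed.

Lemma measurable_normB (u v : Omega -> 'L2 mu) :
  random_element u -> random_element v -> measurable_fun setT (fun w => `|u w - v w|).
Proof.
move=> ru rv.
have -> : (fun w => `|u w - v w|) = (fun w => Num.sqrt (`|u w - v w| ^+ 2)).
  by apply/funext => w; rewrite sqrtr_sqr normr_id.
apply: (@measurableT_comp _ _ _ _ _ _ (@Num.sqrt R)) => //.
  by apply: continuous_measurable_fun; exact: sqrt_continuous.
apply: measurable_sqr_norm => k; under eq_fun do rewrite innerBl.
by apply: measurable_funB; exact: measurable_coef.
Qed.

Lemma measurable_norm_basis_sum (u : Omega -> 'L2 mu) (X : nat -> Omega -> R) n :
  random_element u -> (forall k, measurable_fun setT (X k)) ->
  measurable_fun setT (fun w => `|u w - \sum_(k < n) X k w *: phi k| ^+ 2).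
Proof.
move=> ru mX; apply: measurable_sqr_norm => k.
under eq_fun do rewrite innerBl (inner_basis_sum hphi n (fun j => X j _)).
apply: measurable_funB; first exact: measurable_coef.
by case: (k < n)%N.
Qed.

End random_element.

Section tail.
Context d (Omega : measurableType d) (R : realType) (P : probability Omega R).
Context d' (T : measurableType d') (mu : {measure set T -> \bar R}).
Variables (phi : nat -> 'L2 mu) (hphi : orthonormal_basis phi).

Lemma markov_le (f : Omega -> R) (a c : R) : measurable_fun setT f ->
  (forall w, 0 <= f w) -> 0 < a -> (\int[P]_w (f w)%:E <= c%:E)%E ->
  (P [set w | (a <= f w)%R] <= (c / a)%:E)%E.
Proof.
move=> mf f0 a0 fc; set A := [set w | _].
have mA : measurable A.
  exact: measurable_superlevel.
have : (a%:E * P A <= c%:E)%E.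
  apply: le_trans fc; rewrite -integral_cst//.
  apply: (@le_trans _ _ (\int[P]_(w in A) (f w)%:E)%E).
    apply: ge0_le_integral => //.
    - by move=> w _; rewrite lee_fin ltW.
    - exact/measurable_EFinP/measurable_funTS.
  apply: ge0_subset_integral => //; first exact/measurable_EFinP.
  by move=> w _; rewrite lee_fin.
by rewrite -lee_pdivlMl// -EFinM mulrC.
Qed.

Lemma gaussian_series_tail (us ut : Omega -> 'L2 mu) (Xs Xt : nat -> Omega -> R)
    (q : nat -> R) (Q e : R) :
  random_element us -> random_element ut ->
  (forall k, measurable_fun setT (Xs k)) -> (forall k, measurable_fun setT (Xt k)) ->
  (fun n => \int[P]_w (`|us w - \sum_(k < n) Xs k w *: phi k| ^+ 2)%:E)%E @ \oo --> 0%E ->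
  (fun n => \int[P]_w (`|ut w - \sum_(k < n) Xt k w *: phi k| ^+ 2)%:E)%E @ \oo --> 0%E ->
  (forall k, 0 < q k) -> (forall n, \sum_(k < n) q k <= Q) ->
  (forall k e', 0 < e' -> exists Z, [/\ centred_gaussian P Z,
    (\int[P]_w (Z w ^+ 2)%:E <= (q k)%:E)%E &
    (\int[P]_w ((Xt k w - Xs k w - Z w) ^+ 2)%:E <= e'%:E)%E]) ->
  0 < e ->
  (P [set w | (e <= `|ut w - us w|)%R] <= (2 * expR (- (e ^+ 2 / (128 * Q))))%:E)%E.
Proof.
move=> rs rt mXs mXt cs ct q0 qQ happ e0.
have e20 : 0 < e ^+ 2 by rewrite exprn_gt0.
apply/lee_addgt0Pr => del del0.
pose eta := del * e ^+ 2 / 36.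
have eta0 : 0 < eta by rewrite divr_gt0// mulr_gt0.
have [N1 _ h1] := cvge0_near_le cs eta0; have [N2 _ h2] := cvge0_near_le ct eta0.
pose n := maxn N1 N2.
have As := h1 n.+1 (leq_trans (leq_maxl N1 N2) (leqnSn n)).
have At := h2 n.+1 (leq_trans (leq_maxr N1 N2) (leqnSn n)).
rewrite /= in As At.
have eN : 0 < eta / n.+1%:R by rewrite divr_gt0.
have /choice [Z hZ] := fun k => happ k _ eN.
have mZ k : measurable_fun setT (Z k) by have [[]] := hZ k.
pose U1 w := \sum_(k < n.+1) Z k w ^+ 2.
pose g w := 3 * `|us w - \sum_(k < n.+1) Xs k w *: phi k| ^+ 2 +
  (3 * `|ut w - \sum_(k < n.+1) Xt k w *: phi k| ^+ 2 +
   3 * \sum_(k < n.+1) (Xt k w - Xs k w - Z k w) ^+ 2).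
have mg1 := measurable_norm_basis_sum hphi n.+1 rs mXs.
have mg2 := measurable_norm_basis_sum hphi n.+1 rt mXt.
have mg3 : measurable_fun setT (fun w => \sum_(k < n.+1) (Xt k w - Xs k w - Z k w) ^+ 2).
  apply: measurable_sum => k; apply: measurable_funX; apply: measurable_funB => //.
  exact: measurable_funB.
have mg : measurable_fun setT g.
  by apply: measurable_funD; [|apply: measurable_funD]; exact: measurable_funM.
have g0 w : 0 <= g w.
  by rewrite !addr_ge0// mulr_ge0// ?sqr_ge0// sumr_ge0// => k _; exact: sqr_ge0.
have mU1 : measurable_fun setT U1.
  by apply: measurable_sum => k; exact: measurable_funX.
have key w : `|ut w - us w| ^+ 2 <= 2 * U1 w + 2 * g w.
  have cE : `|\sum_(k < n.+1) Xt k w *: phi k - \sum_(k < n.+1) Xs k w *: phi k -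
      \sum_(k < n.+1) Z k w *: phi k| ^+ 2 =
      \sum_(k < n.+1) (Xt k w - Xs k w - Z k w) ^+ 2.
    rewrite -(norm_basis_sum hphi n.+1 (fun k => Xt k w - Xs k w - Z k w)).
    by rewrite -!sumrB; congr (`|_| ^+ 2); apply: eq_bigr => k _; rewrite !scalerBl.
  rewrite /U1 /g -(norm_basis_sum hphi n.+1 (fun k => Z k w)) -cE.
  exact: sqr_norm_split.
have mge : measurable_fun setT (fun w => (g w)%:E) by exact/measurable_EFinP.
have Eg : (\int[P]_w (g w)%:E <= (9 * eta)%:E)%E.
  have p0 (f : Omega -> R) : (forall w, 0 <= f w) -> forall w, [set: Omega] w -> (0 <= (f w)%:E)%E.
    by move=> f0 w _; rewrite lee_fin.
  have lin (f h : Omega -> R) : measurable_fun setT f -> measurable_fun setT h ->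
      (forall w, 0 <= f w) -> (forall w, 0 <= h w) ->
      (\int[P]_w (3 * f w + h w)%:E = 3%:E * \int[P]_w (f w)%:E + \int[P]_w (h w)%:E)%E.
    move=> mf mh f0 h0; under eq_integral do rewrite EFinD.
    have mf' : measurable_fun setT (fun w => (f w)%:E) by exact/measurable_EFinP.
    have mh' : measurable_fun setT (fun w => (h w)%:E) by exact/measurable_EFinP.
    have m3 : measurable_fun setT (fun w => (3 * f w)%:E).
      by apply/measurable_EFinP; exact: measurable_funM.
    rewrite ge0_integralD//; last 2 first.
      by apply: p0 => w; rewrite mulr_ge0.
      exact: p0.
    congr (_ + _)%E; under eq_integral do rewrite EFinM.
    by rewrite ge0_integralZl//; exact: p0.
  have s0 w : 0 <= \sum_(k < n.+1) (Xt k w - Xs k w - Z k w) ^+ 2.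
    by rewrite sumr_ge0// => k _; exact: sqr_ge0.
  have E3 : (\int[P]_w (\sum_(k < n.+1) (Xt k w - Xs k w - Z k w) ^+ 2)%:E <= eta%:E)%E.
    under eq_integral do rewrite -sumEFin.
    rewrite ge0_integral_sum//; last 2 first.
      move=> k; apply/measurable_EFinP; apply: measurable_funX; apply: measurable_funB => //.
      exact: measurable_funB.
      by move=> k w _; rewrite lee_fin sqr_ge0.
    apply: (@le_trans _ _ (\sum_(k < n.+1) (eta / n.+1%:R)%:E)%E).
      by apply: lee_sum => k _; have [] := hZ k.
    rewrite sumEFin lee_fin sumr_const card_ord -[leLHS]mulr_natr.
    by rewrite divfK.
  rewrite /g lin//; last 2 first.
  - by apply: measurable_funD; exact: measurable_funM.
  - by move=> w; rewrite addr_ge0// mulr_ge0// ?sqr_ge0.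
  have -> : (9 * eta)%:E = (3%:E * eta%:E + (3%:E * eta%:E + 3%:E * eta%:E))%E.
    by rewrite -!EFinM -!EFinD; congr EFin; ring.
  apply: leeD; first by apply: lee_wpmul2l; [rewrite lee_fin|exact: As].
  rewrite lin//; last 2 first.
  - exact: measurable_funM.
  - by move=> w; rewrite mulr_ge0.
  apply: leeD; first by apply: lee_wpmul2l; [rewrite lee_fin|exact: At].
  under eq_integral do rewrite EFinM.
  rewrite ge0_integralZl//; last 2 first.
  - exact/measurable_EFinP.
  - exact: p0.
  by rewrite lee_wpmul2l.
have mA : measurable [set w | (e ^+ 2 / 4 <= U1 w)%R].
  exact: measurable_superlevel.
have mB : measurable [set w | (e ^+ 2 / 4 <= g w)%R].
  exact: measurable_superlevel.
apply: (@le_trans _ _ (P ([set w | (e ^+ 2 / 4 <= U1 w)%R] `|` [set w | (e ^+ 2 / 4 <= g w)%R]))).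
  apply: le_measure.
  - apply: mem_set; apply: measurable_superlevel; exact: (measurable_normB hphi).
  - by apply: mem_set; exact: measurableU.
  move=> w /= ew; have := key w.
  have : e ^+ 2 <= `|ut w - us w| ^+ 2 by rewrite ler_sqr ?nnegrE// ltW.
  have [|l1] := leP (e ^+ 2 / 4) (U1 w); first by left.
  have [|l2] := leP (e ^+ 2 / 4) (g w); first by right.
  by move=> h3 h4; exfalso; lra.
apply: (le_trans (measureU2 _ mA mB)); apply: leeD.
  pose qs := \sum_(k < n.+1) q k.
  have qs0 : 0 < qs by rewrite /qs big_ord_recl ltr_pwDl// sumr_ge0// => k _; exact: ltW.
  have Q0 : 0 < Q by exact: lt_le_trans qs0 (qQ _).
  apply: (le_trans (@gaussian_sum_tail _ _ _ P n (fun k => Z k) (fun k => q k) _ _ _ _)).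
  - by move=> k; have [] := hZ k.
  - by move=> k.
  - by move=> k; have [] := hZ k.
  rewrite lee_fin ler_wpM2l// ler_expR lerN2 -/qs.
  rewrite (_ : e ^+ 2 / 4 / (32 * qs) = e ^+ 2 / (128 * qs)); last first.
    by field; rewrite gt_eqF.
  by rewrite ler_wpM2l ?(ltW e20)// lef_pV2 ?posrE ?mulr_gt0// ler_wpM2l// qQ.
apply: (le_trans (markov_le mg g0 _ Eg)); first by rewrite divr_gt0.
rewrite lee_fin /eta le_eqVlt; apply/orP; left; apply/eqP.
by field; rewrite gt_eqF.
Qed.

End tail.

(** * Completeness of L2 *)

Lemma geometric_sum_le (R : realType) (C rho : R) n : 0 <= C -> 0 <= rho < 1 ->
  \sum_(k < n) C * rho ^+ k <= C / (1 - rho).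
Proof.
move=> C0 /andP[r0 r1]; have r10 : 0 < 1 - rho by rewrite subr_gt0.
rewrite -mulr_sumr ler_wpM2l// -[leRHS]mul1r ler_pdivlMr//.
rewrite (_ : _ * (1 - rho) = - ((rho - 1) * \sum_(k < n) rho ^+ k)); last by ring.
rewrite -subrX1; have := exprn_ge0 n r0; lra.
Qed.

Lemma geometric_tail_le (R : realType) (V : normedModType R) (u : nat -> V) (C rho : R) :
  0 <= C -> 0 <= rho < 1 -> (forall n, `|u n.+1 - u n| <= C * rho ^+ n) ->
  forall n m, `|u (n + m)%N - u n| <= C * rho ^+ n / (1 - rho).
Proof.
move=> C0 r01 hu n m; have r0 : 0 <= rho by case/andP: r01.
apply: (@le_trans _ _ (\sum_(k < m) (C * rho ^+ n) * rho ^+ k)).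
  elim: m => [|m IH]; first by rewrite addn0 subrr normr0 big_ord0.
  rewrite big_ord_recr/= addnS -[u _](subrK (u (n + m)%N)) -addrA.
  rewrite (le_trans (ler_normD _ _))// [leRHS]addrC lerD//.
  by rewrite (le_trans (hu _))// exprD mulrA.
by apply: geometric_sum_le => //; rewrite mulr_ge0// exprn_ge0.
Qed.

Lemma limn_einf_le (R : realType) (u : nat -> \bar R) (K : \bar R) :
  (forall n, (u n <= K)%E) -> (limn_einf u <= K)%E.
Proof.
move=> uK; rewrite limn_einf_lim; apply: lime_le; first exact: is_cvg_einfs.
apply: nearW => n; apply: le_trans (uK n); apply: ereal_inf_lbound.
by exists n => /=.
Qed.

Section completeness.
Context d (T : measurableType d) (R : realType) (mu : probability T R).
Implicit Types u : nat -> 'L2 mu.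

Lemma Lfun2P (f : T -> R) : measurable_fun setT f ->
  (\int[mu]_x (f x ^+ 2)%:E < +oo)%E -> f \in Lfun mu 2%:E.
Proof.
move=> mf fi; apply/andP; split; apply: mem_set => //=.
rewrite /finite_norm unlock; apply: poweR_lty; apply: le_lt_trans fi.
rewrite le_eqVlt; apply/orP; left; apply/eqP; apply: eq_integral => x _.
by rewrite /= powR_mulrn// real_normK// num_real.
Qed.

Lemma L2_geometric_cvg u (C rho : R) : 0 < C -> 0 < rho < 1 ->
  (forall n, `|u n.+1 - u n| <= C * rho ^+ n) ->
  exists l : 'L2 mu, forall n, `|l - u n| <= C * rho ^+ n / (1 - rho).
Proof.
move=> C0 /andP[r0 r1] hu; have r10 : 0 < 1 - rho by rewrite subr_gt0.
have r01 : 0 <= rho < 1 by rewrite (ltW r0).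
pose a n x := `|u n.+1 x - u n x|.
have mu_ n : measurable_fun setT (u n : T -> R) := L2_measurable (u n).
have ma n : measurable_fun setT (a n).
  by apply: measurableT_comp => //; exact: measurable_funB.
have cr n : 0 < C * rho ^+ n by rewrite mulr_gt0// exprn_gt0.
have ia n : (\int[mu]_x (a n x)%:E <= (C * rho ^+ n)%:E)%E.
  set c := C * rho ^+ n in cr *; have c0 : 0 < c by exact: cr.
  have h2 : (\int[mu]_x ((u n.+1 x - u n x) ^+ 2)%:E <= (c ^+ 2)%:E)%E.
    rewrite -L2_normB lee_fin ler_sqr ?nnegrE//; exact: ltW.
  apply: (@le_trans _ _ (\int[mu]_x ((2 * c)^-1%:E * ((u n.+1 x - u n x) ^+ 2)%:E + (c / 2)%:E))%E).
    apply: ge0_le_integral => //.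
    - by move=> x _; rewrite lee_fin /a normr_ge0.
    - exact/measurable_EFinP.
    - apply: emeasurable_funD => //; apply: emeasurable_funM => //.
      by apply/measurable_EFinP; apply: measurable_funX; exact: measurable_funB.
    - move=> x _; rewrite -EFinM -EFinD lee_fin /a -(real_normK (num_real (u n.+1 x - u n x))).
      move: (`|_|) => y; have := sqr_ge0 (y - c).
      have c2 : 0 < 2 * c by rewrite mulr_gt0.
      rewrite -(ler_pM2l c2) mulrDr mulVKf ?gt_eqF//.
      move=> h; rewrite (_ : 2 * c * (c / 2) = c ^+ 2); last by field.
      nra.
  have p0 x : [set: T] x -> (0 <= ((u n.+1 x - u n x) ^+ 2)%:E)%E.
    by move=> _; rewrite lee_fin sqr_ge0.
  have p1 x : [set: T] x -> (0 <= (2 * c)^-1%:E * ((u n.+1 x - u n x) ^+ 2)%:E)%E.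
    by move=> _; rewrite -EFinM lee_fin mulr_ge0 ?sqr_ge0// invr_ge0 mulr_ge0// ltW.
  have m0 : measurable_fun setT (fun x => ((u n.+1 x - u n x) ^+ 2)%:E).
    by apply/measurable_EFinP; apply: measurable_funX; exact: measurable_funB.
  rewrite ge0_integralD//; last 2 first.
  - exact: emeasurable_funM.
  - by move=> x _; rewrite lee_fin divr_ge0// ltW.
  rewrite ge0_integralZl//; last by rewrite lee_fin invr_ge0 mulr_ge0// ltW.
  rewrite integral_cst//.
  apply: (@le_trans _ _ ((2 * c)^-1%:E * (c ^+ 2)%:E + (c / 2)%:E)%E).
    apply: leeD.
      apply: lee_wpmul2l; [by rewrite lee_fin invr_ge0 mulr_ge0// ltW|exact: h2].
    by rewrite [X in (_ * X)%E](_ : _ = 1%E) ?mule1//; exact: probability_setT.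
  rewrite -EFinM -EFinD lee_fin le_eqVlt; apply/orP; left; apply/eqP.
  by field; rewrite gt_eqF.
pose S x := (\sum_(n <oo) (a n x)%:E)%E.
have a0 n x : (0 <= (a n x)%:E)%E by rewrite lee_fin normr_ge0.
have mS : measurable_fun setT S.
  apply: ge0_emeasurable_sum => [n x _ _|n _]; first exact: a0.
  exact/measurable_EFinP.
have iS : (\int[mu]_x S x <= (C / (1 - rho))%:E)%E.
  rewrite integral_nneseries//; last by move=> n; exact/measurable_EFinP.
  apply: lime_le; first by apply: is_cvg_nneseries => n _ _; exact: integral_ge0.
  apply: nearW => n; apply: (@le_trans _ _ (\sum_(0 <= k < n) (C * rho ^+ k)%:E)%E).
    by apply: lee_sum => k _; exact: ia.
  by rewrite sumEFin lee_fin big_mkord geometric_sum_le// ltW.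
have S0 x : (0 <= S x)%E by apply: nneseries_ge0.
have : mu.-integrable setT S.
  apply/integrableP; split => //; apply: le_lt_trans (ltry (C / (1 - rho))).
  by under eq_integral do rewrite gee0_abs//.
move=> /(integrable_ae measurableT)[A [mA A0 Afin]].
pose v n x := u n x * \1_(~` A) x.
have mv n : measurable_fun setT (v n).
  by apply: measurable_funM => //; apply: measurable_indic; exact: measurableC.
have vu n x : ~ A x -> v n x = u n x.
  by move=> nA; rewrite /v indicE mem_set// mulr1.
have cv x : cvgn (fun n => v n x).
  have [Ax|nAx] := pselect (A x).
    have -> : (fun n => v n x) = (fun=> 0).
      by apply/funext => n; rewrite /v indicE memNset ?mulr0//= => /(_ Ax).
    exact: is_cvg_cst.
  have -> : (fun n => v n x) = (fun n => u n x) by apply/funext => n; rewrite vu.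
  have Sfin : S x \is a fin_num.
    by apply: contrapT => h; apply: nAx; apply: Afin => /= /(_ I).
  have -> : (fun n => u n x) = (fun n => u 0%N x + series (telescope (fun n => u n x)) n).
    by apply/funext => n; rewrite -eq_sum_telescope.
  apply: is_cvgD; first exact: is_cvg_cst.
  apply: (@normed_cvg R R^o); apply: nondecreasing_is_cvgn.
    apply: nondecreasing_series => n _ _; exact: normr_ge0.
  exists (fine (S x)) => _ [n _ <-].
  rewrite -lee_fin fineK// /series/= -sumEFin.
  exact: (@nneseries_lim_ge R (fun n => (a n x)%:E) xpredT 0 n).
pose g x := limn (fun n => v n x).
have mg : measurable_fun setT g.
  by apply: (@measurable_fun_cvg _ _ _ _ v) => // x _; exact: cv.
have gu n : (\int[mu]_x ((g x - u n x) ^+ 2)%:E <= ((C * rho ^+ n / (1 - rho)) ^+ 2)%:E)%E.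
  pose f m x := ((v (n + m)%N x - v n x) ^+ 2)%:E.
  have mf m : measurable_fun setT (f m).
    by apply/measurable_EFinP; apply: measurable_funX; exact: measurable_funB.
  have f0 m x : (0 <= f m x)%E by rewrite lee_fin sqr_ge0.
  have cf x : f^~ x @ \oo --> ((g x - v n x) ^+ 2)%:E.
    apply: cvg_EFin; first exact: nearW.
    have h : (fun m => v (n + m)%N x) @ \oo --> g x.
      have := cv x; rewrite /g -(cvg_shiftn n) => h.
      by under eq_cvg do rewrite addnC.
    apply: (@cvg_comp _ _ _ (fun m => v (n + m)%N x - v n x) (fun y : R => y ^+ 2));
      last exact: exprn_continuous.
    by apply: cvgB => //; exact: cvg_cst.
  have -> : (\int[mu]_x ((g x - u n x) ^+ 2)%:E = \int[mu]_x limn_einf (f^~ x))%E.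
    transitivity (\int[mu]_x ((g x - v n x) ^+ 2)%:E)%E; last first.
      apply: eq_integral => x _.
      by rewrite is_cvg_limn_einfE ?(cvg_lim _ (cf x))//; apply/cvg_ex; eexists; exact: cf.
    apply: ae_eq_integral => //.
    - by apply/measurable_EFinP; apply: measurable_funX; exact: measurable_funB.
    - by apply/measurable_EFinP; apply: measurable_funX; exact: measurable_funB.
    exists A; split => // x /= h; apply: contrapT => nA; apply: h => _.
    by rewrite vu.
  apply: (le_trans (fatou _ _ _ _)) => //; apply: limn_einf_le => m.
  have -> : (\int[mu]_x f m x = (`|u (n + m)%N - u n| ^+ 2)%:E)%E.
    rewrite L2_normB; apply: ae_eq_integral => //.
      apply/measurable_EFinP; apply: measurable_funX; exact: measurable_funB.
    exists A; split => // x /= h; apply: contrapT => nA; apply: h => _.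
    by rewrite /f !vu.
  rewrite lee_fin ler_sqr ?nnegrE ?divr_ge0 ?(ltW (cr n)) ?(ltW r10)//.
  by apply: geometric_tail_le => //; exact: ltW.
have gL : g \in Lfun mu 2%:E.
  apply: Lfun2P => //.
  apply: (@le_lt_trans _ _ (\int[mu]_x (2%:E * ((g x - u 0%N x) ^+ 2)%:E + 2%:E * (u 0%N x ^+ 2)%:E))%E).
    apply: ge0_le_integral => //.
    - by move=> x _; rewrite lee_fin sqr_ge0.
    - by apply/measurable_EFinP; exact: measurable_funX.
    - apply: emeasurable_funD; apply: emeasurable_funM => //; apply/measurable_EFinP;
        apply: measurable_funX => //; exact: measurable_funB.
    - move=> x _; rewrite -!EFinM -EFinD lee_fin.
      have := sqr_ge0 (g x - 2 * u 0%N x); nra.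
  have q0 (f : T -> R) : forall x, [set: T] x -> (0 <= (f x ^+ 2)%:E)%E.
    by move=> x _; rewrite lee_fin sqr_ge0.
  have q1 (f : T -> R) : forall x, [set: T] x -> (0 <= 2%:E * (f x ^+ 2)%:E)%E.
    by move=> x _; rewrite -EFinM lee_fin mulr_ge0 ?sqr_ge0.
  have m1 : measurable_fun setT (fun x => ((g x - u 0%N x) ^+ 2)%:E).
    by apply/measurable_EFinP; apply: measurable_funX; exact: measurable_funB.
  have m2 : measurable_fun setT (fun x => (u 0%N x ^+ 2)%:E).
    by apply/measurable_EFinP; exact: measurable_funX.
  rewrite ge0_integralD//; [|exact: (q1 (fun x => g x - u 0%N x))|exact: emeasurable_funM
    |exact: (q1 (u 0%N : T -> R))|exact: emeasurable_funM].
  rewrite ge0_integralZl//; last exact: (q0 (fun x => g x - u 0%N x)).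
  rewrite ge0_integralZl//; last exact: (q0 (u 0%N : T -> R)).
  rewrite -L2_normE lte_add_pinfty// ?lte_mul_pinfty ?ltry//.
  by rewrite (le_lt_trans (gu 0%N))// ltry.
exists (Lclass (Lfun_Sub (lee1n 2) gL)) => n.
rewrite -ler_sqr ?nnegrE ?divr_ge0 ?(ltW (cr n)) ?(ltW r10)// -lee_fin.
apply: le_trans (gu n); rewrite L2_normB.
rewrite le_eqVlt; apply/orP; left; apply/eqP; apply: ae_eq_integral => //.
- by apply/measurable_EFinP; apply: measurable_funX; apply: measurable_funB => //; exact: L2_measurable.
- by apply/measurable_EFinP; apply: measurable_funX; exact: measurable_funB.
- apply: filterS (Lclass_ae (Lfun_Sub (lee1n 2) gL)) => x h _.
  by rewrite h.
Qed.

End completeness.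

(** * Dyadic chaining *)

Section dyadic.
Context (R : realType).

Definition dyad (n j : nat) : R := j%:R / 2 ^+ n.

Definition dfloor (n : nat) (t : R) : R := dyad n (Num.truncn (2 ^+ n * t)).

Lemma dyad_ge0 n j : 0 <= dyad n j. Proof. by rewrite divr_ge0. Qed.

Lemma dfloor_ge0 n t : 0 <= dfloor n t. Proof. exact: dyad_ge0. Qed.

Lemma dfloor_itv n t : 0 <= t -> dfloor n t <= t /\ t - dfloor n t <= 2 ^- n.
Proof.
move=> t0; have p0 : 0 < 2 ^+ n :> R by rewrite exprn_gt0.
have pt : 0 <= 2 ^+ n * t by rewrite mulr_ge0// ltW.
have /andP[h1 h2] := truncn_itv pt; rewrite /dfloor /dyad; split.
  by rewrite ler_pdivrMr// [leRHS]mulrC.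
rewrite lerBlDr -[X in X + _]div1r -mulrDl ler_pdivlMr// mulrC ltW//.
by rewrite (lt_le_trans h2)// -natr1 addrC.
Qed.

Lemma dyad_double n j : dyad n.+1 j.*2 = dyad n j.
Proof.
rewrite /dyad -muln2 natrM exprS; field.
by rewrite expf_neq0.
Qed.

Lemma dfloor_lt n (t : R) N : 0 <= t -> t < N%:R -> (Num.truncn (2 ^+ n * t) < N * 2 ^ n)%N.
Proof.
move=> t0 tN; rewrite truncn_lt_nat; last by rewrite mulr_ge0// exprn_ge0.
by rewrite natrM natrX mulrC ltr_pM2r// exprn_gt0.
Qed.

Lemma dyadic_scale (h : R) n0 : 0 < h -> h <= 2 ^- n0 ->
  exists2 n, (n0 <= n)%N & 2 ^- n.+1 < h <= 2 ^- n.
Proof.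
move=> h0 hn0.
have ex : exists n, 2 ^- n.+1 < h.
  have : (fun n => (2^-1 : R) ^+ n) @ \oo --> 0.
    by apply: cvg_expr; rewrite ger0_norm//; lra.
  move=> /cvgrPdist_lt /(_ _ h0)[n _ /(_ n.+1 (leqnSn n))].
  rewrite /= sub0r normrN ger0_norm ?exprn_ge0// exprVn => ?.
  by exists n.
have [n hn nmin] := ex_minnP ex; exists n.
  rewrite leqNgt; apply/negP => nn0; have /(lt_le_trans hn) := hn0.
  by rewrite ltNge lef_pV2 ?posrE ?exprn_gt0// ler_eXn2l ?ltr1n// nn0.
rewrite hn/=; case: n nmin hn => [|n] nmin hn.
  rewrite expr0 invr1 (le_trans hn0)// invf_le1 ?exprn_gt0//.
  by rewrite exprn_ege1// ler1n.
rewrite leNgt; apply/negP => nh; have := nmin n nh.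
by rewrite ltnn.
Qed.

Context (V : normedModType R) (f : R -> V) (rho : R) (N n0 : nat).
Hypotheses (rho01 : 0 < rho < 1)
  (inc : forall n j, (n0 <= n)%N -> (j < N * 2 ^ n)%N ->
     `|f (dyad n j.+1) - f (dyad n j)| <= rho ^+ n).

Let rho0 : 0 < rho. Proof. by case/andP: rho01. Qed.

Lemma dfloor_refine n t : (n0 <= n)%N -> 0 <= t -> t < N%:R ->
  `|f (dfloor n.+1 t) - f (dfloor n t)| <= rho ^+ n.+1.
Proof.
move=> n0n t0 tN; rewrite /dfloor -(dyad_double n).
set k := Num.truncn _; set k' := Num.truncn _.
have p0 : 0 < 2 ^+ n :> R by rewrite exprn_gt0.
have pt m : 0 <= 2 ^+ m * t by rewrite mulr_ge0// exprn_ge0.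
have /andP[h1 h2] := truncn_itv (pt n.+1).
have /andP[h3 h4] := truncn_itv (pt n).
rewrite -/k in h1 h2; rewrite -/k' in h3 h4.
have l1 : (k'.*2 <= k)%N.
  rewrite /k truncn_ge_nat// -muln2 natrM exprS -mulrA mulrC.
  by rewrite ler_pM2l.
have l2 : (k < k'.*2.+2)%N.
  rewrite /k truncn_lt_nat// -doubleS -muln2 natrM exprS -mulrA mulrC.
  by rewrite ltr_pM2r.
have [->|kn] := eqVneq k k'.*2; first by rewrite subrr normr0 exprn_ge0// ltW.
have -> : k = k'.*2.+1.
  by apply/eqP; rewrite eqn_leq -ltnS l2 ltn_neqAle eq_sym kn.
apply: inc; first exact: leq_trans (leqnSn n).
rewrite expnS mulnCA -muln2 mulnC ltn_pmul2l//.
exact: dfloor_lt.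
Qed.

Lemma dfloor_close n s t : (n0 <= n)%N -> 0 <= s -> s <= t -> t < N%:R ->
  t - s <= 2 ^- n -> `|f (dfloor n t) - f (dfloor n s)| <= rho ^+ n.
Proof.
move=> n0n s0 st tN hst; have t0 := le_trans s0 st.
have p0 : 0 < 2 ^+ n :> R by rewrite exprn_gt0.
rewrite /dfloor; set k := Num.truncn (_ * t); set k' := Num.truncn _.
have pt : 0 <= 2 ^+ n * t by rewrite mulr_ge0// exprn_ge0.
have ps : 0 <= 2 ^+ n * s by rewrite mulr_ge0// exprn_ge0.
have l1 : (k' <= k)%N.
  rewrite /k truncn_ge_nat//; have /andP[h _] := truncn_itv ps.
  by apply: (le_trans h); rewrite ler_pM2l.
have l2 : (k < k'.+2)%N.
  rewrite /k truncn_lt_nat//; have /andP[_ h] := truncn_itv ps.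
  have : 2 ^+ n * t - 2 ^+ n * s <= 1.
    by rewrite -mulrBr -ler_pdivlMl// mulr1.
  rewrite -/k' in h; rewrite -natr1; lra.
have [->|kn] := eqVneq k k'; first by rewrite subrr normr0 exprn_ge0// ltW.
have -> : k = k'.+1.
  by apply/eqP; rewrite eqn_leq -ltnS l2 ltn_neqAle eq_sym kn.
by apply: inc => //; apply: dfloor_lt => //; exact: le_lt_trans tN.
Qed.

Variables (l : R -> V) (K : R).
Hypotheses (K0 : 0 <= K) (lim_l : forall n t, (n0 <= n)%N -> 0 <= t -> t < N%:R ->
  `|l t - f (dfloor n t)| <= K * rho ^+ n).

Lemma dyadic_hoelder gamma : 0 < gamma -> rho = 2 `^ (- gamma) ->
  exists2 C : R, 0 < C & forall s t, 0 <= s < N%:R -> 0 <= t < N%:R ->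
    `|l t - l s| <= C * `|t - s| `^ gamma.
Proof.
move=> g0 rhoE.
have rhoX n : rho ^+ n = (2 ^- n) `^ gamma.
  rewrite rhoE -powR_mulrn ?powR_ge0// -powRrM -powR_invn// -powRrM; congr (_ `^ _); ring.
pose b := \big[Num.max/0]_(j < (N * 2 ^ n0).+1) `|f (dyad n0 j)|.
have b0 : 0 <= b by exact: bigmax_ge_id.
pose B := K * rho ^+ n0 + b.
have B0 : 0 <= B by rewrite addr_ge0// mulr_ge0// exprn_ge0// ltW.
have lB t : 0 <= t < N%:R -> `|l t| <= B.
  move=> /andP[t0 tN]; rewrite -[l t](subrK (f (dfloor n0 t))).
  rewrite (le_trans (ler_normD _ _))// lerD ?lim_l//.
  have h := dfloor_lt n0 t0 tN.
  have h' : (Num.truncn (2 ^+ n0 * t) < (N * 2 ^ n0).+1)%N by rewrite ltnS ltnW.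
  by rewrite /b (le_bigmax 0 (fun j : 'I_(N * 2 ^ n0).+1 => `|f (dyad n0 j)|) (Ordinal h')).
pose C := (2 * K + 1) * 2 `^ gamma + 2 * B * (2 ^+ n0) `^ gamma.
have C1 : 0 < (2 * K + 1) * 2 `^ gamma.
  by rewrite mulr_gt0 ?powR_gt0// ltr_wpDl// mulr_ge0.
have C2 : 0 <= 2 * B * (2 ^+ n0) `^ gamma by rewrite mulr_ge0 ?powR_ge0// mulr_ge0.
exists C; first by rewrite ltr_pwDl.
suff W s t : 0 <= s < N%:R -> 0 <= t < N%:R -> s < t ->
    `|l t - l s| <= C * (t - s) `^ gamma.
  move=> s t sN tN; have [st|ts|->] := ltgtP s t.
  - by rewrite [X in X `^ _]gtr0_norm ?subr_gt0// W.
  - by rewrite distrC [X in _ <= _ * X `^ _]distrC [X in X `^ _]gtr0_norm ?subr_gt0// W.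
  - by rewrite !subrr normr0 mulr_ge0 ?powR_ge0// addr_ge0// ltW.
move=> sN tN st; have h0 : 0 < t - s by rewrite subr_gt0.
have [hs|hb] := leP (t - s) (2 ^- n0).
  have [n n0n /andP[nh hn]] := dyadic_scale h0 hs.
  move: sN tN => /andP[s0 sN] /andP[t0 tN].
  have e1 : `|l t - l s| <= (2 * K + 1) * rho ^+ n.
    rewrite (_ : l t - l s = (l t - f (dfloor n t)) +
       ((f (dfloor n t) - f (dfloor n s)) - (l s - f (dfloor n s)))); last first.
      by rewrite opprB !addrA !subrK.
    rewrite (le_trans (ler_normD _ _))//.
    have := lim_l n0n t0 tN; have := lim_l n0n s0 sN.
    have := dfloor_close n0n s0 (ltW st) tN hn.
    have := ler_normB (f (dfloor n t) - f (dfloor n s)) (l s - f (dfloor n s)); lra.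
  apply: (le_trans e1); rewrite /C [leRHS]mulrDl.
  apply: (@le_trans _ _ ((2 * K + 1) * 2 `^ gamma * (t - s) `^ gamma)).
    rewrite -mulrA ler_wpM2l ?addr_ge0 ?mulr_ge0// rhoX.
    rewrite -powRM ?(ltW h0)//; apply: ge0_ler_powR; rewrite ?nnegrE ?(ltW g0) ?invr_ge0 ?exprn_ge0//.
      by rewrite mulr_ge0// ltW.
    rewrite -ler_pdivrMl// ltW// (le_lt_trans _ nh)//.
    by rewrite exprS invfM.
  by rewrite lerDl mulr_ge0 ?powR_ge0.
apply: (@le_trans _ _ (2 * B)).
  by rewrite (le_trans (ler_normB _ _))// mulr_natl mulr2n lerD// lB.
apply: (@le_trans _ _ (2 * B * (2 ^+ n0) `^ gamma * (t - s) `^ gamma)).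
  rewrite -mulrA ler_peMr ?mulr_ge0// -powRM ?exprn_ge0 ?(ltW h0)//.
  rewrite -[leLHS](powRr0 (2 ^+ n0 * (t - s))); apply: ler_powR; last exact: ltW.
  by rewrite -ler_pdivrMl ?exprn_gt0// mulr1 ltW.
by rewrite /C [leRHS]mulrDl lerDr mulr_ge0 ?powR_ge0// ltW.
Qed.

End dyadic.

Lemma random_element_cvg d (Omega : measurableType d) (R : realType)
    (V : normedModType R) (Z : set Omega) (g_ : nat -> Omega -> V) (g : Omega -> V) (z : V) :
  measurable Z -> (forall n, random_element (g_ n)) ->
  (forall w, ~ Z w -> (fun n => g_ n w) @ \oo --> g w) ->
  (forall w, Z w -> g w = z) -> random_element g.
Proof.
move=> mZ rg cg gz A oA.
pose inner_part m := [set x : V | forall y, `|x - y| < m.+1%:R^-1 -> A y].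
have oC m : open (~` inner_part m).
  have -> : ~` inner_part m = \bigcup_(y in ~` A) ball y (m.+1%:R^-1 : R).
    apply/seteqP; split=> [x /= /existsNP[y /not_implyP[xy nAy]]|x [y nAy xy] h].
      by exists y => //; rewrite -ball_normE /= distrC.
    by apply: nAy; apply: h; rewrite -ball_normE /= distrC in xy.
  by apply: bigcup_open => y _; exact: ball_open.
have mC m n : measurable (g_ n @^-1` inner_part m).
  rewrite -[inner_part m]setCK preimage_setC; apply: measurableC; exact: (rg n _ (oC m)).
have -> : g @^-1` A = (~` Z `&` \bigcup_m \bigcup_k \bigcap_(n in [set n | (k <= n)%N])
     (g_ n @^-1` inner_part m)) `|` (Z `&` [set w | A z]).
  apply/seteqP; split=> [w /= Agw|w].
    have [Zw|nZw] := pselect (Z w); first by right; rewrite -(gz w Zw).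
    left; split => //; have /nbhs_ballP[r /= r0 hr] := open_nbhs_nbhs (conj oA Agw).
    have r20 : 0 < r / 2 by rewrite divr_gt0.
    have [m _ /(_ m (leqnn m)) /= hm1] := near_infty_natSinv_lt (PosNum r20).
    have /cvgrPdist_lt /(_ _ r20) [k _ hk] := cg w nZw.
    exists m => //; exists k => // n /= kn y gy; apply: hr.
    rewrite -ball_normE /=; have := hk n kn; rewrite /= => h1.
    rewrite -(subrK (g_ n w) (g w)) -addrA (le_lt_trans (ler_normD _ _))//.
    by rewrite (splitr r) ltrD// (lt_trans gy).
  move=> [[nZ [m _ [k _ hk]]]|[Zw /= Az]]; last by rewrite /= (gz w Zw).
  suff : inner_part m (g w).
    by move=> /= h; apply: h; rewrite subrr normr0 invr_gt0.
  have cl : closed (inner_part m) by rewrite -openC; exact: oC.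
  apply: (closed_cvg _ cl _ _ (cg w nZ)).
  by exists k => // n /= kn; exact: hk.
apply: measurableU; apply: measurableI => //.
- exact: measurableC.
- apply: bigcup_measurable => m _; apply: bigcup_measurable => k _.
  by apply: bigcap_measurable => [|n _]; [exists k => /=|exact: mC].
- have [Az|nAz] := pselect (A z).
    by have -> : [set w : Omega | A z] = setT by apply/seteqP; split.
  by have -> : [set w : Omega | A z] = set0 by apply/seteqP; split => // w /=.
Qed.

Section borel_cantelli.
Context d (Omega : measurableType d) (R : realType) (P : probability Omega R).

Lemma geometric_borel_cantelli (F : nat -> set Omega) (C rho : R) :
  0 <= C -> 0 <= rho < 1 -> (forall n, measurable (F n)) ->
  (forall n, (P (F n) <= (C * rho ^+ n)%:E)%E) -> P.-negligible (lim_sup_set F).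
Proof.
move=> C0 r01 mF PF.
have m : measurable (lim_sup_set F).
  by apply: bigcap_measurable => // n _; apply: bigcup_measurable => k _.
apply/negligibleP => //; apply: lim_sup_set_cvg0 => //.
apply: le_lt_trans (ltry (C / (1 - rho))).
apply: lime_le; first by apply: is_cvg_nneseries => n _ _; exact: measure_ge0.
apply: nearW => n; apply: (@le_trans _ _ (\sum_(0 <= k < n) (C * rho ^+ k)%:E)%E).
  by apply: lee_sum => k _; exact: PF.
by rewrite sumEFin lee_fin big_mkord geometric_sum_le.
Qed.

Lemma measure_bigsetU_le n (A : nat -> set Omega) (c : R) :
  (forall j, measurable (A j)) -> (forall j, (j < n)%N -> (P (A j) <= c%:E)%E) ->
  (P (\big[setU/set0]_(j < n) A j) <= (n%:R * c)%:E)%E.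
Proof.
move=> mA; elim: n => [|n IH] PA; first by rewrite big_ord0 measure0 mul0r.
rewrite big_ord_recr/= (le_trans (measureU2 _ _ _))//.
  by apply: bigsetU_measurable.
rewrite -natr1 mulrDl mul1r EFinD leeD//; last exact: PA.
by apply: IH => j jn; apply: PA; exact: ltnW.
Qed.

Lemma not_lim_sup_set (F : nat -> set Omega) w : ~ lim_sup_set F w ->
  exists n0, forall n, (n0 <= n)%N -> ~ F n w.
Proof.
move=> /existsNP[n0 /not_implyP[_ h]]; exists n0 => n n0n Fn.
by apply: h; exists n.
Qed.

End borel_cantelli.

Section kolmogorov.
Context d (Omega : measurableType d) (R : realType) (P : probability Omega R).
Context (V : normedModType R) (u : R -> Omega -> V) (alpha : R).
Hypotheses (alpha0 : 0 < alpha)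
  (ru : forall t, 0 <= t -> random_element (u t))
  (mn : forall s t, 0 <= s -> 0 <= t -> measurable_fun setT (fun w => `|u t w - u s w|))
  (compl : forall (v : nat -> V) (C rho : R), 0 < C -> 0 < rho < 1 ->
     (forall n, `|v n.+1 - v n| <= C * rho ^+ n) ->
     exists l : V, forall n, `|l - v n| <= C * rho ^+ n / (1 - rho))
  (tail : forall (N : nat) (a : R), 0 < a < alpha -> exists2 c : R, 0 < c &
     forall s t h e, 0 <= s <= N%:R -> 0 <= t <= N%:R -> 0 < h -> `|t - s| <= h -> 0 < e ->
     (P [set w | (e <= `|u t w - u s w|)%R] <=
        (2 * expR (- (c * e ^+ 2 / h `^ (2 * a))))%:E)%E).

Let ratio (gamma : R) : R := 2 `^ (- gamma).

Lemma ratio_itv gamma : 0 < gamma -> 0 < ratio gamma < 1.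
Proof.
move=> g0; rewrite /ratio powR_gt0//= powRN invf_lt1 ?powR_gt0//.
by rewrite /powR pnatr_eq0/= expR_gt1 mulr_gt0// ln_gt0// ltr1n.
Qed.

Lemma tail_dyadic N gamma : 0 < gamma < alpha -> exists C : R, 0 <= C /\
  forall n s t, 0 <= s <= N%:R -> 0 <= t <= N%:R -> `|t - s| <= 2 ^- n ->
  (P [set w | (ratio gamma ^+ n <= `|u t w - u s w|)%R] <= (C * 4^-1 ^+ n)%:E)%E.
Proof.
move=> /andP[g0 ga]; pose a := (gamma + alpha) / 2.
have [|c c0 hc] := @tail N a; first by apply/andP; split; rewrite /a; lra.
pose theta : R := 2 `^ (2 * (a - gamma)).
have th1 : 1 < theta.
  rewrite /theta /powR pnatr_eq0/= expR_gt1 mulr_gt0 ?ln_gt0 ?ltr1n//.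
  by rewrite /a; lra.
have th0 : 0 < theta by lra.
have [m hm] : exists m, 4 <= theta ^+ m.+1.
  have : (fun n => theta^-1 ^+ n) @ \oo --> 0.
    by apply: cvg_expr; rewrite ger0_norm ?invr_ge0 ?ltW// invf_lt1.
  have q0 : (0 : R) < 4^-1 by rewrite invr_gt0.
  move=> /cvgrPdist_lt /(_ _ q0)[m _ /(_ m.+1 (leqnSn m))].
  rewrite /= sub0r normrN ger0_norm ?exprn_ge0 ?invr_ge0 ?ltW// exprVn.
  by rewrite ltf_pV2 ?posrE ?exprn_gt0// => /ltW ?; exists m.
exists (2 * (m.+1`!%:R / c ^+ m.+1)); split.
  by rewrite mulr_ge0// divr_ge0// exprn_ge0// ltW.
move=> n s t sN tN st.
have r0 : 0 < ratio gamma by have /andP[] := ratio_itv g0.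
apply: (le_trans (hc s t (2 ^- n) (ratio gamma ^+ n) sN tN _ st _)).
- by rewrite invr_gt0 exprn_gt0.
- by rewrite exprn_gt0.
rewrite lee_fin -[leRHS]mulrA ler_wpM2l//.
have -> : c * (ratio gamma ^+ n) ^+ 2 / (2 ^- n) `^ (2 * a) = c * theta ^+ n.
  rewrite -mulrA; congr (_ * _).
  have two (x y : R) : 2 `^ x * 2 `^ y = 2 `^ (x + y) :> R.
    by rewrite powRD// pnatr_eq0 implybT.
  have -> : ratio gamma ^+ n = 2 `^ (- gamma * n%:R).
    by rewrite powRrM powR_mulrn// powR_ge0.
  have -> : theta ^+ n = 2 `^ (2 * (a - gamma) * n%:R).
    by rewrite powRrM powR_mulrn// powR_ge0.
  rewrite -powR_invn// -powRrM -powRN expr2 !two; congr (_ `^ _); ring.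
set x := c * theta ^+ n.
have x0 : 0 < x by rewrite mulr_gt0// exprn_gt0.
have xm0 : 0 < x ^+ m.+1 by rewrite exprn_gt0.
have h1 : x ^+ m.+1 / m.+1`!%:R <= expR x.
  by have := expR_ge1Dxn m (ltW x0); lra.
rewrite expRN; apply: (@le_trans _ _ (m.+1`!%:R / x ^+ m.+1)).
  rewrite -[leRHS]invrK lef_pV2 ?posrE ?expR_gt0 ?invr_gt0 ?divr_gt0 ?ltr0n ?fact_gt0//.
  by rewrite invf_div.
rewrite /x exprMn invfM mulrA ler_wpM2l ?divr_ge0 ?exprn_ge0 ?(ltW c0)//.
rewrite exprVn lef_pV2 ?posrE ?exprn_gt0//.
by rewrite exprAC lerXn2r ?nnegrE// exprn_ge0// ltW.
Qed.

Definition increment_event gamma n j : set Omega :=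
  [set w | ratio gamma ^+ n <= `|u (dyad R n j.+1) w - u (dyad R n j) w|].

Definition bad_event N gamma n : set Omega :=
  \big[setU/set0]_(j < N * 2 ^ n) increment_event gamma n j.

Lemma measurable_increment_event gamma n j : measurable (increment_event gamma n j).
Proof. by apply: measurable_superlevel; apply: mn; exact: dyad_ge0. Qed.

Lemma measurable_bad_event N gamma n : measurable (bad_event N gamma n).
Proof.
by apply: bigsetU_measurable => j _; exact: measurable_increment_event.
Qed.

Lemma dyadS_sub n j : `|dyad R n j.+1 - dyad R n j| <= 2 ^- n.
Proof.
rewrite /dyad -mulrBl -natr1 addrAC subrr add0r mul1r ger0_norm//.
Qed.

Lemma dyad_le n j N : (j <= N * 2 ^ n)%N -> 0 <= dyad R n j <= N%:R.
Proof.
move=> jN; rewrite dyad_ge0/= ler_pdivrMr ?exprn_gt0//.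
by rewrite -natrX -natrM ler_nat.
Qed.

Lemma bad_event_negligible N gamma : 0 < gamma < alpha ->
  P.-negligible (lim_sup_set (bad_event N gamma)).
Proof.
move=> /(tail_dyadic N)[C [C0 hC]].
apply: (@geometric_borel_cantelli _ _ _ P _ (N%:R * C) 2^-1).
- exact: mulr_ge0.
- by apply/andP; split; lra.
- exact: measurable_bad_event.
move=> n; apply: (le_trans (measure_bigsetU_le (c := C * 4^-1 ^+ n) _ _)).
- by move=> j; exact: measurable_increment_event.
- move=> j jN; apply: hC; last exact: dyadS_sub.
    by apply: dyad_le; exact: ltnW.
  exact: dyad_le.
rewrite lee_fin natrM natrX le_eqVlt; apply/orP; left; apply/eqP.
have -> : (4^-1 : R) = 2^-1 * 2^-1 by rewrite -invfM; congr (_^-1); ring.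
rewrite exprMn !exprVn; field; by rewrite expf_neq0.
Qed.

Let gam m : R := alpha * (m.+1%:R / m.+2%:R).

Let gam_itv m : 0 < gam m < alpha.
Proof.
rewrite mulr_gt0 ?divr_gt0//= gtr_pMr// ltr_pdivrMr// mul1r ltr_nat//.
Qed.

Let gam_gt gamma : gamma < alpha -> exists m, gamma < gam m.
Proof.
move=> ga; have e0 : 0 < (alpha - gamma) / alpha by rewrite divr_gt0// subr_gt0.
have [m _ /(_ m.+1 (leqnSn m)) /= h] := near_infty_natSinv_lt (PosNum e0).
exists m; rewrite /gam.
have -> : m.+1%:R / m.+2%:R = 1 - m.+2%:R^-1 :> R.
  have n0 : m.+2%:R != 0 :> R by rewrite pnatr_eq0.
  by apply: (mulIf n0); rewrite mulrBl mul1r divfK// mulVf// -[m.+2%:R]natr1 addrK.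
have {}h : m.+2%:R^-1 < (alpha - gamma) / alpha := h.
move: h; rewrite ltr_pdivlMr// mulrBr mulr1 [alpha * _]mulrC.
by move: (_^-1 * alpha) => y; lra.
Qed.

Definition exceptional : set Omega :=
  \bigcup_m \bigcup_N lim_sup_set (bad_event N (gam m)).

Lemma measurable_exceptional : measurable exceptional.
Proof.
apply: bigcup_measurable => m _; apply: bigcup_measurable => N _.
apply: bigcap_measurable => [|k _]; first by exists 0%N.
by apply: bigcup_measurable => n _; exact: measurable_bad_event.
Qed.

Lemma exceptional_negligible : P.-negligible exceptional.
Proof.
apply: negligible_bigcup => m; apply: negligible_bigcup => N.
exact: bad_event_negligible.
Qed.

Definition modification (t : R) (w : Omega) : V :=
  if pselect (exceptional w) then 0 else lim ((fun n => u (dfloor n t) w) @ \oo).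

Lemma cvg_geometric_rate (v : nat -> V) (l : V) (K rho : R) (n0 : nat) : 0 < rho < 1 ->
  (forall n, (n0 <= n)%N -> `|l - v n| <= K * rho ^+ n) -> v @ \oo --> l.
Proof.
move=> /andP[r0 r1] h; apply/cvgrPdist_lt => e e0.
have : (fun n => K * rho ^+ n) @ \oo --> K * 0.
  by apply: cvgMl_tmp; apply: cvg_expr; rewrite ger0_norm// ltW.
rewrite mulr0 => /cvgrPdist_lt /(_ _ e0)[n1 _ hn1].
exists (maxn n0 n1) => // n /=; rewrite geq_max => /andP[n0n n1n].
apply: (le_lt_trans (h n n0n)); apply: le_lt_trans (hn1 n n1n).
by rewrite /= sub0r normrN ler_norm.
Qed.

Lemma modification_rate w m N : ~ exceptional w -> exists n0,
  (forall n j, (n0 <= n)%N -> (j < N * 2 ^ n)%N ->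
     `|u (dyad R n j.+1) w - u (dyad R n j) w| <= ratio (gam m) ^+ n) /\
  (forall n t, (n0 <= n)%N -> 0 <= t -> t < N%:R ->
     `|modification t w - u (dfloor n t) w| <= (1 - ratio (gam m))^-1 * ratio (gam m) ^+ n).
Proof.
move=> nw; have /andP[g0 ga] := gam_itv m.
have r01 := ratio_itv g0; have /andP[r0 r1] := r01.
have [n0 hn0] : exists n0, forall n, (n0 <= n)%N -> ~ bad_event N (gam m) n w.
  by apply: not_lim_sup_set => h; apply: nw; exists m => //; exists N.
have inc n j : (n0 <= n)%N -> (j < N * 2 ^ n)%N ->
     `|u (dyad R n j.+1) w - u (dyad R n j) w| <= ratio (gam m) ^+ n.
  move=> n0n jN; rewrite leNgt; apply/negP => /ltW h; apply: (hn0 n n0n).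
  by rewrite /bad_event -bigcup_mkord; exists j.
exists n0; split => // n t n0n t0 tN.
set rho := ratio (gam m) in r01 r0 r1 inc *.
have [l hl] : exists l : V, forall k, (n0 <= k)%N ->
    `|l - u (dfloor k t) w| <= (1 - rho)^-1 * rho ^+ k.
  have [||l hl] := @compl (fun k => u (dfloor (n0 + k) t) w) (rho ^+ n0) rho _ r01.
  - by rewrite exprn_gt0.
  - move=> k; rewrite addnS -exprD.
    have h := dfloor_refine (f := fun s => u s w) r01 inc (leq_addr k n0) t0 tN.
    by apply: (le_trans h); rewrite exprS ler_piMl ?exprn_ge0 ?(ltW r0) ?(ltW r1).
  exists l => k n0k; have := hl (k - n0)%N; rewrite subnKC// -exprD subnKC//.
  by rewrite mulrC.
have -> : modification t w = l.
  rewrite /modification; case: (pselect (exceptional w)) => [/nw|nwx] //=.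
  by apply: (cvg_lim _ (cvg_geometric_rate r01 hl)); exact: norm_hausdorff.
exact: hl.
Qed.

Lemma modification_random_element t : 0 <= t -> random_element (modification t).
Proof.
move=> t0; apply: (@random_element_cvg d Omega R V exceptional
  (fun n => u (dfloor n t)) (modification t) 0).
- exact: measurable_exceptional.
- by move=> n; apply: ru; exact: dfloor_ge0.
- move=> w nw; have [n0 [_ h]] := modification_rate 0 (Num.truncn t).+1 nw.
  have /andP[g0 ga] := gam_itv 0.
  have /andP[_ tN] := truncn_itv t0.
  apply: (@cvg_geometric_rate _ _ (1 - ratio (gam 0))^-1 _ n0 (ratio_itv g0)) => n n0n.
  exact: h.
- by move=> w ew; rewrite /modification; case: (pselect (exceptional w)).
Qed.

Lemma modification_ae t : 0 <= t -> {ae P, forall w, modification t w = u t w}.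
Proof.
move=> t0; have /andP[_ tN] := truncn_itv t0; set N := (Num.truncn t).+1 in tN.
have g01 := gam_itv 0; have /andP[g0 ga] := g01.
have [C [C0 hC]] := tail_dyadic N g01.
pose A n := [set w | ratio (gam 0) ^+ n <= `|u t w - u (dfloor n t) w|].
have nA : P.-negligible (lim_sup_set A).
  apply: (@geometric_borel_cantelli _ _ _ P A C 4^-1) => //.
  - by apply/andP; split; lra.
  - by move=> n; apply: measurable_superlevel; apply: mn => //; exact: dfloor_ge0.
  move=> n; have [d1 d2] := dfloor_itv n t0; apply: hC.
  - by rewrite dfloor_ge0 (le_trans d1)// ltW.
  - by rewrite t0 ltW.
  - by rewrite ger0_norm// subr_ge0.
apply: negligibleS (negligibleU exceptional_negligible nA) => w /= h.
apply: contrapT => /not_orP[nw nAw]; apply: h.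
have [n0 [_ h0]] := modification_rate 0 N nw.
have [n1 h1] := not_lim_sup_set nAw.
have c1 : (fun n => u (dfloor n t) w) @ \oo --> modification t w.
  apply: (@cvg_geometric_rate _ _ (1 - ratio (gam 0))^-1 _ n0 (ratio_itv g0)) => n n0n.
  exact: h0.
have c2 : (fun n => u (dfloor n t) w) @ \oo --> u t w.
  apply: (@cvg_geometric_rate _ _ 1 _ n1 (ratio_itv g0)) => n n1n.
  by rewrite mul1r leNgt; apply/negP => /ltW; exact: h1.
exact: cvg_unique c1 c2.
Qed.

Lemma modification_hoelder w (T : R) gamma : ~ exceptional w -> 0 < gamma < alpha ->
  exists2 C : R, 0 < C & forall s t, 0 <= s <= T -> 0 <= t <= T ->
    `|modification t w - modification s w| <= C * `|t - s| `^ gamma.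
Proof.
move=> nw /andP[g0 ga]; have [m gm] := gam_gt ga.
have /andP[gm0 _] := gam_itv m.
pose N := (Num.truncn `|T|).+1.
have TN : T < N%:R.
  have /andP[_ h] := truncn_itv (normr_ge0 T); exact: le_lt_trans (ler_norm T) h.
have [n0 [inc rate]] := modification_rate m N nw.
have r01 := ratio_itv gm0; have /andP[r0 r1] := r01.
have K0 : 0 <= (1 - ratio (gam m))^-1 by rewrite invr_ge0 subr_ge0 ltW.
have [C C0 hC] := dyadic_hoelder (f := fun t => u t w) (l := fun t => modification t w)
  r01 inc K0 rate gm0 erefl.
exists (C * N%:R `^ (gam m - gamma)); first by rewrite mulr_gt0 ?powR_gt0.
move=> s t /andP[s0 sT] /andP[t0 tT].
have sN := le_lt_trans sT TN; have tN := le_lt_trans tT TN.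
apply: (le_trans (hC s t _ _)); rewrite ?s0 ?t0//.
rewrite -mulrA ler_wpM2l ?(ltW C0)//.
have [->|st] := eqVneq t s; first by rewrite subrr normr0 !powR0 ?gt_eqF ?mulr0//.
have d0 : 0 < `|t - s| by rewrite normr_gt0 subr_eq0.
have -> : `|t - s| `^ gam m = `|t - s| `^ (gam m - gamma) * `|t - s| `^ gamma.
  rewrite -powRD; last by rewrite (gt_eqF d0) implybT.
  by rewrite subrK.
rewrite ler_wpM2r ?powR_ge0//; apply: ge0_ler_powR; rewrite ?nnegrE ?subr_ge0 ?(ltW gm)//.
rewrite ler_norml; apply/andP; split; lra.
Qed.

End kolmogorov.

(** * The stochastic wave equation *)

Section real_bounds.
Context (R : realType).

Lemma zeta_partial_sum (del : R) n : 0 < del ->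
  \sum_(k < n) k.+1%:R `^ (- (1 + del)) <= 1 + del^-1.
Proof.
move=> d0; have di0 : 0 <= del^-1 by rewrite invr_ge0 ltW.
case: n => [|n]; first by rewrite big_ord0 addr_ge0.
suff h : \sum_(k < n.+1) k.+1%:R `^ (- (1 + del)) <=
    1 + del^-1 - n.+1%:R `^ (- del) * del^-1.
  by apply: (le_trans h); rewrite gerBl mulr_ge0// powR_ge0.
elim: n => [|n IH].
  by rewrite big_ord_recl big_ord0 !powR1 mul1r addr0; lra.
rewrite big_ord_recr/=; apply: (le_trans (lerD IH (lexx _))).
set x : R := n.+2%:R; set y : R := n.+1%:R.
have y0 : 0 < y by rewrite /y.
have x0 : 0 < x by rewrite /x.
have xy : x = y + 1 by rewrite /x /y natr1.
have ln1 : x^-1 <= ln x - ln y.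
  have : ln (y / x) <= y / x - 1.
    have yx : y / x \is Num.pos by rewrite posrE divr_gt0.
    by have := expR_ge1Dx (ln (y / x)); rewrite (lnK yx); move: (y / x) => z; lra.
  rewrite ln_div ?posrE// xy; move: (ln _) (ln _) => p q.
  have -> : y / (y + 1) - 1 = - (y + 1)^-1.
    by field; apply: lt0r_neq0; lra.
  lra.
have key : x `^ (- del) * (1 + del / x) <= y `^ (- del).
  rewrite /powR !gt_eqF//.
  have -> : - del * ln y = - del * ln x + del * (ln x - ln y) by ring.
  rewrite expRD ler_wpM2l ?expR_ge0//.
  apply: le_trans (expR_ge1Dx _); rewrite lerD2l ler_wpM2l ?(ltW d0)//.
have -> : x `^ (- (1 + del)) = x `^ (- del) / x.
  rewrite opprD addrC powRD ?powR_inv1 ?(ltW x0)//.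
  by rewrite (gt_eqF x0) implybT.
have : x `^ (- del) * (1 + del / x) * del^-1 <= y `^ (- del) * del^-1.
  by rewrite ler_wpM2r.
have -> : x `^ (- del) * (1 + del / x) * del^-1 =
    x `^ (- del) * del^-1 + x `^ (- del) / x.
  by field; rewrite !gt_eqF.
move: (x `^ (- del) / del) (x `^ (- del) / x) (y `^ (- del) / del) => A1 A2 A3; lra.
Qed.

Lemma interpolation_bound (a h y l l' : R) : 0 < a < 1 -> 0 < h -> 0 <= y ->
  y <= h ^+ 2 -> 0 < l' <= l -> l * y <= 4 ->
  y <= 4 * (h `^ (2 * a) * l' `^ (- (1 - a))).
Proof.
move=> /andP[a0 a1] h0 y0 yh /andP[l'0 ll] ly.
have l0 : 0 < l by exact: lt_le_trans ll.
have b0 : 0 < 1 - a by lra.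
have [->|yn] := eqVneq y 0.
  by rewrite !mulr_ge0 ?powR_ge0.
have yp : 0 < y by rewrite lt_neqAle eq_sym yn.
have -> : y = y `^ a * y `^ (1 - a).
  rewrite -powRD; last by rewrite yn implybT.
  by rewrite addrC subrK powRr1.
have e1 : y `^ a <= h `^ (2 * a).
  rewrite powRrM powR_mulrn ?(ltW h0)//.
  by apply: ge0_ler_powR; rewrite ?nnegrE ?(ltW a0)// exprn_ge0// ltW.
have e2 : y `^ (1 - a) <= 4 * l' `^ (- (1 - a)).
  apply: (@le_trans _ _ ((4 / l') `^ (1 - a))).
    apply: ge0_ler_powR; rewrite ?nnegrE ?(ltW b0) ?divr_ge0 ?(ltW l'0)//.
    rewrite ler_pdivlMr// mulrC (le_trans _ ly)// ler_wpM2r//.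
  rewrite powRM ?invr_ge0 ?(ltW l'0)//.
  have -> : l'^-1 `^ (1 - a) = l' `^ (- (1 - a)).
    by rewrite -powR_inv1 ?(ltW l'0)// -powRrM mulN1r.
  rewrite ler_wpM2r ?powR_ge0//; apply: ler1_powR; lra.
rewrite mulrCA mulrA -mulrA [leRHS]mulrCA.
have := ler_pM (powR_ge0 y a) (powR_ge0 y (1 - a)) e1 e2.
by move=> /le_trans; apply; rewrite mulrCA.
Qed.

End real_bounds.

Lemma damped_measurable (R : realType) (v : R -> R) (t : R) :
  {within `[0, +oo[, continuous v} ->
  measurable_fun `[0, t]%classic (fun s => v (t - s)).
Proof.
move=> cv.
rewrite -[X in measurable_fun _ X]/(v \o (fun s : R => t - s)).
apply: (measurable_comp (F := `[0, +oo[%classic : set R)).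
- exact: measurable_itv.
- move=> _ [s /= + <-]; rewrite !in_itv/= andbT => /andP[_ st].
  by rewrite subr_ge0.
- by apply: subspace_continuous_measurable_fun => //; exact: measurable_itv.
- by apply: measurable_funB.
Qed.

Section spde.
Context (R : realType) d' (T : measurableType d') (mu : {measure set T -> \bar R}).
Variables (phi : nat -> 'L2 mu) (hphi : orthonormal_basis phi) (lambda : nat -> R).
Variables (dH c0 : R).
Hypotheses (dH0 : 0 < dH) (c00 : 0 < c0) (lambda0 : 0 <= lambda 0%N)
  (weyl : forall n, (0 < n)%N -> c0 * n%:R `^ ((dH + 1) / dH) <= lambda n).
Variables (beta : R) (hbeta : 0 <= beta) (V : R -> R -> R)
  (hV : forall x, 0 <= x -> damped_solution beta x (V x)).
Context d (Omega : measurableType d) (P : probability Omega R).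
Variables (W : 'L2 mu -> R -> Omega -> R) (hW : cylindrical_wiener P W)
  (u : R -> Omega -> 'L2 mu) (hu : spde_solution P W phi lambda V u).

Lemma lambda_ge0 k : 0 <= lambda k.
Proof.
case: k => // k; apply: le_trans (weyl (ltn0Sn k)).
by rewrite mulr_ge0 ?powR_ge0// ltW.
Qed.

(* The variance bound [min (h ^ 2) (1 / lambda_k)] interpolated between its two
   terms: summable in [k] as soon as [a < 1 / (dH + 1)]. *)
Let kappa (D a : R) (k : nat) : R :=
  if k is n.+1 then (c0 * n.+1%:R `^ ((dH + 1) / dH)) `^ (- (1 - a)) else D ^+ 2.

Lemma kappa_gt0 D a k : 0 < D -> 0 < kappa D a k.
Proof.
move=> D0; case: k => [|k] /=; first by rewrite exprn_gt0.
by rewrite powR_gt0// mulr_gt0// powR_gt0.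
Qed.

Lemma kappa_summable D a : 0 < D -> 0 < a < (dH + 1)^-1 -> exists S : R, 0 < S /\
  forall n, \sum_(k < n) kappa D a k <= S.
Proof.
move=> D0 /andP[a0 a1]; have d1 : 0 < dH + 1 by rewrite addr_gt0.
pose del := (dH + 1) / dH * (1 - a) - 1.
have del0 : 0 < del.
  have : a * (dH + 1) < 1 by rewrite -ltr_pdivlMr// div1r.
  rewrite /del mulrAC subr_gt0 ltr_pdivlMr// mul1r; nra.
exists (D ^+ 2 + c0 `^ (- (1 - a)) * (1 + del^-1)).
have p0 : 0 < c0 `^ (- (1 - a)) by exact: powR_gt0.
have z0 : 0 <= c0 `^ (- (1 - a)) * (1 + del^-1).
  by rewrite mulr_ge0 ?(ltW p0)// addr_ge0// invr_ge0 ltW.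
split; first by rewrite ltr_pwDl// exprn_gt0.
case=> [|n]; first by rewrite big_ord0 addr_ge0// sqr_ge0.
rewrite big_ord_recl/= lerD2l.
apply: (@le_trans _ _ (\sum_(k < n) c0 `^ (- (1 - a)) * k.+1%:R `^ (- (1 + del)))).
  apply: ler_sum => k _; rewrite powRM ?powR_ge0 ?(ltW c00)//.
  rewrite -powRrM le_eqVlt; apply/orP; left; apply/eqP; congr (_ * _ `^ _).
  by rewrite /del; ring.
by rewrite -mulr_sumr ler_wpM2l ?(ltW p0)// zeta_partial_sum.
Qed.

Lemma kappa_bound k a h D x y : 0 < a < 1 -> 0 < h -> 1 <= D -> 0 <= y ->
  0 <= x <= h -> x <= D -> y <= x ^+ 2 -> lambda k * y <= 4 ->
  y <= 4 * (h `^ (2 * a) * kappa D a k).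
Proof.
move=> a01 h0 D1 y0 /andP[x0 xh] xD yx ly; have /andP[a0 a1] := a01.
have yh : y <= h ^+ 2 by apply: (le_trans yx); rewrite ler_sqr ?nnegrE// ltW.
case: k ly => [|k] ly /=; last first.
  apply: (@interpolation_bound _ a h y (lambda k.+1)) => //.
  by apply/andP; split; [rewrite mulr_gt0// powR_gt0|exact: weyl].
have -> : h `^ (2 * a) = (h ^+ 2) `^ a.
  by rewrite powRrM powR_mulrn// ltW.
have r0 : 0 <= (h ^+ 2) `^ a * D ^+ 2.
  by apply: mulr_ge0; [exact: powR_ge0|exact: sqr_ge0].
have [->|yn] := eqVneq y 0; first exact: mulr_ge0.
have yp : 0 < y by rewrite lt_neqAle eq_sym yn.
have yE : y = y `^ a * y `^ (1 - a).
  rewrite -powRD; last by rewrite yn implybT.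
  by rewrite addrC subrK powRr1.
have e1 : y `^ a <= (h ^+ 2) `^ a.
  by apply: ge0_ler_powR; rewrite ?nnegrE ?(ltW a0)// sqr_ge0.
have yD : y <= D ^+ 2.
  by apply: (le_trans yx); rewrite ler_sqr ?nnegrE// (le_trans x0).
have e2 : y `^ (1 - a) <= D ^+ 2.
  apply: (@le_trans _ _ ((D ^+ 2) `^ (1 - a))).
    by apply: ge0_ler_powR; rewrite ?nnegrE ?sqr_ge0//; lra.
  by apply: ler1_powR; [rewrite exprn_ege1|lra].
have h4 := ler_pM (powR_ge0 y a) (powR_ge0 y (1 - a)) e1 e2.
rewrite -yE in h4; apply: (le_trans h4).
by rewrite ler_peMl// ler1n.
Qed.

Lemma kernel_bound k s t v a h D : 0 < a < 1 -> 0 < h -> 0 <= s <= t -> t - s <= h ->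
  t - s <= D -> 1 <= D -> 0 <= v <= s ->
  (V (lambda k) (t - v) - V (lambda k) (s - v)) ^+ 2 <= 4 * (h `^ (2 * a) * kappa D a k).
Proof.
move=> a01 h0 /andP[s0 st] tsh tsD D1 /andP[v0 vs].
have l0 := lambda_ge0 k; have sv := hV l0.
have tv0 : 0 <= t - v by lra.
have sv0 : 0 <= s - v by lra.
apply: (@kappa_bound _ _ _ _ (t - s)) => //; rewrite ?sqr_ge0 ?subr_ge0 ?st//.
  have := damped_lipschitz hbeta l0 sv sv0 tv0.
  rewrite (_ : t - v - (s - v) = t - s); last by ring.
  rewrite -ler_sqr ?nnegrE// !real_normK ?num_real//.
have := damped_bound hbeta sv tv0; have := damped_bound hbeta sv sv0.
move: (V _ _) (V _ _) => p q hp hq.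
have := mulr_ge0 l0 (sqr_ge0 (p + q)); nra.
Qed.

Lemma kernel_bound_end k s t v a h D : 0 < a < 1 -> 0 < h -> 0 <= s <= t -> t - s <= h ->
  t - s <= D -> 1 <= D -> s < v <= t ->
  V (lambda k) (t - v) ^+ 2 <= 4 * (h `^ (2 * a) * kappa D a k).
Proof.
move=> a01 h0 /andP[s0 st] tsh tsD D1 /andP[sv vt].
have l0 := lambda_ge0 k; have sol := hV l0.
have tv0 : 0 <= t - v by lra.
apply: (@kappa_bound _ _ _ _ (t - s)) => //; rewrite ?sqr_ge0 ?subr_ge0 ?st//.
  have := damped_lipschitz hbeta l0 sol (lexx 0) tv0.
  rewrite (damped0 sol) !subr0 -ler_sqr ?nnegrE// !real_normK ?num_real// => /le_trans; apply.
  by rewrite ler_sqr ?nnegrE ?subr_ge0//; lra.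
by have := damped_bound hbeta sol tv0; lra.
Qed.

Lemma spde_tail (N : nat) (a : R) : 0 < a < (dH + 1)^-1 -> exists2 c : R, 0 < c &
  forall s t h e, 0 <= s <= N%:R -> 0 <= t <= N%:R -> 0 < h -> `|t - s| <= h -> 0 < e ->
  (P [set w | (e <= `|u t w - u s w|)%R] <=
     (2 * expR (- (c * e ^+ 2 / h `^ (2 * a))))%:E)%E.
Proof.
move=> ha; have /andP[a0 aa] := ha.
pose D : R := N%:R + 1; have D1 : 1 <= D by rewrite lerDr.
have D0 : 0 < D by lra.
have [S [S0 hS]] := kappa_summable D0 ha.
have a1 : a < 1.
  apply: (lt_le_trans aa); rewrite invf_le1 ?lerDr ?(ltW dH0)// addr_gt0//.
have a01 : 0 < a < 1 by rewrite a0.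
exists (128 * (12 * D * S))^-1; first by rewrite invr_gt0 !mulr_gt0.
move=> s t h e sN tN h0 + e0.
wlog st : s t sN tN / s <= t.
  move=> W'; have [st|ts] := leP s t; first exact: W'.
  have -> : [set w | e <= `|u t w - u s w|] = [set w | e <= `|u s w - u t w|].
    by apply/seteqP; split => w /=; rewrite distrC.
  by rewrite distrC; apply: W' => //; exact: ltW.
rewrite ger0_norm ?subr_ge0// => tsh.
have /andP[s0 sN'] := sN; have /andP[t0 tN'] := tN.
have [X hX] := hu.
have [Ws rs cs] := hX s s0; have [Wt rt ct] := hX t t0.
have tsD : t - s <= D by rewrite /D; lra.
have hp : 0 < h `^ (2 * a) by exact: powR_gt0.
pose q k := 12 * (t + 1) * (h `^ (2 * a) * kappa D a k).
have q0 k : 0 < q k.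
  by apply: mulr_gt0; apply: mulr_gt0 => //; [lra|exact: kappa_gt0].
have qQ n : \sum_(k < n) q k <= 12 * D * S * h `^ (2 * a).
  rewrite /q -mulr_sumr -mulr_sumr.
  have t1D : t + 1 <= D by rewrite /D; lra.
  rewrite (_ : 12 * D * S * _ = 12 * D * (h `^ (2 * a) * S)); last by ring.
  apply: ler_pM; rewrite ?mulr_ge0 ?addr_ge0 ?(ltW hp)//.
  - by apply: sumr_ge0 => k _; rewrite ltW// kappa_gt0.
  - by rewrite ler_wpM2l.
  - by rewrite ler_wpM2l ?(ltW hp).
have -> : (128 * (12 * D * S))^-1 * e ^+ 2 / h `^ (2 * a) =
    e ^+ 2 / (128 * (12 * D * S * h `^ (2 * a))).
  by field; rewrite !gt_eqF.
apply: (gaussian_series_tail hphi (q := q) rs rt _ _ cs ct q0 qQ _ e0).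
- by move=> k; exact: (Ws k).1.
- by move=> k; exact: (Wt k).1.
move=> k e' e'0; have [G C] := hW; have [orth _] := hphi.
apply: (@wiener_increment _ _ _ P (W (phi k)) _ _ s t (h `^ (2 * a) * kappa D a k)
  (fun v => V (lambda k) (s - v)) (fun v => V (lambda k) (t - v))) => //.
- by move=> n c t' ht'; exact: (G n c (fun=> phi k) t' ht').
- by move=> s' t' hs ht; rewrite C// orth eqxx mulr1.
- by rewrite mulr_gt0// kappa_gt0.
- exact: damped_measurable (damped_continuous (hV (lambda_ge0 k))).
- exact: damped_measurable (damped_continuous (hV (lambda_ge0 k))).
- by move=> v vs; apply: kernel_bound => //; rewrite s0.
- by move=> v vs; apply: (@kernel_bound_end _ s) => //; rewrite s0.
Qed.

End spde.

Theorem theorem3p3 (R : realType)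
  (M : nat) (hM : (2 <= M)%N) (F : pMetricType R)
  (hFconn : connected [set: F]) (hFcomp : compact [set: F])
  (psi : 'I_M -> F -> F) (hpsi : self_similar psi)
  (code : (nat -> 'I_M) -> F) (hcode : is_coding_map psi code)
  (hpcf : finite_set (post_critical_set psi code))
  (a : F -> F -> R) (r : 'I_M -> R)
  (har : regular_harmonic_structure psi (boundary psi code) a r)
  (dH : R) (hdH : \sum_i r i `^ dH = 1)
  (mu : probability (borelType F) R)
  (hmu : forall w : seq 'I_M, mu (cell psi w) = (weight r w `^ dH)%:E)
  (b : set F) (hb : b `<=` boundary psi code)
  (phi : nat -> 'L2 mu) (lambda : nat -> R)
  (hphi : orthonormal_basis phi)
  (heig : forall k, generator psi (boundary psi code) a r b
    (phi k) (- lambda k *: phi k))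
  (hlambda0 : 0 <= lambda 0%N)
  (hlambda : forall k, lambda k <= lambda k.+1)
  (beta : R) (hbeta : 0 <= beta)
  (V : R -> R -> R)
  (hV : forall x, 0 <= x -> damped_solution beta x (V x))
  (d : measure_display) (Omega : measurableType d) (P : probability Omega R)
  (W : 'L2 mu -> R -> Omega -> R) (hW : cylindrical_wiener P W)
  (u : R -> Omega -> 'L2 mu) (hu : spde_solution P W phi lambda V u) :
  exists u' : R -> Omega -> 'L2 mu,
    [/\ forall t, 0 <= t -> random_element (u' t),
        forall t, 0 <= t -> {ae P, forall w, u' t w = u t w} &
        forall T, 0 < T -> {ae P, forall w,
          @essentially_hoelder R R^o ('L2 mu) `[0, T]
            (1 - spectral_dim dH / 2) (fun t => u' t w)}].
Proof.
have d0 := dimension_gt0 hM har hdH.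
have d1 : 0 < dH + 1 by rewrite addr_gt0.
have [c c0 weyl] := eigenvalue_lower_bound hM hFconn hFcomp hpsi hcode hpcf har
  hdH hmu hphi heig hlambda.
have alphaE : 1 - spectral_dim dH / 2 = (dH + 1)^-1.
  by rewrite /spectral_dim; field; rewrite gt_eqF.
have alpha0 : 0 < (dH + 1)^-1 by rewrite invr_gt0.
have ru t : 0 <= t -> random_element (u t).
  by have [X hX] := hu; move=> /hX[].
have mn s t : 0 <= s -> 0 <= t -> measurable_fun setT (fun w => `|u t w - u s w|).
  by move=> s0 t0; apply: (measurable_normB hphi); exact: ru.
have tail := spde_tail hphi d0 c0 hlambda0 weyl hbeta hV hW hu.
have compl (v : nat -> 'L2 mu) := @L2_geometric_cvg _ _ _ mu v.
exists (modification u ((dH + 1)^-1)); split.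
- move=> t; exact: (modification_random_element alpha0 ru mn compl).
- move=> t; exact: (modification_ae alpha0 mn compl tail).
move=> T T0; rewrite alphaE.
apply: negligibleS (exceptional_negligible alpha0 mn tail) => w /= h.
apply: contrapT => nw; apply: h => gamma hg.
have [C C0 hC] := modification_hoelder alpha0 compl T nw hg.
exists C => // s t; rewrite /= !in_itv/= => sT tT.
have hst := hC s t sT tT; rewrite distrC in hst.
exact: hst.
Qed.
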